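(* Let $k,\ell\ge1$ be integers and let $U\subset\mathbb{R}^2$ be a non-empty open set. Suppose $f\in\mathcal{E}'(S^k\times S^\ell)$ satisfies $f|_U=\lambda w'$ (restricted to $U$) for some $w'\in\mathcal{E}'(S^{k-1}\times S^{\ell-1})$, and the mixed ray transform $L_{k,\ell}f$ vanishes on all lines passing through $U$. Then there exist $u\in\mathcal{E}'(S^{k-1}\times S^\ell)$ and $w\in\mathcal{E}'(S^{k-1}\times S^{\ell-1})$ such that $f=\mathrm{d}'u+\lambda w$.
   Context: $\mathcal{E}'(S^k\times S^\ell)$ denotes $(k+\ell)$-tensor fields on $\mathbb{R}^2$, symmetric in the first $k$ indices and symmetric in the last $\ell$ indices, whose components are compactly supported distributions. Repeated indices are summed over $\{1,2\}$. $\sigma(i_1,\dots,i_p)$ denotes symmetrization over the indicated indices (average over all permutations). Operators (acting on smooth or distributional tensor fields): $(\mathrm{d}'u)_{i_1\dots i_kj_1\dots j_\ell}=\sigma(i_1,\dots,i_k)\,\partial_{x^{i_1}}u_{i_2\dots i_kj_1\dots j_\ell}$ and $(\lambda w)_{i_1\dots i_kj_1\dots j_\ell}=\sigma(i_1,\dots,i_k)\sigma(j_1,\dots,j_\ell)\,\delta_{i_1j_1}w_{i_2\dots i_kj_2\dots j_\ell}$. $T\mathbb{S}^1=\{(x,\xi)\in\mathbb{R}^2\times\mathbb{S}^1:\langle x,\xi\rangle=0\}$ parametrizes lines $\{x+t\xi:t\in\mathbb{R}\}$. For smooth compactly supported $f$, $L_{k,\ell}f(x,\xi)=\int_{-\infty}^\infty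 f_{i_1\dots i_kj_1\dots j_\ell}(x+t\xi)\,\xi^{i_1}\cdots\xi^{i_k}\eta^{j_1}\cdots\eta^{j_\ell}\,dt$, where $\eta=\xi^\perp=(-\xi_2,\xi_1)$. Its formal $L^2$ adjoint is $((L_{k,\ell})^*g)_{i_1\dots i_kj_1\dots j_\ell}(x)=\int_{\mathbb{S}^1}\xi^{i_1}\cdots\xi^{i_k}\eta^{j_1}\cdots\eta^{j_\ell}\,g(x-\langle x,\xi\rangle\xi,\xi)\,dS_\xi$. For $f\in\mathcal{E}'(S^k\times S^\ell)$, $L_{k,\ell}f\in\mathcal{D}'(T\mathbb{S}^1)$ is defined by $\langle L_{k,\ell}f,g\rangle=\langle f,(L_{k,\ell})^*g\rangle$ for $g\in C_c^\infty(T\mathbb{S}^1)$. That $L_{k,\ell}f$ vanishes on all lines passing through $U$ means that this distribution vanishes on the open set of $(x,\xi)\in T\mathbb{S}^1$ whose line meets $U$. *)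

(* Defs.v *)
From HB Require Import structures.
From mathcomp Require Import all_boot all_order all_algebra all_fingroup.
From mathcomp Require Import all_classical all_reals all_analysis.

Set Implicit Arguments.
Unset Strict Implicit.
Unset Printing Implicit Defensive.

Import Order.TTheory GRing.Theory Num.Theory.
Import numFieldNormedType.Exports.

Local Open Scope classical_set_scope.
Local Open Scope ring_scope.

Section SmoothFunctions.
Context {R : realType}.
Implicit Types phi : 'rV[R]_2 -> R.

Definition partial (i : 'I_2) phi : 'rV[R]_2 -> R :=
  fun x => 'D_(delta_mx 0 i) phi x.

Definition partials (s : seq 'I_2) phi : 'rV[R]_2 -> R := foldr partial phi s.

Definition smooth phi : Prop := forall s : seq 'I_2,
  continuous (partials s phi) /\
  forall i x, derivable (partials s phi) x (delta_mx 0 i).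

Definition supp phi : set 'rV[R]_2 := closure [set x | phi x != 0].

(* phi \in C_c^oo(W) *)
Definition test_function (W : set 'rV[R]_2) phi : Prop :=
  [/\ smooth phi, compact (supp phi) & supp phi `<=` W].

End SmoothFunctions.

Section Distributions.
Context {R : realType}.

(* Functionals are total on 'rV[R]_2 -> R, but only their values on smooth
   functions carry information. *)
Definition functional : Type := ('rV[R]_2 -> R) -> R.

Implicit Types T S : functional.

Definition linear_on_smooth T : Prop :=
  forall (a : R) (phi psi : 'rV[R]_2 -> R), smooth phi -> smooth psi ->
    T (fun x => a * phi x + psi x) = a * T phi + T psi.

(* On every compact K, |<T, phi>| <= C * max_(|alpha| <= N) sup_K |D^alpha phi|
   for phi \in C_c^oo(K); the maximum of the suprema is expressed through its
   upper bounds M. *)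
Definition locally_finite_order T : Prop :=
  forall K : set 'rV[R]_2, compact K -> exists (C : R) (N : nat), 0 <= C /\
    forall phi, test_function K phi ->
    forall M : R, 0 <= M ->
      (forall s : seq 'I_2, (size s <= N)%N ->
         forall x, K x -> `|partials s phi x| <= M) ->
      `|T phi| <= C * M.

(* T is supported in a compact K.  As phi need not have compact support here,
   T phi = T (chi * phi) for each smooth phi and each chi \in C_c^oo which is 1
   near K: T agrees on smooth functions with the canonical extension of its
   restriction to C_c^oo. *)
Definition compactly_supported T : Prop :=
  exists2 K : set 'rV[R]_2, compact K &
    forall phi, smooth phi -> supp phi `&` K = set0 -> T phi = 0.

(* E'(R^2) *)
Definition compact_distribution T : Prop :=
  [/\ linear_on_smooth T, locally_finite_order T & compactly_supported T].

(* equality of the restrictions to an open set W *)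
Definition eq_distr_on (W : set 'rV[R]_2) T S : Prop :=
  forall phi, test_function W phi -> T phi = S phi.

Definition distr_partial (i : 'I_2) T : functional :=
  fun phi => - T (partial i phi).

End Distributions.

Arguments functional : clear implicits.

Section Tensors.
Context {R : realType}.

(* (k + l)-tensors on the plane with functionals as components: component
   u_{i_1 ... i_k j_1 ... j_l} is u [tuple i_1; ...; i_k] [tuple j_1; ...; j_l] *)
Definition tensor (k l : nat) : Type :=
  k.-tuple 'I_2 -> l.-tuple 'I_2 -> functional R.

Definition permute_idx n (s : 'S_n) (I : n.-tuple 'I_2) : n.-tuple 'I_2 :=
  [tuple tnth I (s a) | a < n].

Definition symmetrize n (A : n.-tuple 'I_2 -> R) (I : n.-tuple 'I_2) : R :=
  (n`!%:R)^-1 * \sum_(s : 'S_n) A (permute_idx s I).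

(* f \in E'(S^k x S^l) *)
Definition compact_tensor_distribution k l (f : tensor k l) : Prop :=
  [/\ forall I J, compact_distribution (f I J),
      forall (s : 'S_k) I J, eq_distr_on setT (f (permute_idx s I) J) (f I J)
    & forall (s : 'S_l) I J, eq_distr_on setT (f I (permute_idx s J)) (f I J)].

Definition eq_tensor_on (W : set 'rV[R]_2) k l (f g : tensor k l) : Prop :=
  forall I J, eq_distr_on W (f I J) (g I J).

Definition add_tensor k l (f g : tensor k l) : tensor k l :=
  fun I J phi => f I J phi + g I J phi.

Definition dprime k l (u : tensor k l) : tensor k.+1 l :=
  fun I J phi =>
    symmetrize (fun I' : k.+1.-tuple 'I_2 =>
      distr_partial (thead I') (u (behead_tuple I') J) phi) I.

Definition lambda k l (w : tensor k l) : tensor k.+1 l.+1 :=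
  fun I J phi =>
    symmetrize (fun I' : k.+1.-tuple 'I_2 =>
      symmetrize (fun J' : l.+1.-tuple 'I_2 =>
        (thead I' == thead J')%:R * w (behead_tuple I') (behead_tuple J') phi)
      J) I.

End Tensors.

Arguments tensor : clear implicits.

Section MixedRayTransform.
Context {R : realType}.
Implicit Types (x xi : 'rV[R]_2) (g : 'rV[R]_2 * 'rV[R]_2 -> R).

Definition dotp x xi : R := \sum_(i < 2) x 0 i * xi 0 i.

Definition perp xi : 'rV[R]_2 :=
  \row_(j < 2) (if j == 0 then - xi 0 1 else xi 0 0).

(* the circle is parametrized by angle, which is also its arc length *)
Definition unit_vector (theta : R) : 'rV[R]_2 :=
  \row_(j < 2) (if j == 0 then cos theta else sin theta).

(* Only the values of g on TS1 matter in the definitions below. *)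
Definition TS1 : set ('rV[R]_2 * 'rV[R]_2) :=
  [set p | dotp p.2 p.2 = 1 /\ dotp p.1 p.2 = 0].

(* The smooth structure of TS1 is the one for which the covering map
   (theta, r) |-> (r xi^perp, xi), xi = (cos theta, sin theta), from the plane
   onto TS1 is a local diffeomorphism. *)
Definition smooth_TS1 g : Prop :=
  smooth (fun q : 'rV[R]_2 =>
    g (q 0 1 *: perp (unit_vector (q 0 0)), unit_vector (q 0 0))).

(* TS1 is closed in R^2 x R^2, so this is also the closure in TS1. *)
Definition supp_TS1 g : set ('rV[R]_2 * 'rV[R]_2) :=
  closure [set p | TS1 p /\ g p != 0].

Definition test_function_TS1 (V : set ('rV[R]_2 * 'rV[R]_2)) g : Prop :=
  [/\ smooth_TS1 g, compact (supp_TS1 g) & supp_TS1 g `<=` V].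

(* the components of (L_{k,l})^* g *)
Definition mixed_ray_adjoint k l g (I : k.-tuple 'I_2) (J : l.-tuple 'I_2) :
    'rV[R]_2 -> R :=
  fun x => \int[lebesgue_measure]_(theta in `[0, 2 * pi])
    (let xi := unit_vector theta in
     (\prod_(i <- I) xi 0 i) * (\prod_(j <- J) perp xi 0 j) *
     g (x - dotp x xi *: xi, xi)).

(* the distribution L_{k,l} f on TS1, as a functional of the test function g *)
Definition mixed_ray k l (f : tensor R k l) : ('rV[R]_2 * 'rV[R]_2 -> R) -> R :=
  fun g => \sum_(I : k.-tuple 'I_2) \sum_(J : l.-tuple 'I_2)
    f I J (mixed_ray_adjoint g I J).

Definition lines_meeting (U : set 'rV[R]_2) : set ('rV[R]_2 * 'rV[R]_2) :=
  [set p | TS1 p /\ exists t : R, U (p.1 + t *: p.2)].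

Definition mixed_ray_vanishes_through (U : set 'rV[R]_2) k l (f : tensor R k l) :
    Prop :=
  forall g, test_function_TS1 (lines_meeting U) g -> mixed_ray f g = 0.

End MixedRayTransform.

(* Main.v *)
(* In the plane, contracting f with xi, ..., xi, perp xi, ..., perp xi turns the mixed
   ray transform into the ray transform of a symmetric tensor h of rank m = k + l
   whose components are the contractions of f; the kernel of this contraction is the
   image of lambda, and d' corresponds to the symmetrized gradient.  So h vanishes on
   U, its ray transform vanishes on the lines through U, and h must be shown to be a
   symmetrized gradient.  Let s be the scalar distribution obtained by applying the
   m-fold rotated gradient to h; its integrals over the lines through U vanish as well.

   s = 0: for a centre c in U, s annihilates the derivatives of the back-projections
   of bumps concentrating at the lines through c, which converge to a multiple of
   1/|z|, z = x - c, with all derivatives away from c.  Hence s annihilates all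
   derivatives of 1/|z|, therefore (Laplacian of |z|^p = p^2 |z|^(p-2)) all functions
   z^alpha |z|^(-1-2i) with i >= |alpha|, and by polynomial approximation in the
   variable 1/|z|^2 all monomials z^alpha, so that s = 0.

   Once s = 0, the relation sum_a (-d_0)^a d_1^(m-a) h_a = 0 is solved by successive
   divisions by d_0, which are possible for compactly supported distributions
   annihilating the functions independent of x_0. *)
Require Import Defs.
From mathcomp Require Import all_boot all_order all_algebra all_fingroup.
From mathcomp Require Import all_classical all_reals all_analysis.
From mathcomp Require Import ring lra zify.

Set Implicit Arguments.
Unset Strict Implicit.
Unset Printing Implicit Defensive.

Import Order.TTheory GRing.Theory Num.Theory.
Import numFieldNormedType.Exports.

Local Open Scope classical_set_scope.
Local Open Scope ring_scope.

(** A derivative falling on a function B of the signed distance <x - c, perp xi> produces a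
    component of perp xi. This links tensors to [s]: the m-fold rotated gradient replaces B by its
    m-th derivative and creates exactly the angular monomials that are paired with [h]. The bumps at
    scale delta need no limit theorem. The gradient of |z| times their back-projection has the same
    form with a factor delta^2, whereas the crude bound of such a function costs only 1/delta. So
    all its derivatives are O(delta) away from c, it is constant up to O(delta) on a connected
    annulus, and the lower bound 1/2 for that constant is enough. The singularity at c does no harm
    because [s] vanishes near c, which is where f = lambda w' on U enters. The condition i >=
    |alpha| is the price of the factors z_j: each is gained by differentiating a power |z|^(2s),
    which lowers s by one. Further powers of t = 1/|z|^2 are free, and with s = -1/2 - |alpha| the
    function t^s, approximated by polynomials in t, cancels the factor |z|^(2s). *)

Section PartialDerivatives.
Context {R : realType}.
Implicit Types (phi psi : 'rV[R]_2 -> R) (i : 'I_2).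

Definition has_partial i phi (x : 'rV[R]_2) (d : R) : Prop :=
  is_derive x (delta_mx 0 i : 'rV[R]_2) phi d.

Lemma has_partialP i phi x d : has_partial i phi x d <->
  is_derive (0 : R) (1 : R) (fun h => phi (x + h *: delta_mx 0 i)) d.
Proof.
have -> : (fun h => phi (x + h *: delta_mx 0 i)) =
    (fun h : R => phi (h *: delta_mx 0 i + x)).
  by apply/funext => h; rewrite addrC.
have E : (fun h : R => h^-1 *: ((phi \o shift x) (h *: delta_mx 0 i) - phi x)) =
  (fun h : R => h^-1 *: (((fun h => phi (h *: delta_mx 0 i + x)) \o shift 0)
     (h *: 1) - phi (0 *: delta_mx 0 i + x))).
  by apply/funext => h /=; rewrite addr0 scale0r add0r [_%:A]mulr1.
split=> -[df <-]; split.
- by rewrite /derivable -E; exact: df.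
- by rewrite /derive -E.
- by rewrite /derivable E; exact: df.
- by rewrite /derive E.
Qed.

Lemma has_partial_val i phi x d : has_partial i phi x d -> partial i phi x = d.
Proof. by case. Qed.

Lemma has_partial_eq i phi x d d' : has_partial i phi x d -> d = d' ->
  has_partial i phi x d'.
Proof. by move=> ? <-. Qed.

Lemma has_partial_cst i (c : R) x : has_partial i (fun=> c) x 0.
Proof. exact: is_derive_cst. Qed.

Lemma has_partial_coord i j x :
  has_partial i (fun x => x 0 j) x (i == j)%:R.
Proof.
apply/has_partialP.
rewrite [X in is_derive _ _ X _](_ : _ =
    (cst (x 0 j) + (i == j)%:R \*: id)); last first.
  by apply/funext => h; rewrite !mxE eqxx /= eq_sym /GRing.scale_fun /= fctE
    /= /GRing.scale /= mulrC.
apply: (is_derive_eq (is_deriveD (is_derive_cst _ _ _) (is_deriveZ _ (is_derive_id _ _)))).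
by rewrite add0r /GRing.scale /= mulr1.
Qed.

Lemma has_partialD i phi psi x a b :
  has_partial i phi x a -> has_partial i psi x b ->
  has_partial i (fun x => phi x + psi x) x (a + b).
Proof. by move=> ? ?; exact: is_deriveD. Qed.

Lemma has_partialM i phi psi x a b :
  has_partial i phi x a -> has_partial i psi x b ->
  has_partial i (fun x => phi x * psi x) x (a * psi x + phi x * b).
Proof.
move=> ? ?; apply: (has_partial_eq (d := phi x *: b + psi x *: a)).
  exact: is_deriveM.
by rewrite addrC /GRing.scale /= (mulrC a).
Qed.

Lemma has_partialZ i phi x c a :
  has_partial i phi x a -> has_partial i (fun x => c * phi x) x (c * a).
Proof.
move=> /(has_partialM (has_partial_cst i c x)); rewrite mul0r add0r; exact.
Qed.

Lemma is_derive1_chain (f g : R -> R) (t a b : R) : is_derive t 1 f a ->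
  is_derive (f t) 1 g b -> is_derive t 1 (fun s => g (f s)) (b * a).
Proof.
move=> [df <-] [dg <-].
have dgf : derivable (g \o f) t 1.
  by apply/derivable1_diffP/differentiable_comp; apply/derivable1_diffP.
split; first exact: dgf.
have -> : (fun s => g (f s)) = g \o f by [].
by rewrite -derive1E (derive1_comp df dg) !derive1E.
Qed.

Lemma has_partial_comp i phi (B : R -> R) x a b :
  has_partial i phi x a -> is_derive (phi x) 1 B b ->
  has_partial i (fun x => B (phi x)) x (b * a).
Proof.
move=> /has_partialP dphi dB; apply/has_partialP.
by apply: (is_derive1_chain dphi); rewrite scale0r addr0.
Qed.

End PartialDerivatives.

#[global] Opaque has_partial.

(** * Smooth functions of one and two variables *)

Section Smooth.
Context {R : realType}.
Implicit Types (phi psi : 'rV[R]_2 -> R) (B : R -> R).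

Lemma smooth_partial (i : 'I_2) phi : smooth phi -> smooth (partial i phi).
Proof. by move=> sphi s; have := sphi (rcons s i); rewrite /partials foldr_rcons. Qed.

Lemma smooth_partials s phi : smooth phi -> smooth (partials s phi).
Proof. by move=> sphi; elim: s => [|i s]; [exact: sphi|exact: smooth_partial]. Qed.

Lemma smooth_continuous phi : smooth phi -> continuous phi.
Proof. by move=> /(_ [::])[]. Qed.

Lemma smooth_has_partial (i : 'I_2) phi x : smooth phi ->
  has_partial i phi x (partial i phi x).
Proof. by move=> /(_ [::])[_ /(_ i x)] /derivableP. Qed.

(** Iterated partials of a member stay in [S], so a single differentiation step suffices and no
    formula for higher derivatives is ever needed. *)
Lemma smooth_coind (S : ('rV[R]_2 -> R) -> Prop) :
  (forall phi, S phi -> continuous phi /\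
     forall i, exists2 psi, S psi & forall x, has_partial i phi x (psi x)) ->
  forall phi, S phi -> smooth phi.
Proof.
move=> step phi Sphi s.
have Ss : S (partials s phi).
  elim: s => //= i s /step[_ /(_ i)[psi Spsi dpsi]].
  by rewrite [partial _ _](_ : _ = psi)//; apply/funext => x; exact: has_partial_val.
have [cs ds] := step _ Ss; split=> // i x.
by have [psi _ /(_ x)[]] := ds i.
Qed.

#[local] Opaque smooth.

(** Closed under partial derivatives by the sum, product and chain rules, hence an instance of
    [smooth_coind]. Composition takes a whole tower [F] of successive derivatives, required only at
    the values of [phi], so that real powers of positive functions are covered. *)
Inductive smooth_expr : ('rV[R]_2 -> R) -> Prop :=
| smooth_expr_atom phi : smooth phi -> smooth_expr phi
| smooth_expr_cst c : smooth_expr (fun=> c)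
| smooth_expr_coord (i : 'I_2) : smooth_expr (fun x => x 0 i)
| smooth_expr_add phi psi : smooth_expr phi -> smooth_expr psi ->
    smooth_expr (fun x => phi x + psi x)
| smooth_expr_mul phi psi : smooth_expr phi -> smooth_expr psi ->
    smooth_expr (fun x => phi x * psi x)
| smooth_expr_comp (F : nat -> R -> R) n phi : smooth_expr phi ->
    (forall n x, is_derive (phi x) 1 (F n) (F n.+1 (phi x))) ->
    smooth_expr (fun x => F n (phi x)).

Lemma smooth_expr_smooth phi : smooth_expr phi -> smooth phi.
Proof.
apply: smooth_coind => {}phi; elim=> {phi}.
- move=> phi sphi; split; first exact: smooth_continuous.
  move=> i; exists (partial i phi); first exact/smooth_expr_atom/smooth_partial.
  by move=> x; exact: smooth_has_partial.
- move=> c; split; first exact: cst_continuous.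
  move=> i; exists (fun=> 0); first exact: smooth_expr_cst.
  by move=> x; exact: has_partial_cst.
- move=> j; split; first exact: coord_continuous.
  move=> i; exists (fun=> (i == j)%:R); first exact: smooth_expr_cst.
  by move=> x; exact: has_partial_coord.
- move=> phi psi _ [cphi dphi] _ [cpsi dpsi]; split.
    by move=> x; apply: continuousD; [exact: cphi|exact: cpsi].
  move=> i; have [dp Sdp dpE] := dphi i; have [dq Sdq dqE] := dpsi i.
  exists (fun x => dp x + dq x); first exact: smooth_expr_add.
  by move=> x; exact: has_partialD.
- move=> phi psi Sphi [cphi dphi] Spsi [cpsi dpsi]; split.
    by move=> x; apply: continuousM; [exact: cphi|exact: cpsi].
  move=> i; have [dp Sdp dpE] := dphi i; have [dq Sdq dqE] := dpsi i.
  exists (fun x => dp x * psi x + phi x * dq x); last by move=> x; exact: has_partialM.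
  by apply: smooth_expr_add; exact: smooth_expr_mul.
- move=> F n phi Sphi [cphi dphi] dF; split.
    move=> x; apply: continuous_comp; first exact: cphi.
    by apply/differentiable_continuous/derivable1_diffP; case: (dF n x).
  move=> i; have [dp Sdp dpE] := dphi i.
  exists (fun x => F n.+1 (phi x) * dp x); last first.
    by move=> x; exact: has_partial_comp.
  by apply: smooth_expr_mul => //; exact: smooth_expr_comp.
Qed.

Lemma smooth_cst (c : R) : smooth (fun _ : 'rV[R]_2 => c).
Proof. exact/smooth_expr_smooth/smooth_expr_cst. Qed.

Lemma smooth_coord (i : 'I_2) : smooth (fun x : 'rV[R]_2 => x 0 i).
Proof. exact/smooth_expr_smooth/smooth_expr_coord. Qed.

Lemma smoothD phi psi : smooth phi -> smooth psi ->
  smooth (fun x => phi x + psi x).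
Proof.
by move=> ? ?; apply/smooth_expr_smooth/smooth_expr_add; exact: smooth_expr_atom.
Qed.

Lemma smoothM phi psi : smooth phi -> smooth psi ->
  smooth (fun x => phi x * psi x).
Proof.
by move=> ? ?; apply/smooth_expr_smooth/smooth_expr_mul; exact: smooth_expr_atom.
Qed.

Lemma smoothZ c phi : smooth phi -> smooth (fun x => c * phi x).
Proof. by apply: smoothM; exact: smooth_cst. Qed.

Lemma smoothN phi : smooth phi -> smooth (fun x => - phi x).
Proof.
move=> /(smoothZ (-1)); congr smooth.
by apply/funext => x; rewrite mulN1r.
Qed.

Lemma smoothB phi psi : smooth phi -> smooth psi ->
  smooth (fun x => phi x - psi x).
Proof. by move=> sphi spsi; exact: (smoothD sphi (smoothN spsi)). Qed.

Lemma smoothX n phi : smooth phi -> smooth (fun x => phi x ^+ n).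
Proof.
move=> sphi; elim: n => [|n IH].
  by under eq_fun do rewrite expr0; exact: smooth_cst.
by under eq_fun do rewrite exprS; exact: smoothM.
Qed.

Lemma smooth_powR a phi : smooth phi -> (forall x, 0 < phi x) ->
  smooth (fun x => phi x `^ a).
Proof.
move=> sphi phi0.
pose F n t := \prod_(i < n) (a - i%:R) * t `^ (a - n%:R) : R.
have -> : (fun x => phi x `^ a) = (fun x => F 0 (phi x)).
  by apply/funext => x; rewrite /F big_ord0 mul1r subr0.
apply/smooth_expr_smooth/smooth_expr_comp; first exact: smooth_expr_atom.
move=> n x; rewrite /F.
have H := is_deriveZ (\prod_(i < n) (a - i%:R))
  (@is_derive1_powR _ (a - n%:R) _ (phi0 x)).
apply: (is_derive_eq H).
by rewrite big_ord_recr /= /GRing.scale /= -addrA -opprD natr1 mulrA.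
Qed.

(** The tower of derivatives is the datum that [smooth_expr_comp] asks for. By [smooth1_expr] this
    amounts to smoothness of x |-> B (x_0), from which the closure properties in one variable are
    inherited. *)
Definition smooth1 B : Prop := exists2 F : nat -> R -> R, F 0 = B &
  forall n (t : R), is_derive t 1 (F n) (F n.+1 t).

Lemma smooth_comp1 B phi : smooth1 B -> smooth phi ->
  smooth (fun x => B (phi x)).
Proof.
move=> [F <- dF] sphi; apply/smooth_expr_smooth/smooth_expr_comp => //.
exact: smooth_expr_atom.
Qed.

Lemma smooth1_derive B : smooth1 B -> exists2 B', smooth1 B' &
  forall t : R, is_derive t 1 B (B' t).
Proof.
move=> [F <- dF]; exists (F 1); last by move=> t; exact: dF.
by exists (fun n => F n.+1) => // n t; exact: dF.
Qed.

Lemma smooth1_continuous B : smooth1 B -> continuous B.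
Proof.
move=> [F <- dF] t.
by apply/differentiable_continuous/derivable1_diffP; case: (dF 0 t).
Qed.

Definition point (a b : R) : 'rV[R]_2 := a *: delta_mx 0 0 + b *: delta_mx 0 1.

Lemma is_derive_partials_point phi n (a t : R) : smooth phi ->
  is_derive t (1 : R) (fun t => partials (nseq n 0) phi (point t a))
    (partials (nseq n.+1 0) phi (point t a)).
Proof.
move=> sphi.
have /has_partialP := smooth_has_partial 0 (point t a) (smooth_partials (nseq n 0) sphi).
have dt : is_derive t 1 (fun s : R => s - t) 1.
  by rewrite -[X in is_derive _ _ _ X]subr0; exact: (is_deriveB (is_derive_id _ _) (is_derive_cst _ _ _)).
move=> H; have := @is_derive1_chain _ (fun s : R => s - t)
   (fun h => partials (nseq n 0) phi (point t a + h *: delta_mx 0 0)) t _ _ dt.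
rewrite subrr => /(_ _ H); rewrite mulr1.
congr is_derive; apply/funext => s; congr (partials _ _ _).
by rewrite /point addrAC -scalerDl [t + _]addrC subrK.
Qed.

Lemma smooth_restrict1 phi (a : R) : smooth phi -> smooth1 (fun t => phi (point t a)).
Proof.
move=> sphi; exists (fun n t => partials (nseq n 0) phi (point t a)) => // n t.
exact: is_derive_partials_point.
Qed.

Lemma smooth1_coord B : smooth (fun x : 'rV[R]_2 => B (x 0 0)) -> smooth1 B.
Proof.
move=> /smooth_restrict1 -/(_ 0); congr smooth1; apply/funext => t.
by rewrite !mxE eqxx /= mulr1 mulr0 addr0.
Qed.

Lemma smooth1_expr B : smooth (fun x : 'rV[R]_2 => B (x 0 0)) <-> smooth1 B.
Proof.
split; first exact: smooth1_coord.
by move=> sB; apply: smooth_comp1 => //; exact: smooth_coord.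
Qed.

End Smooth.

#[global] Opaque smooth.

(** * A flat function and the smooth step *)

Section SmoothStep.
Context {R : realType}.

(** With y = 1/t one has dy/dt = - y^2, so the derivative of p(y) exp(-y) in t is y^2 (p(y) - p'(y))
    exp(-y). *)
Let step_poly (n : nat) : {poly R} :=
  iter n (fun p => 'X^2 * (p - p^`())) 1.

(* exp (-1/t) for t > 0, extended by 0, and its successive derivatives *)
Let flat n (t : R) : R :=
  if t <= 0 then 0 else (step_poly n).[t^-1] * expR (- t^-1).

(** Each monomial is bounded through y^n <= n! exp y, a term of the exponential series. The factor
    y^2 makes p(1/t) exp(-1/t) of size O(t^2), hence differentiable at 0 with derivative 0. *)
Lemma horner_expN_bound (p : {poly R}) :
  exists2 C, 0 <= C & forall y, 0 <= y -> `|p.[y] * expR (- y)| * y ^+ 2 <= C.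
Proof.
have mon n : forall y : R, 0 <= y -> y ^+ n * expR (- y) <= n`!%:R.
  move=> y y0; rewrite expRN ler_pdivrMr ?expR_gt0//.
  case: n => [|n].
    rewrite expr0 fact0 mul1r; apply: le_trans (expR_ge1Dxn 0 y0).
    by rewrite lerDl divr_ge0 ?exprn_ge0 ?ler0n.
  rewrite mulrC -ler_pdivrMr ?ltr0n ?fact_gt0//.
  by apply: le_trans (expR_ge1Dxn n y0); rewrite lerDr.
exists (\sum_(i < size p) `|p`_i| * (i + 2)`!%:R).
  by apply: sumr_ge0 => i _; rewrite mulr_ge0.
move=> y y0; rewrite horner_coef normrM mulrAC.
rewrite (ger0_norm (expR_ge0 _)) -mulrA.
apply: le_trans (ler_wpM2r _ (ler_norm_sum _ _ _)) _.
  by rewrite mulr_ge0 ?exprn_ge0 ?expR_ge0.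
rewrite mulr_suml; apply: ler_sum => i _.
rewrite normrM normrX (ger0_norm y0) -mulrA ler_wpM2l//.
by rewrite mulrA -exprD; exact: mon.
Qed.

Lemma flat_bound n : exists2 C, 0 <= C & forall t, `|flat n t| <= C * t ^+ 2.
Proof.
have [C C0 HC] := horner_expN_bound (step_poly n).
exists C => // t; rewrite /flat; case: ifPn => [_|].
  by rewrite normr0 mulr_ge0 ?sqr_ge0.
rewrite -ltNge => t0; rewrite -ler_pdivrMr ?exprn_gt0//.
by rewrite -exprVn; apply: HC; rewrite invr_ge0 ltW.
Qed.

Lemma is_derive1_quadratic_bound (f : R -> R) C :
  (forall h, `|f h| <= C * h ^+ 2) -> is_derive (0 : R) (1 : R) f 0.
Proof.
move=> fC.
have f0 : f 0 = 0.
  by apply/eqP; rewrite -normr_le0 (le_trans (fC 0))// expr0n mulr0.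
suff L : (fun h => h^-1 *: ((f \o shift 0) (h *: 1) - f 0)) @ 0^' --> (0 : R).
  by split; [apply/cvg_ex; exists 0|exact/cvg_lim].
apply/cvgr0Pnorm_le => _/posnumP[e].
have C0 : 0 <= C by have := le_trans (normr_ge0 _) (fC 1); rewrite expr1n mulr1.
have C1 : 0 < C + 1 by rewrite ltr_wpDl.
near=> h.
have h0 : h != 0 by near: h; exact: nbhs_dnbhs_neq.
rewrite /= addr0 [_%:A]mulr1 f0 subr0 normrM normfV.
rewrite ler_pdivrMl ?normr_gt0//; apply: le_trans (fC h) _.
rewrite -real_normK ?num_real// expr2 mulrA mulrC ler_wpM2l//.
have : `|h| <= e%:num / (C + 1) by near: h; apply: dnbhs0_le; exact: divr_gt0.
rewrite ler_pdivlMr// => H.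
by apply: le_trans H; rewrite mulrC ler_wpM2l// lerDl.
Unshelve. all: by end_near. Qed.

Lemma is_derive1_flat n (t : R) : is_derive t (1 : R) (flat n) (flat n.+1 t).
Proof.
have [t0|t0|->] := ltgtP t 0.
- apply: (@near_eq_is_derive R R R (fun=> 0)).
    near=> s; rewrite /flat ifT//; apply: ltW.
    by near: s; exact: lt_nbhsl.
  by rewrite {1}/flat (ltW t0); exact: is_derive_cst.
- apply: (@near_eq_is_derive R R R
    (fun t => (step_poly n).[t^-1] * expR (- t^-1))).
    near=> s; rewrite /flat ifF//; apply/negbTE; rewrite -ltNge.
    by near: s; exact: lt_nbhsr.
  have dV : is_derive t (1 : R) (fun s : R => s^-1) (- t ^- 2).
    have := @is_deriveV R id t 1 1 (lt0r_neq0 t0) (is_derive_id _ _).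
    by rewrite /GRing.scale /= mulr1.
  have dp : is_derive t (1 : R) (fun s => (step_poly n).[s^-1])
      ((step_poly n)^`().[t^-1] * - t ^- 2).
    have dh : is_derive t^-1 (1 : R) (horner (step_poly n)) (step_poly n)^`().[t^-1].
      by split; [exact: derivable_horner|rewrite -derive1E -derivE].
    exact: (is_derive1_chain dV dh).
  have dN : is_derive t (1 : R) (fun s : R => - s^-1) (t ^- 2).
    by rewrite -[X in is_derive _ _ _ X]opprK; exact: (is_deriveN dV).
  have de := is_derive1_chain dN (is_derive_expR _).
  apply: (is_derive_eq (is_deriveM dp de)).
  rewrite /flat ifF; last by apply/negbTE; rewrite -ltNge.
  rewrite [step_poly n.+1]/= !hornerE /GRing.scale /= -exprVn.
  by ring.
- have [C _ HC] := flat_bound n.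
  by rewrite {2}/flat lexx; exact: (is_derive1_quadratic_bound HC).
Unshelve. all: by end_near. Qed.

Lemma smooth1_flat : smooth1 (flat 0).
Proof. by exists flat => //; exact: is_derive1_flat. Qed.

Lemma flat_ge0 t : 0 <= flat 0 t.
Proof.
rewrite /flat; case: ifPn => // _.
by rewrite /= hornerC mul1r expR_ge0.
Qed.

Lemma flat_gt0 t : 0 < t -> 0 < flat 0 t.
Proof. by move=> t0; rewrite /flat leNgt t0 /= hornerC mul1r expR_gt0. Qed.

Lemma smooth_step_exists : exists k : R -> R, [/\ smooth1 k,
  (forall t, 0 <= k t <= 1), (forall t, t <= 0 -> k t = 0) &
  (forall t, 1 <= t -> k t = 1)].
Proof.
pose d t := flat 0 t + flat 0 (1 - t).
have d0 t : 0 < d t.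
  have [t0|t0] := ltP 0 t; first by rewrite ltr_wpDr ?flat_ge0 ?flat_gt0.
  by rewrite ltr_wpDl ?flat_ge0// flat_gt0// subr_gt0 (le_lt_trans t0).
(* The quotient of the flat function at t by the sum of its values at t and 1 - t; the reciprocal is
   written as a real power of a positive function so that [smooth_powR] applies. *)
exists (fun t => flat 0 t * d t `^ (-1)); split.
- apply/smooth1_expr.
  have s0 := smooth_comp1 smooth1_flat (smooth_coord (0 : 'I_2)).
  apply: (smoothM s0).
  apply: smooth_powR => [|x]; last exact: d0.
  apply: (smoothD s0); apply: (smooth_comp1 smooth1_flat).
  exact: (smoothB (smooth_cst _) (smooth_coord _)).
- move=> t; rewrite powR_inv1 ?(ltW (d0 _))// divr_ge0 ?flat_ge0 ?(ltW (d0 _))//=.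
  by rewrite ler_pdivrMr// mul1r lerDl flat_ge0.
- by move=> t t0; rewrite {1}/flat t0 mul0r.
- move=> t t1; rewrite powR_inv1 ?(ltW (d0 _))//.
  have E : flat 0 (1 - t) = 0 by rewrite /flat subr_le0 t1.
  by rewrite /d E addr0 divff// lt0r_neq0// flat_gt0// (lt_le_trans ltr01).
Qed.

End SmoothStep.

(** * Iterated partial derivatives and pointwise C^N bounds *)

Section PartialRules.
Context {R : realType}.
Implicit Types (phi psi : 'rV[R]_2 -> R) (s : seq 'I_2) (x : 'rV[R]_2).

Lemma ord2P (i : 'I_2) : i = 0 \/ i = 1.
Proof. by case: i => -[|[|//]] ?; [left|right]; exact: val_inj. Qed.

Lemma has_partial_partial (i : 'I_2) phi (d : 'rV[R]_2 -> R) :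
  (forall x, has_partial i phi x (d x)) -> partial i phi = d.
Proof. by move=> H; apply/funext => x; exact: has_partial_val. Qed.

Lemma partial_cst (i : 'I_2) (c : R) : partial i (fun=> c) = fun=> 0.
Proof. by apply: has_partial_partial => x; exact: has_partial_cst. Qed.

Lemma partialD (i : 'I_2) phi psi : smooth phi -> smooth psi ->
  partial i (fun x => phi x + psi x) = fun x => partial i phi x + partial i psi x.
Proof.
move=> sphi spsi; apply: has_partial_partial => x.
by apply: has_partialD; exact: smooth_has_partial.
Qed.

Lemma partialM (i : 'I_2) phi psi : smooth phi -> smooth psi ->
  partial i (fun x => phi x * psi x) =
  fun x => partial i phi x * psi x + phi x * partial i psi x.
Proof.
move=> sphi spsi; apply: has_partial_partial => x.
by apply: has_partialM; exact: smooth_has_partial.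
Qed.

Lemma partialZ (i : 'I_2) c phi : smooth phi ->
  partial i (fun x => c * phi x) = fun x => c * partial i phi x.
Proof.
move=> sphi; apply: has_partial_partial => x.
by apply: has_partialZ; exact: smooth_has_partial.
Qed.

Lemma partial_comp1 (i : 'I_2) phi (B B' : R -> R) : smooth phi ->
  (forall t : R, is_derive t 1 B (B' t)) ->
  partial i (fun x => B (phi x)) = fun x => B' (phi x) * partial i phi x.
Proof.
move=> sphi dB; apply: has_partial_partial => x.
exact: (has_partial_comp (smooth_has_partial i x sphi) (dB _)).
Qed.

Lemma partials_cat s1 s2 phi :
  partials (s1 ++ s2) phi = partials s1 (partials s2 phi).
Proof. by rewrite /partials foldr_cat. Qed.

Lemma partials_rcons s i phi :
  partials (rcons s i) phi = partials s (partial i phi).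
Proof. by rewrite /partials foldr_rcons. Qed.

Lemma partialsDZ s (a : R) phi psi : smooth phi -> smooth psi ->
  partials s (fun x => a * phi x + psi x) =
  fun x => a * partials s phi x + partials s psi x.
Proof.
move=> sphi spsi; elim: s => //= i s ->.
have s1 := smooth_partials s sphi; have s2 := smooth_partials s spsi.
by rewrite (partialD i (smoothZ a s1) s2) (partialZ i a s1).
Qed.

Lemma partialsB s phi psi : smooth phi -> smooth psi ->
  partials s (fun x => phi x - psi x) =
  fun x => partials s phi x - partials s psi x.
Proof.
move=> sphi spsi.
rewrite [X in partials s X](_ : _ = (fun x => -1 * psi x + phi x)); last first.
  by apply/funext => x; rewrite mulN1r addrC.
by rewrite partialsDZ//; apply/funext => x; rewrite mulN1r addrC.
Qed.

Lemma partialsZ s (a : R) phi : smooth phi ->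
  partials s (fun x => a * phi x) = fun x => a * partials s phi x.
Proof.
move=> sphi; elim: s => //= i s ->.
by rewrite (partialZ i a (smooth_partials s sphi)).
Qed.

Lemma partials_cst0 s : partials s (fun=> 0 : R) = fun=> 0.
Proof. by elim: s => //= i s ->; rewrite partial_cst. Qed.

Lemma eq_partials_open (W : set 'rV[R]_2) s phi psi : open W ->
  (forall x, W x -> phi x = psi x) ->
  forall x, W x -> partials s phi x = partials s psi x.
Proof.
move=> oW E; elim: s => // i s IH x Wx /=.
rewrite /partial; apply: near_eq_derive.
have : nbhs x W by exact: open_nbhs_nbhs.
by apply: filterS.
Qed.

Lemma partial_mvt (i : 'I_2) phi x (h M : R) : smooth phi ->
  (forall t, 0 <= t <= 1 -> `|partial i phi (x + (t * h) *: delta_mx 0 i)| <= M) ->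
  `|phi (x + h *: delta_mx 0 i) - phi x| <= M * `|h|.
Proof.
move=> sphi HM.
pose g t := phi (x + (t * h) *: delta_mx 0 i).
pose dg t := partial i phi (x + (t * h) *: delta_mx 0 i) * h.
have Dg (t : R) : is_derive t 1 g (dg t).
  have dl : is_derive t 1 (fun u : R => u * h - t * h) h.
    rewrite [X in is_derive _ _ X _](_ : _ = (h \*: id) - cst (t * h)); last first.
      by apply/funext => u; rewrite /= !fctE /= /GRing.scale /= mulrC.
    apply: (is_derive_eq (is_deriveB (is_deriveZ _ (is_derive_id _ _)) (is_derive_cst _ _ _))).
    by rewrite subr0 /GRing.scale /= mulr1.
  have /has_partialP := smooth_has_partial i (x + (t * h) *: delta_mx 0 i) sphi.
  set G := fun h => _; move=> dG.
  have dG' : is_derive ((fun u : R => u * h - t * h) t) (1 : R) G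
    (partial i phi (x + (t * h) *: delta_mx 0 i)) by rewrite /= subrr.
  have := is_derive1_chain dl dG'.
  congr is_derive; apply/funext => u.
  by rewrite /G /g -addrA -scalerDl [_ + (_ - _)]addrC subrK.
have cg : continuous g.
  by move=> t; apply/differentiable_continuous/derivable1_diffP; case: (Dg t).
have [c c01 E] := @MVT_segment _ g dg 0 1 ler01 (fun t _ => Dg t)
  (continuous_subspaceT cg).
move: E; rewrite /g mul1r mul0r scale0r addr0 subr0 mulr1 => ->.
by rewrite normrM ler_wpM2r//; apply: HM; move: c01; rewrite in_itv.
Qed.

End PartialRules.

Section PartialsBound.
Context {R : realType}.
Implicit Types (phi psi : 'rV[R]_2 -> R) (s : seq 'I_2) (x : 'rV[R]_2).

(** Kept pointwise in [x] because the bounds are taken over boxes as well as over annuli. *)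
Definition partials_le N phi x (M : R) : Prop :=
  forall s, (size s <= N)%N -> `|partials s phi x| <= M.

Lemma partials_le_ge0 N phi x M : partials_le N phi x M -> 0 <= M.
Proof. by move=> /(_ [::] isT); apply: le_trans. Qed.

Lemma partials_leW N N' phi x M M' : (N' <= N)%N -> M <= M' ->
  partials_le N phi x M -> partials_le N' phi x M'.
Proof.
move=> NN MM H s sN; apply: le_trans MM; apply: H; exact: leq_trans NN.
Qed.

Lemma partials_le_partial N phi x M i : partials_le N.+1 phi x M ->
  partials_le N (partial i phi) x M.
Proof. by move=> H s sN; rewrite -partials_rcons; apply: H; rewrite size_rcons. Qed.

(** The list is split at its last entry, the derivative applied first, so that an induction on [N]
    can use the product or chain rule for [partial i phi] itself. *)
Lemma partials_leS N phi x M : `|phi x| <= M ->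
  (forall i, partials_le N (partial i phi) x M) -> partials_le N.+1 phi x M.
Proof.
move=> H0 H s; case/lastP: s => [//|s i].
by rewrite size_rcons ltnS partials_rcons; exact: H.
Qed.

Lemma partials_leD N phi psi x A B : smooth phi -> smooth psi ->
  partials_le N phi x A -> partials_le N psi x B ->
  partials_le N (fun x => phi x + psi x) x (A + B).
Proof.
move=> sphi spsi HA HB s sN.
rewrite [X in partials s X](_ : _ = (fun x => 1 * phi x + psi x)); last first.
  by apply/funext => y; rewrite mul1r.
rewrite partialsDZ// mul1r; apply: le_trans (ler_normD _ _) _.
by rewrite lerD ?HA ?HB.
Qed.

Lemma partials_leM N phi psi x A B : smooth phi -> smooth psi ->
  partials_le N phi x A -> partials_le N psi x B ->
  partials_le N (fun x => phi x * psi x) x (2 ^+ N * A * B).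
Proof.
elim: N phi psi => [|N IH] phi psi sphi spsi HA HB.
  move=> s; rewrite leqn0 size_eq0 => /eqP ->; rewrite expr0 mul1r normrM.
  by rewrite ler_pM// ?(HA [::])// ?(HB [::]).
have A0 := partials_le_ge0 HA; have B0 := partials_le_ge0 HB.
have HA' := partials_leW (leqnSn N) (lexx _) HA.
have HB' := partials_leW (leqnSn N) (lexx _) HB.
apply: partials_leS.
  rewrite normrM -[leLHS]mul1r -mulrA ler_pM// ?exprn_ege1 ?ler1n//.
  by rewrite ler_pM// ?(HA [::])// ?(HB [::]).
move=> i; rewrite partialM//.
have -> : 2 ^+ N.+1 * A * B = 2 ^+ N * A * B + 2 ^+ N * A * B.
  by rewrite exprS; ring.
have sA := smooth_partial i sphi; have sB := smooth_partial i spsi.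
apply: partials_leD; [exact: (smoothM sA spsi)|exact: (smoothM sphi sB)| |].
- by apply: (IH _ _ sA spsi) => //; exact: partials_le_partial.
- by apply: (IH _ _ sphi sB) => //; exact: partials_le_partial.
Qed.

Lemma partials_leZ N phi x (a A : R) : smooth phi ->
  partials_le N phi x A -> partials_le N (fun x => a * phi x) x (`|a| * A).
Proof. by move=> sphi H s sN; rewrite partialsZ// normrM ler_wpM2l// H. Qed.

Lemma partials_le_compact N phi (K : set 'rV[R]_2) : smooth phi -> compact K ->
  exists2 M, 0 <= M & forall x, K x -> partials_le N phi x M.
Proof.
move=> + cK; elim: N phi => [|N IH] phi sphi.
  have [M [_ HM]] : bounded_set (phi @` K).
    apply: compact_bounded; apply: continuous_compact => //.
    by apply: continuous_subspaceT; exact: smooth_continuous.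
  exists (`|M| + 1); first by rewrite addr_ge0.
  move=> x Kx s; rewrite leqn0 size_eq0 => /eqP ->.
  apply: (HM (`|M| + 1)); last by exists x.
  by rewrite ltr_pwDr// ler_norm.
have [M0 M00 H0] := IH _ sphi.
have [M1 M10 H1] := IH _ (smooth_partial 0 sphi).
have [M2 M20 H2] := IH _ (smooth_partial 1 sphi).
exists (M0 + M1 + M2); first by rewrite !addr_ge0.
move=> x Kx; apply: partials_leS.
  apply: le_trans (H0 x Kx [::] isT) _; lra.
move=> i; have [->|->] := ord2P i.
- by apply: partials_leW (H1 x Kx) => //; lra.
- by apply: partials_leW (H2 x Kx) => //; lra.
Qed.

(** A crude Faa di Bruno estimate. [C] is chosen before the point and the outer function; this
    uniformity later makes f |-> T (g f(1/|z|^2)) a continuous functional of f. *)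
Lemma partials_le_comp1 N phi (D : R) : smooth phi ->
  exists2 C, 0 <= C & forall x, partials_le N phi x D ->
    forall (F : nat -> R -> R) (M : R),
    (forall n (t : R), is_derive t 1 (F n) (F n.+1 t)) ->
    (forall n, (n <= N)%N -> `|F n (phi x)| <= M) ->
    partials_le N (fun x => F 0 (phi x)) x (C * M).
Proof.
move=> sphi; elim: N => [|N [C C0 IH]].
  exists 1 => // x _ F M _ HF s; rewrite leqn0 size_eq0 => /eqP ->.
  by rewrite mul1r HF.
exists (2 ^+ N * C * `|D| + 1).
  by rewrite addr_ge0// !mulr_ge0// exprn_ge0.
move=> x HD F M dF HF.
have D0 := partials_le_ge0 HD.
have M0 : 0 <= M by apply: le_trans (HF 0 isT).
apply: partials_leS.
  apply: le_trans (HF 0 isT) _; rewrite mulrDl mul1r lerDr.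
  by rewrite !mulr_ge0// exprn_ge0.
move=> i; rewrite (partial_comp1 i sphi (dF 0)).
have HD' := partials_leW (leqnSn N) (lexx _) HD.
have sF1 : smooth1 (F 1) by exists (fun n => F n.+1) => // n t; exact: dF.
have H1 := IH x HD' (fun n => F n.+1) M (fun n => dF n.+1) (fun n nN => HF n.+1 nN).
apply: partials_leW (partials_leM (smooth_comp1 sF1 sphi) (smooth_partial i sphi)
  H1 (partials_le_partial i HD)) => //.
rewrite (ger0_norm D0).
have -> : 2 ^+ N * (C * M) * D = 2 ^+ N * C * D * M by ring.
by rewrite ler_wpM2r// lerDl.
Qed.

End PartialsBound.

#[global] Opaque partial partials_le.

Lemma continuous_slice (T U W : topologicalType) (G : T -> U -> W) y :
  continuous (fun p : T * U => G p.1 p.2) -> continuous (G y).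
Proof.
move=> cG t; have := cG (y, t).
apply: (@cvg_comp _ _ _ (fun u : U => (y, u)) (fun p => G p.1 p.2)).
exact: (cvg_pair (cvg_cst y) cvg_id).
Qed.

(** * Integrals over a segment, with parameters *)

Section SegmentIntegral.
Context {R : realType}.
Implicit Types (a b : R) (f g : R -> R).

Definition segment_integral a b f : R := \int[lebesgue_measure]_(t in `[a, b]) f t.

Lemma segment_integralE a b f :
  segment_integral a b f = \int[lebesgue_measure]_(t in `[a, b]) f t.
Proof. by []. Qed.

Lemma continuous_segment_integrable a b f : continuous f ->
  (@lebesgue_measure R).-integrable `[a, b] (EFin \o f).
Proof.
move=> cf; apply: continuous_compact_integrable; first exact: segment_compact.
exact: continuous_subspaceT.
Qed.

Lemma eq_segment_integral a b f g : (forall t, a <= t <= b -> f t = g t) ->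
  segment_integral a b f = segment_integral a b g.
Proof.
move=> fg; apply: eq_Rintegral => t /[!inE]/=; rewrite in_itv/=; exact: fg.
Qed.

Lemma segment_integralZ a b c f : continuous f ->
  segment_integral a b (fun t => c * f t) = c * segment_integral a b f.
Proof.
move=> cf; apply: RintegralZl; first exact: measurable_itv.
exact: continuous_segment_integrable.
Qed.

Lemma segment_integralD a b f g : continuous f -> continuous g ->
  segment_integral a b (fun t => f t + g t) =
  segment_integral a b f + segment_integral a b g.
Proof.
move=> cf cg; apply: RintegralD; first exact: measurable_itv.
- exact: continuous_segment_integrable.
- exact: continuous_segment_integrable.
Qed.

Lemma segment_integralB a b f g : continuous f -> continuous g ->
  segment_integral a b (fun t => f t - g t) =
  segment_integral a b f - segment_integral a b g.
Proof.
move=> cf cg; apply: RintegralB; first exact: measurable_itv.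
- exact: continuous_segment_integrable.
- exact: continuous_segment_integrable.
Qed.

Lemma segment_integral_cst a b c : a <= b ->
  segment_integral a b (fun=> c) = c * (b - a).
Proof.
move=> ab; rewrite /segment_integral Rintegral_cst; last exact: measurable_itv.
have E : (@lebesgue_measure R) `[a, b]%classic = (b - a)%:E.
  rewrite lebesgue_measure_itv /= lte_fin; case: ltgtP ab => // -> _.
  by rewrite subrr.
by rewrite -[RHS]/(c * fine (b - a)%:E) -E.
Qed.

Lemma le_segment_integral a b f g : continuous f -> continuous g ->
  (forall t, a <= t <= b -> f t <= g t) ->
  segment_integral a b f <= segment_integral a b g.
Proof.
move=> cf cg fg; apply: le_Rintegral; first exact: measurable_itv.
- exact: continuous_segment_integrable.
- exact: continuous_segment_integrable.
- by move=> t /=; rewrite in_itv/=; exact: fg.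
Qed.

Lemma segment_integral_norm_le a b f M : a <= b -> continuous f ->
  (forall t, a <= t <= b -> `|f t| <= M) ->
  `|segment_integral a b f| <= M * (b - a).
Proof.
move=> ab cf fM; rewrite -segment_integral_cst// ler_norml; apply/andP; split.
- rewrite lerNl -mulN1r -segment_integralZ//.
  apply: le_segment_integral => [t|t|t tab]; [|exact: cst_continuous|].
    exact: (cvgM (cvg_cst _) (cf t)).
  by rewrite mulN1r; apply: le_trans (fM t tab); rewrite -normrN ler_norm.
- apply: le_segment_integral => [//|t|t tab]; first exact: cst_continuous.
  by apply: le_trans (fM t tab); rewrite ler_norm.
Qed.

Lemma segment_integral_derive a b (f F : R -> R) : a < b -> continuous f ->
  (forall t : R, is_derive t 1 F (f t)) ->
  segment_integral a b f = F b - F a.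
Proof.
move=> ab cf dF; rewrite /segment_integral /Rintegral.
have cF : continuous F.
  by move=> t; apply/differentiable_continuous/derivable1_diffP; case: (dF t).
rewrite (@continuous_FTC2 _ f F)//.
- exact: continuous_subspaceT.
- split=> [t _| |]; first by case: (dF t).
  + exact: cvg_at_right_filter (cF a).
  + exact: cvg_at_left_filter (cF b).
- by move=> t _; rewrite derive1E; case: (dF t).
Qed.

Lemma segment_integral_ge_sub a b c d f k : a <= c -> c <= d -> d <= b ->
  continuous f -> (forall t, a <= t <= b -> 0 <= f t) ->
  (forall t, c <= t <= d -> k <= f t) ->
  k * (d - c) <= segment_integral a b f.
Proof.
move=> ac cd db cf f0 fk.
rewrite -(@segment_integral_cst c d k)//.
apply: (@le_trans _ _ (segment_integral c d f)).
  by apply: le_segment_integral => // t; exact: cst_continuous.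
rewrite /segment_integral /Rintegral; apply: fine_le.
- apply: integrable_fin_num; first exact: measurable_itv.
  exact: continuous_segment_integrable.
- apply: integrable_fin_num; first exact: measurable_itv.
  exact: continuous_segment_integrable.
- apply: ge0_subset_integral.
  + exact: measurable_itv.
  + exact: measurable_itv.
  + have /integrableP[mf _] := continuous_segment_integrable a b cf; exact: mf.
  + by move=> t /=; rewrite in_itv/= => tab; rewrite lee_fin f0.
  + move=> t /=; rewrite !in_itv/= => /andP[ct td].
    by rewrite (le_trans ac ct) (le_trans td db).
Qed.

Section ParametricIntegral.
Variables (a b : R).
Hypothesis ab : a <= b.

(** The tube lemma: compactness of the segment makes continuity at [x] uniform in t. *)
Lemma near_segment_uniform (T : topologicalType) (G : T * R -> R) (x : T) e :
  continuous G -> 0 < e ->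
  \forall y \near x, forall t, a <= t <= b -> `|G (x, t) - G (y, t)| <= e.
Proof.
move=> cG e0.
have cK : compact `[a, b]%classic by exact: segment_compact.
have Hc := (compact_near_coveringP _).1 cK _ (nbhs x)
  (fun y t => `|G (x, t) - G (y, t)| <= e) _.
have {}Hc : \forall y \near x, `[a, b]%classic `<=` (fun t => `|G (x, t) - G (y, t)| <= e).
  apply: Hc => t _.
  have /cvgrPdist_le/(_ _ (divr_gt0 e0 (ltr0n _ 2))) := cG (x, t).
  move=> [[A B] /= [Ax Bt] AB].
  exists (B, A); first by split.
  move=> [u y] /= [Bu Ay].
  have H1 := AB (y, u) (conj Ay Bu).
  have H2 := AB (x, u) (conj (nbhs_singleton Ax) Bu).
  rewrite (splitr e).
  rewrite -(subrKA (G (x, t))).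
  apply: le_trans (ler_normD _ _) (lerD _ H1).
  by rewrite distrC.
by apply: filterS Hc => y H t tab; apply: H; rewrite /= in_itv.
Qed.

Lemma continuous_segment_integral (T : topologicalType) (F : T -> R -> R) :
  continuous (fun p : T * R => F p.1 p.2) ->
  continuous (fun x => segment_integral a b (F x)).
Proof.
move=> cF x.
have cFx y : continuous (F y) by exact: continuous_slice.
apply/cvgrPdist_le => e e0.
have e1 : 0 < e / (b - a + 1).
  by rewrite divr_gt0// ltr_wpDl// subr_ge0.
have := near_segment_uniform x cF e1.
apply: filterS => y H.
rewrite -segment_integralB//.
have cB : continuous (fun t => F x t - F y t).
  by move=> t; apply: continuousB; exact: cFx.
apply: le_trans (segment_integral_norm_le ab cB H) _.
rewrite mulrAC ler_pdivrMr ?ltr_wpDl ?subr_ge0//.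
by rewrite ler_wpM2l ?(ltW e0)// lerDl.
Qed.

Lemma is_derive_segment_integral (F D : R -> R -> R) (h : R) :
  continuous (fun p : R * R => F p.1 p.2) ->
  continuous (fun p : R * R => D p.1 p.2) ->
  (forall h t : R, is_derive h 1 (F ^~ t) (D h t)) ->
  is_derive h 1 (fun h => segment_integral a b (F h)) (segment_integral a b (D h)).
Proof.
move=> cF cD dF.
have [M0 [_ HM]] : bounded_set ((fun p : R * R => D p.1 p.2) @`
    (`[h - 1, h + 1] `*` `[a, b])%classic).
  apply: compact_bounded; apply: continuous_compact.
    exact: continuous_subspaceT.
  by apply: compact_setX; exact: segment_compact.
pose M := `|M0| + 1.
have DM (k t : R) : h - 1 < k < h + 1 -> a <= t <= b -> `|D k t| <= M.
  move=> /andP[hk kh] tab; apply: (HM M); first by rewrite ltr_pwDr// ler_norm.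
  by exists (k, t) => //; split; rewrite /= in_itv/= ?(ltW hk) ?(ltW kh).
have mI : measurable (`[a, b]%classic : set (measurableTypeR R)).
  exact: measurable_itv.
have hI : `]h - 1, h + 1[%classic h.
  by rewrite /= in_itv/= ltrBlDr ltrDl ltr01.
have intF (k : R) : `]h - 1, h + 1[%classic k ->
    (@lebesgue_measure R).-integrable `[a, b] (EFin \o F k).
  by move=> _; apply: continuous_segment_integrable; exact: continuous_slice.
have dF1 (k t : R) : `]h - 1, h + 1[%classic k -> `[a, b]%classic t ->
    derivable (F ^~ t) k 1 by move=> _ _; case: (dF k t).
have M_ge0 (t : R) : 0 <= (fun=> M) t by rewrite /M addr_ge0.
have intM : (@lebesgue_measure R).-integrable `[a, b] (EFin \o (fun=> M)).
  by apply: continuous_segment_integrable => t; exact: cst_continuous.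
have ubM (k t : R) : `]h - 1, h + 1[%classic k -> `[a, b]%classic t ->
    `|partial1of2 F k t| <= (fun=> M) t.
  rewrite /= !in_itv/= => hk tab; rewrite partial1of2E.
  by have [_ ->] := dF k t; exact: DM.
have E : segment_integral a b (D h) =
    \int[lebesgue_measure]_(t in `[a, b]) partial1of2 F h t.
  by apply: eq_Rintegral => t _; rewrite partial1of2E; case: (dF h t).
split.
  exact: (derivable_under_integral mI hI intF dF1 M_ge0 intM ubM).
rewrite E -derive1E.
exact: (differentiation_under_integral mI hI intF dF1 M_ge0 intM ubM).
Qed.

Lemma has_partial_segment_integral (i : 'I_2) (F D : 'rV[R]_2 -> R -> R) x :
  continuous (fun p : 'rV[R]_2 * R => F p.1 p.2) ->
  continuous (fun p : 'rV[R]_2 * R => D p.1 p.2) ->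
  (forall x t, has_partial i (F ^~ t) x (D x t)) ->
  has_partial i (fun x => segment_integral a b (F x)) x (segment_integral a b (D x)).
Proof.
move=> cF cD dF; apply/has_partialP.
pose line (h : R) : 'rV[R]_2 := x + h *: delta_mx 0 i.
have cline : continuous line.
  move=> h; rewrite /line.
  exact: (cvgD (cvg_cst x) (@scalel_continuous R _ (delta_mx 0 i : 'rV[R]_2) h)).
have cl (G : 'rV[R]_2 -> R -> R) : continuous (fun p : 'rV[R]_2 * R => G p.1 p.2) ->
    continuous (fun p : R * R => G (line p.1) p.2).
  move=> cG [u v]; have := cG (line u, v).
  apply: (@cvg_comp _ _ _ (fun q : R * R => (line q.1, q.2))
    (fun q => G q.1 q.2)).
  exact: (cvg_pair (cvg_comp _ _ (@cvg_fst _ _ (nbhs u) (nbhs v) _) (cline u)) cvg_snd).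
have := @is_derive_segment_integral (fun h => F (line h)) (fun h => D (line h)) 0
  (cl F cF) (cl D cD).
rewrite /line scale0r addr0; apply => h t.
have /has_partialP dFh := dF (line h) t.
have ds : is_derive h (1 : R) (fun k : R => k - h) 1.
  rewrite -[X in is_derive _ _ _ X]subr0.
  exact: (is_deriveB (is_derive_id _ _) (is_derive_cst _ _ _)).
have dFh' : is_derive ((fun k : R => k - h) h) (1 : R)
    (fun k => F (line h + k *: delta_mx 0 i) t) (D (line h) t) by rewrite subrr.
have := is_derive1_chain ds dFh'; rewrite mulr1.
congr is_derive; apply/funext => k.
by rewrite /line -addrA -scalerDl [h + _]addrC subrK.
Qed.

End ParametricIntegral.

End SegmentIntegral.

#[global] Opaque segment_integral.

Lemma continuous_fst_comp (T U W : topologicalType) (g : T -> W) :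
  continuous g -> continuous (fun p : T * U => g p.1).
Proof. by move=> cg [x t]; exact: (cvg_comp _ _ (@cvg_fst _ _ (nbhs x) (nbhs t) _) (cg x)). Qed.

Lemma continuous_snd_comp (T U W : topologicalType) (g : U -> W) :
  continuous g -> continuous (fun p : T * U => g p.2).
Proof. by move=> cg [x t]; exact: (cvg_comp _ _ (@cvg_snd _ _ (nbhs x) (nbhs t) _) (cg t)). Qed.

(** * Smooth dependence on a point, antiderivatives along an axis, symmetry of second partials *)

Section SmoothFamily.
Context {R : realType}.
Implicit Types (phi : 'rV[R]_2 -> R) (F : 'rV[R]_2 -> R -> R) (x : 'rV[R]_2).

(* the point dividing in the ratio t : 1 - t the segment that joins, parallel to
   the i-th axis, the line x_i = c to x *)
Definition along (i : 'I_2) (c : R) x (t : R) : 'rV[R]_2 :=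
  x + ((t - 1) * (x 0 i - c)) *: delta_mx 0 i.

Lemma along_coord i c x t : along i c x t 0 i = c + t * (x 0 i - c).
Proof. by rewrite !mxE !eqxx /=; ring. Qed.

Lemma along_coord_neq i j c x t : j != i -> along i c x t 0 j = x 0 j.
Proof. by move=> /negbTE ji; rewrite !mxE ji andbF mulr0 addr0. Qed.

Lemma along1 i c x : along i c x 1 = x.
Proof. by rewrite /along subrr mul0r scale0r addr0. Qed.

Lemma continuous_along i c :
  continuous (fun p : 'rV[R]_2 * R => along i c p.1 p.2).
Proof.
have cx : continuous (fun p : 'rV[R]_2 * R => p.1).
  by apply: (@continuous_fst_comp _ _ _ id) => x; exact: cvg_id.
have ct : continuous (fun p : 'rV[R]_2 * R => p.2).
  by apply: (@continuous_snd_comp _ _ _ id) => t; exact: cvg_id.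
have cc := @continuous_fst_comp _ R _ _ (@coord_continuous R 1 2 0 i).
move=> p; rewrite /along; apply: (cvgD (cx p)); apply: cvgZr_tmp.
apply: cvgM.
  by apply: cvgB; [exact: ct|exact: cvg_cst].
by apply: cvgB; [exact: cc|exact: cvg_cst].
Qed.

Lemma has_partial_along i j c phi x t : smooth phi ->
  has_partial j (fun x => phi (along i c x t)) x
    ((if j == i then t else 1) * partial j phi (along i c x t)).
Proof.
move=> sphi; apply/has_partialP.
have /has_partialP D := smooth_has_partial j (along i c x t) sphi.
case: eqVneq => [ji|ji].
  have dl : is_derive (0 : R) (1 : R) (fun h : R => t * h) t.
    rewrite -[X in is_derive _ _ _ X]mulr1.
    exact: (is_deriveZ t (is_derive_id _ _)).
  rewrite mulrC; have D' : is_derive ((fun h : R => t * h) 0) (1 : R)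
      (fun h => phi (along i c x t + h *: delta_mx 0 j))
      (partial j phi (along i c x t)) by rewrite mulr0.
  have := is_derive1_chain dl D'.
  congr is_derive; apply/funext => h; congr phi.
  rewrite /along -ji !mxE !eqxx /= -!addrA -!scalerDl; congr (_ + _ *: _).
  ring.
rewrite mul1r; move: D; congr is_derive; apply/funext => h; congr phi.
by rewrite /along !mxE [i == j]eq_sym (negbTE ji) andbF mulr0 addr0 addrAC.
Qed.

(** A syntactic class of integrands: members are jointly continuous, and their partials in x are
    again members, so [smooth_coind] applies to the integrals over t. *)
Inductive smooth_family : ('rV[R]_2 -> R -> R) -> Prop :=
| smooth_family_param (k : R -> R) : continuous k -> smooth_family (fun _ t => k t)
| smooth_family_smooth phi : smooth phi -> smooth_family (fun x _ => phi x)
| smooth_family_add F G : smooth_family F -> smooth_family G ->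
    smooth_family (fun x t => F x t + G x t)
| smooth_family_mul F G : smooth_family F -> smooth_family G ->
    smooth_family (fun x t => F x t * G x t)
| smooth_family_comp1 (B : R -> R) F : smooth1 B -> smooth_family F ->
    smooth_family (fun x t => B (F x t))
| smooth_family_along i c phi : smooth phi ->
    smooth_family (fun x t => phi (along i c x t)).

Lemma smooth_family_continuous F : smooth_family F ->
  continuous (fun p : 'rV[R]_2 * R => F p.1 p.2).
Proof.
elim=> {F}.
- by move=> k ck; exact: continuous_snd_comp.
- move=> phi sphi; apply: (continuous_fst_comp (g := phi)).
  exact: smooth_continuous.
- by move=> F G _ cF _ cG p; exact: (cvgD (cF p) (cG p)).
- by move=> F G _ cF _ cG p; exact: (cvgM (cF p) (cG p)).
- move=> B F sB _ cF p.
  have cB : continuous B := smooth1_continuous sB.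
  exact: (@cvg_comp _ _ _ (fun p => F p.1 p.2) B _ _ _ (cF p) (cB (F p.1 p.2))).
- move=> i c phi sphi p.
  have cphi : continuous phi := smooth_continuous sphi.
  have ca := @continuous_along i c.
  exact: (@cvg_comp _ _ _ (fun p => along i c p.1 p.2) phi _ _ _ (ca p) (cphi (along i c p.1 p.2))).
Qed.

Lemma smooth_family_partial (j : 'I_2) F : smooth_family F ->
  exists2 D, smooth_family D & forall x t, has_partial j (F ^~ t) x (D x t).
Proof.
elim=> {F}.
- move=> k ck; exists (fun _ _ => 0).
    by apply: smooth_family_param; exact: cst_continuous.
  by move=> x t; exact: has_partial_cst.
- move=> phi sphi; exists (fun x _ => partial j phi x).
    by apply: smooth_family_smooth; exact: smooth_partial.
  by move=> x t; exact: smooth_has_partial.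
- move=> F G _ [DF sDF dF] _ [DG sDG dG].
  exists (fun x t => DF x t + DG x t); first exact: smooth_family_add.
  by move=> x t; exact: has_partialD.
- move=> F G sF [DF sDF dF] sG [DG sDG dG].
  exists (fun x t => DF x t * G x t + F x t * DG x t).
    by apply: smooth_family_add; exact: smooth_family_mul.
  by move=> x t; exact: has_partialM.
- move=> B F sB sF [DF sDF dF]; have [B' sB' dB] := smooth1_derive sB.
  exists (fun x t => B' (F x t) * DF x t).
    by apply: smooth_family_mul => //; exact: smooth_family_comp1.
  by move=> x t; exact: (has_partial_comp (dF x t) (dB _)).
- move=> i c phi sphi.
  exists (fun x t => (if j == i then t else 1) * partial j phi (along i c x t)).
    apply: (@smooth_family_mul (fun _ t => if j == i then t else 1)); last first.
      exact: (smooth_family_along i c (smooth_partial j sphi)).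
    by apply: smooth_family_param; case: eqP => _ t; [exact: cvg_id|exact: cvg_cst].
  by move=> x t; exact: has_partial_along.
Qed.

Lemma partial_segment_integral (j : 'I_2) a b F D : a <= b -> smooth_family F ->
  smooth_family D -> (forall x t, has_partial j (F ^~ t) x (D x t)) ->
  partial j (fun x => segment_integral a b (F x)) =
  fun x => segment_integral a b (D x).
Proof.
move=> ab sF sD dF; apply: has_partial_partial => x.
by apply: has_partial_segment_integral => //; exact: smooth_family_continuous.
Qed.

Lemma smooth_segment_integral a b F : a <= b -> smooth_family F ->
  smooth (fun x => segment_integral a b (F x)).
Proof.
move=> ab sF; pose S phi := exists2 F, smooth_family F &
  phi = fun x => segment_integral a b (F x).
apply: (@smooth_coind _ S); last by exists F.
move=> _ [{sF}F sF ->]; split.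
  by apply: continuous_segment_integral => //; exact: smooth_family_continuous.
move=> j; have [D sD dF] := smooth_family_partial j sF.
exists (fun x => segment_integral a b (D x)); first by exists D.
move=> x; by apply: has_partial_segment_integral => //; exact: smooth_family_continuous.
Qed.

Lemma smooth_family_slice F x : smooth_family F -> continuous (F x).
Proof. by move=> /smooth_family_continuous; exact: continuous_slice. Qed.

End SmoothFamily.

Section Antiderivative.
Context {R : realType}.
Variables (i : 'I_2) (c : R).
Implicit Types (phi : 'rV[R]_2 -> R) (x : 'rV[R]_2).

(* the integral of phi parallel to the i-th axis, from the line x_i = c to x *)
Definition antiderivative phi x : R :=
  segment_integral 0 1 (fun t => (x 0 i - c) * phi (along i c x t)).

Lemma antiderivative_family phi : smooth phi ->
  smooth_family (fun x t => (x 0 i - c) * phi (along i c x t)).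
Proof.
move=> sphi; apply: (@smooth_family_mul _ (fun x _ => x 0 i - c)).
  apply: (@smooth_family_smooth _ (fun x => x 0 i - c)).
  exact: (smoothB (smooth_coord i) (smooth_cst c)).
exact: smooth_family_along.
Qed.

Lemma smooth_antiderivative phi : smooth phi -> smooth (antiderivative phi).
Proof.
by move=> sphi; exact: (smooth_segment_integral ler01 (antiderivative_family sphi)).
Qed.

Lemma partial_antiderivative_neq j phi : smooth phi -> j != i ->
  partial j (antiderivative phi) = antiderivative (partial j phi).
Proof.
move=> sphi ji.
apply: (partial_segment_integral ler01 (antiderivative_family sphi)
  (antiderivative_family (smooth_partial j sphi))) => x t.
have H := has_partialM
  (has_partialD (has_partial_coord j i x) (has_partial_cst j (- c) x))
  (has_partial_along i j c x t sphi).
apply: (has_partial_eq H); rewrite (negbTE ji).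
by rewrite addr0 mul0r add0r mul1r.
Qed.

Lemma is_derive_along phi x (t : R) : smooth phi ->
  is_derive t (1 : R) (fun t => phi (along i c x t))
    ((x 0 i - c) * partial i phi (along i c x t)).
Proof.
move=> sphi.
have /has_partialP D := smooth_has_partial i (along i c x t) sphi.
have dl : is_derive t (1 : R) (fun s : R => (x 0 i - c) * (s - t)) (x 0 i - c).
  have H := is_deriveZ (x 0 i - c)
    (is_deriveB (is_derive_id t (1 : R)) (is_derive_cst t t (1 : R))).
  by apply: (is_derive_eq H); rewrite subr0 /GRing.scale /= mulr1.
have D' : is_derive ((fun s : R => (x 0 i - c) * (s - t)) t) (1 : R)
    (fun h => phi (along i c x t + h *: delta_mx 0 i))
    (partial i phi (along i c x t)) by rewrite subrr mulr0.
have := is_derive1_chain dl D'; rewrite mulrC.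
congr is_derive; apply/funext => s; congr phi.
rewrite /along -!addrA -!scalerDl; congr (_ + _ *: _).
ring.
Qed.

Lemma partial_antiderivative phi : smooth phi ->
  partial i (antiderivative phi) = phi.
Proof.
move=> sphi.
(* This is d/dt of t * phi (along i c x t), so that its integral over [0, 1] is phi x. *)
pose D x t := phi (along i c x t) +
  (x 0 i - c) * (t * partial i phi (along i c x t)).
have sD : smooth_family D.
  apply: smooth_family_add; first exact: smooth_family_along.
  apply: (@smooth_family_mul _ (fun x _ => x 0 i - c)).
    apply: (@smooth_family_smooth _ (fun x => x 0 i - c)).
    exact: (smoothB (smooth_coord i) (smooth_cst c)).
  apply: (@smooth_family_mul _ (fun _ t => t)).
    by apply: smooth_family_param => t; exact: cvg_id.
  exact: (smooth_family_along i c (smooth_partial i sphi)).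
rewrite (partial_segment_integral (D := D) ler01 (antiderivative_family sphi) sD).
  apply/funext => x.
  have dD (t : R) : is_derive t (1 : R) (fun t => t * phi (along i c x t)) (D x t).
    have H := is_deriveM (is_derive_id t (1 : R)) (is_derive_along x t sphi).
    apply: (is_derive_eq H); rewrite /D /GRing.scale /=; ring.
  rewrite (segment_integral_derive ltr01 (@smooth_family_slice R _ x sD) dD).
  by rewrite mul0r subr0 mul1r along1.
move=> x t.
have H := has_partialM
  (has_partialD (has_partial_coord i i x) (has_partial_cst i (- c) x))
  (has_partial_along i i c x t sphi).
by apply: (has_partial_eq H); rewrite /D eqxx addr0 mul1r.
Qed.

Lemma antiderivative_partial phi x : smooth phi ->
  antiderivative (partial i phi) x = phi x - phi (along i c x 0).
Proof.
move=> sphi; rewrite /antiderivative.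
have cf := @smooth_family_slice R _ x (antiderivative_family (smooth_partial i sphi)).
rewrite (segment_integral_derive ltr01 cf (fun t => is_derive_along x t sphi)).
by rewrite along1.
Qed.

Lemma antiderivativeDZ a phi psi : smooth phi -> smooth psi ->
  antiderivative (fun x => a * phi x + psi x) =
  fun x => a * antiderivative phi x + antiderivative psi x.
Proof.
move=> sphi spsi; apply/funext => x; rewrite /antiderivative.
have c1 := @smooth_family_slice R _ x (antiderivative_family sphi).
have c2 := @smooth_family_slice R _ x (antiderivative_family spsi).
rewrite -segment_integralZ// -segment_integralD//; last first.
  by move=> t; exact: (cvgM (cvg_cst _) (c1 t)).
by apply: eq_segment_integral => t _; ring.
Qed.

Lemma antiderivative0 phi x :
  (forall t, 0 <= t <= 1 -> phi (along i c x t) = 0) -> antiderivative phi x = 0.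
Proof.
move=> H; rewrite /antiderivative.
rewrite (@eq_segment_integral _ _ _ _ (fun=> 0)).
  by rewrite segment_integral_cst// mul0r.
by move=> t t01; rewrite H// mulr0.
Qed.

Lemma antiderivative_norm_le phi x M : smooth phi ->
  (forall t, 0 <= t <= 1 -> `|phi (along i c x t)| <= M) ->
  `|antiderivative phi x| <= `|x 0 i - c| * M.
Proof.
move=> sphi H; rewrite -[leRHS]mulr1 -[X in _ <= _ * X](subr0 1).
apply: segment_integral_norm_le => //.
  exact: (@smooth_family_slice R _ x (antiderivative_family sphi)).
by move=> t t01; rewrite normrM ler_wpM2l// H.
Qed.

End Antiderivative.

(** Write [phi] as the antiderivative in x_1 of d_1 phi plus its restriction to x_1 = 0. Integration
    in x_1 commutes with d_0; then d_1 undoes the integration and kills the second summand, which is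
    independent of x_1. *)
Lemma partialC (R : realType) (i j : 'I_2) (phi : 'rV[R]_2 -> R) : smooth phi ->
  partial i (partial j phi) = partial j (partial i phi).
Proof.
move=> sphi.
suff main : partial 1 (partial 0 phi) = partial 0 (partial 1 phi).
  have [->|->] := ord2P i; have [->|->] := ord2P j.
  - reflexivity.
  - exact: esym.
  - exact: main.
  - reflexivity.
pose psi (x : 'rV[R]_2) := phi (along 1 0 x 0).
have s1 := smooth_partial 1 sphi.
have sA := smooth_antiderivative 1 0 s1.
have dpsi i' (x : 'rV[R]_2) : has_partial i' psi x
    ((if i' == 1 then 0 else 1) * partial i' phi (along 1 0 x 0)).
  exact: has_partial_along.
have E : phi = fun x => antiderivative 1 0 (partial 1 phi) x + psi x.
  by apply/funext => x; rewrite antiderivative_partial// subrK.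
have E0 : partial 0 phi = fun x =>
    antiderivative 1 0 (partial 0 (partial 1 phi)) x + partial 0 phi (along 1 0 x 0).
  rewrite {1}E; apply: has_partial_partial => x; apply: has_partialD.
    have n01 : (0 : 'I_2) != 1 by [].
    rewrite -(partial_antiderivative_neq 0 s1 n01).
    exact: (smooth_has_partial 0 x sA).
  by apply: has_partial_eq (dpsi 0 x) _; rewrite mul1r.
rewrite {1}E0; apply: has_partial_partial => x; rewrite -[X in has_partial _ _ _ X]addr0.
apply: has_partialD.
  have s01 := smooth_partial 0 s1.
  rewrite -{2}(partial_antiderivative 1 0 s01).
  exact: (smooth_has_partial 1 x (smooth_antiderivative 1 0 s01)).
apply: has_partial_eq (has_partial_along 1 1 0 x 0 (smooth_partial 0 sphi)) _.
by rewrite eqxx mul0r.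
Qed.

(** * Boxes, supports and cutoffs *)

Section BoxesAndSupports.
Context {R : realType}.
Implicit Types (phi psi : 'rV[R]_2 -> R) (x : 'rV[R]_2) (r : R).

Definition box r : set 'rV[R]_2 := [set x | forall i, `|x 0 i| <= r].

Lemma norm_coord_le x i : `|x 0 i| <= `|x|.
Proof.
rewrite [leRHS]/Num.Def.normr /= mx_normrE.
by apply: (le_trans _ (@le_bigmax _ _ _ 0 (fun ij : 'I_1 * 'I_2 => `|x ij.1 ij.2|) (0, i))).
Qed.

Lemma norm_row_le x r : 0 <= r -> (forall i, `|x 0 i| <= r) -> `|x| <= r.
Proof.
move=> r0 H; rewrite [leLHS]/Num.Def.normr /= mx_normrE.
by apply: bigmax_le => // -[j i] _ /=; rewrite ord1.
Qed.

Lemma compact_box r : compact (box r).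
Proof.
have := @rV_compact R 2 (fun=> `[- r, r]%classic) (fun=> @segment_compact _ _ _).
congr compact; apply/seteqP; split => x H i; have := H i;
  by rewrite /= in_itv /= -ler_norml.
Qed.

Lemma closed_box r : closed (box r).
Proof. by apply: compact_closed; [exact: norm_hausdorff|exact: compact_box]. Qed.

Lemma compact_sub_box (K : set 'rV[R]_2) : compact K -> exists2 r, 0 <= r & K `<=` box r.
Proof.
move=> /compact_bounded[M [_ HM]]; exists (`|M| + 1); first by rewrite addr_ge0.
move=> x Kx i; apply: le_trans (norm_coord_le x i) _.
by apply: HM => //; rewrite ltr_pwDr// ler_norm.
Qed.

Lemma box_le r r' : r <= r' -> box r `<=` box r'.
Proof. by move=> rr x H i; apply: le_trans (H i) rr. Qed.

Lemma box_interior r r' : r < r' -> exists W : set 'rV[R]_2,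
  [/\ open W, box r `<=` W & W `<=` box r'].
Proof.
move=> rr; exists [set x | (`|x 0 0| < r') && (`|x 0 1| < r')]; split.
- have cn (i : 'I_2) : continuous (fun x : 'rV[R]_2 => `|x 0 i|).
    move=> x; exact: (@cvg_comp _ _ _ (fun x : 'rV[R]_2 => x 0 i) (fun y : R => `|y|)
      _ _ _ (@coord_continuous R 1 2 0 i x) (@norm_continuous R R (x 0 i))).
  have oi (i : 'I_2) : open [set x : 'rV[R]_2 | `|x 0 i| < r'].
    by apply: (@open_comp _ _ (fun x : 'rV[R]_2 => `|x 0 i|) [set y | y < r']);
      [move=> x _; exact: cn|exact: open_lt].
  have := openI (oi 0) (oi 1); congr open.
  by apply/seteqP; split => x /= => [[-> ->]|/andP[]].
- by move=> x H /=; rewrite !(le_lt_trans (H _)).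
- by move=> x /= /andP[H0 H1] i; have [->|->] := ord2P i; exact: ltW.
Qed.

Lemma supp_sub (A : set 'rV[R]_2) phi : closed A ->
  (forall x, ~ A x -> phi x = 0) -> supp phi `<=` A.
Proof.
move=> cA H; rewrite /supp; apply: (subset_trans (closure_subset _) (_ : closure A `<=` A)); last by rewrite -(closure_id A).1.
by move=> x /= /eqP; apply: contra_notP => /H.
Qed.

Lemma supp_disjoint (W : set 'rV[R]_2) phi : open W ->
  (forall x, W x -> phi x = 0) -> supp phi `<=` ~` W.
Proof.
move=> oW H; apply: supp_sub; first exact: open_closedC.
by move=> x /contrapT; exact: H.
Qed.

Lemma notin_supp phi x : ~ supp phi x -> phi x = 0.
Proof.
move=> nsx; apply/eqP; apply: contra_notT nsx => px.
exact: subset_closure.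
Qed.

Lemma test_function_sub (A : set 'rV[R]_2) phi : smooth phi -> compact A ->
  (forall x, ~ A x -> phi x = 0) -> test_function A phi.
Proof.
move=> sphi cA H.
have clA : closed A by apply: compact_closed; [exact: norm_hausdorff|].
have sA := supp_sub clA H.
split=> //; exact: (subclosed_compact (@closed_closure _ _) cA sA).
Qed.

Lemma partials_le0_open (W : set 'rV[R]_2) phi N x M : open W -> W x ->
  (forall y, W y -> phi y = 0) -> 0 <= M -> partials_le N phi x M.
Proof.
move=> oW Wx H M0 s _; rewrite (eq_partials_open (psi := fun=> 0) s oW)//.
by rewrite partials_cst0 normr0.
Qed.

Lemma partials_le_notin_supp phi N x M : ~ supp phi x -> 0 <= M ->
  partials_le N phi x M.
Proof.
move=> nsx M0; apply: (@partials_le0_open (~` supp phi)) => //.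
  by apply: closed_openC; exact: closed_closure.
by move=> y; exact: notin_supp.
Qed.

Lemma box_cutoff r : exists chi : 'rV[R]_2 -> R, [/\ smooth chi,
  (forall x, box r x -> chi x = 1) & (forall x, ~ box (r + 1) x -> chi x = 0)].
Proof.
have [k [sk _ k0 k1]] := @smooth_step_exists R.
pose c (i : 'I_2) (x : 'rV[R]_2) := k (r + 1 - x 0 i) * k (x 0 i + (r + 1)).
have sc i : smooth (c i).
  have s1 := smoothB (smooth_cst (r + 1)) (smooth_coord i).
  have s2 := smoothD (smooth_coord i) (smooth_cst (r + 1)).
  exact: (smoothM (smooth_comp1 sk s1) (smooth_comp1 sk s2)).
exists (fun x => c 0 x * c 1 x); split.
- exact: smoothM.
- move=> x H.
  by rewrite /c !k1 ?mulr1// ?lerBrDr; have := H 0; have := H 1;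
    rewrite !ler_norml => /andP[? ?] /andP[? ?]; lra.
- move=> x /existsNP[i /negP]; rewrite -ltNge => H.
  have ci0 : c i x = 0.
    rewrite /c; have [xi|xi] := leP (r + 1) (x 0 i).
      by rewrite k0 ?mul0r// subr_le0.
    rewrite [X in _ * X]k0 ?mulr0//.
    by move: H; rewrite ltNge ler_norml => /nandP[]; rewrite -ltNge; lra.
  by have [i0|i0] := ord2P i; rewrite i0 in ci0; rewrite ci0 ?mul0r ?mulr0.
Qed.

End BoxesAndSupports.

(** * Compactly supported distributions as functionals on all smooth functions *)

Section CompactDistributions.
Context {R : realType}.
Implicit Types (phi psi : 'rV[R]_2 -> R) (T S : functional R).

Lemma linear_on_smooth0 T : linear_on_smooth T -> T (fun=> 0) = 0.
Proof.
move=> /(_ (-1) _ _ (smooth_cst 0) (smooth_cst 0)).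
rewrite [X in T X](_ : _ = fun=> 0); last by apply/funext => x; rewrite mulr0 addr0.
by move=> ->; rewrite mulN1r addNr.
Qed.

Lemma linear_on_smoothD T phi psi : linear_on_smooth T -> smooth phi -> smooth psi ->
  T (fun x => phi x + psi x) = T phi + T psi.
Proof.
move=> lT s1 s2; rewrite -[T phi]mul1r -lT//; congr T.
by apply/funext => x; rewrite mul1r.
Qed.

Lemma linear_on_smoothZ T a phi : linear_on_smooth T -> smooth phi ->
  T (fun x => a * phi x) = a * T phi.
Proof.
move=> lT s1; rewrite -[RHS]addr0 -(linear_on_smooth0 lT) -(lT a _ _ s1 (smooth_cst 0)).
by congr T; apply/funext => x; rewrite addr0.
Qed.

Lemma linear_on_smoothB T phi psi : linear_on_smooth T -> smooth phi -> smooth psi ->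
  T (fun x => phi x - psi x) = T phi - T psi.
Proof.
move=> lT s1 s2; rewrite -mulN1r addrC -lT//; congr T.
by apply/funext => x; rewrite mulN1r addrC.
Qed.

(** Continuity for one C^N norm on one box, tested on all smooth functions: polynomials and ray
    integrals, which need not have compact support, can be inserted directly. *)
Definition seminorm_bounded T : Prop := exists (C : R) (N : nat) (r : R), 0 <= C /\
  forall phi M, smooth phi -> 0 <= M -> (forall x, box r x -> partials_le N phi x M) ->
  `|T phi| <= C * M.

Lemma localized_bound T (chi : 'rV[R]_2 -> R) (A : set 'rV[R]_2) :
  locally_finite_order T -> smooth chi -> compact A ->
  (forall x, ~ A x -> chi x = 0) ->
  (forall phi, smooth phi -> T phi = T (fun x => chi x * phi x)) ->
  exists (C : R) (N : nat), 0 <= C /\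
    forall phi M, smooth phi -> 0 <= M -> (forall x, A x -> partials_le N phi x M) ->
    `|T phi| <= C * M.
Proof.
move=> loT schi cA chi0 TE.
have [C [N [C0 HC]]] := loT _ cA.
have [D D0 HD] := partials_le_compact N schi cA.
exists (C * (2 ^+ N * D)), N; split; first by rewrite !mulr_ge0// exprn_ge0.
move=> phi M sphi M0 HM; rewrite TE// -mulrA.
have scp := smoothM schi sphi.
apply: HC.
- by apply: test_function_sub => // x /chi0 ->; rewrite mul0r.
- by rewrite !mulr_ge0// exprn_ge0.
- by move=> s sN x Ax; apply: (partials_leM schi sphi (HD x Ax) (HM x Ax)).
Qed.

Lemma compact_distribution_cutoff T : compact_distribution T -> exists2 r, 0 <= r &
  forall chi, smooth chi -> (forall x, box r x -> chi x = 1) ->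
  forall phi, smooth phi -> T phi = T (fun x => chi x * phi x).
Proof.
move=> [lT _ [K cK HK]].
have [r r0 Kr] := compact_sub_box cK.
(* The margin 1 makes (1 - chi) phi vanish on an open set around K, so that its support, which is a
   closure, misses K. *)
exists (r + 1); first by rewrite addr_ge0.
move=> chi schi chi1 phi sphi; apply/eqP; rewrite -subr_eq0; apply/eqP.
have scp := smoothM schi sphi.
rewrite -linear_on_smoothB//; apply: HK; first exact: smoothB.
have [W [oW rW Wr]] : exists W : set 'rV[R]_2,
    [/\ open W, box r `<=` W & W `<=` box (r + 1)].
  by apply: box_interior; rewrite ltrDl.
have sW : supp (fun x => phi x - chi x * phi x) `<=` ~` W.
  by apply: supp_disjoint => // x /Wr /chi1 ->; rewrite mul1r subrr.
by apply/seteqP; split => // x [/sW nWx /Kr/rW].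
Qed.

(** Forwards, a cutoff reduces an arbitrary smooth function to one supported in a fixed box, where
    the finite order applies. Backwards, a function supported off the box has zero derivatives on
    it, so the bound can be used with M = 0. *)
Lemma compact_distributionP T :
  compact_distribution T <-> linear_on_smooth T /\ seminorm_bounded T.
Proof.
split=> [cT|[lT [C [N [r [C0 HC]]]]]].
  have [lT loT _] := cT; split=> //.
  have [r r0 Hr] := compact_distribution_cutoff cT.
  have [chi [schi chi1 chi0]] := box_cutoff r.
  have [C [N [C0 HC]]] := localized_bound loT schi (@compact_box R (r + 1)) chi0
    (Hr chi schi chi1).
  by exists C, N, (r + 1).
split=> //.
- move=> K cK; exists C, N; split=> // phi [sphi _ sK] M M0 HM.
  apply: HC => // x _; have [Kx|nKx] := pselect (K x).
    by move=> s sN; apply: HM.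
  by apply: partials_le_notin_supp => // /sK.
- exists (box r); first exact: compact_box.
  move=> phi sphi dis; apply/eqP; rewrite -normr_le0 -(mulr0 C); apply: HC => //.
  move=> x bx; apply: partials_le_notin_supp => // sx.
  by have : (supp phi `&` box r) x by []; rewrite dis.
Qed.

Lemma compact_distribution_order T : compact_distribution T -> locally_finite_order T.
Proof. by case. Qed.

Lemma compact_distribution_eq T S : compact_distribution T ->
  compact_distribution S -> eq_distr_on setT T S ->
  forall phi, smooth phi -> T phi = S phi.
Proof.
move=> cT cS TS phi sphi.
have [r1 _ H1] := compact_distribution_cutoff cT.
have [r2 _ H2] := compact_distribution_cutoff cS.
have [chi [schi chi1 chi0]] := box_cutoff (Num.max r1 r2).
have scp := smoothM schi sphi.
rewrite (H1 chi)//; last by move=> x bx; apply/chi1/(box_le _ bx); rewrite le_max lexx.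
rewrite (H2 chi)//; last first.
  by move=> x bx; apply/chi1/(box_le _ bx); rewrite le_max lexx orbT.
apply: TS; have [? ? _] : test_function (box (Num.max r1 r2 + 1)) (fun x => chi x * phi x).
  apply: test_function_sub => //; first exact: compact_box.
  by move=> x /chi0 ->; rewrite mul0r.
by split.
Qed.

Lemma compact_distribution0 : compact_distribution (fun=> 0 : R).
Proof.
apply/compact_distributionP; split.
  by move=> a phi psi _ _; rewrite mulr0 addr0.
exists 0, 0%N, 0; split=> // phi M _ M0 _; by rewrite normr0 mul0r.
Qed.

Lemma compact_distributionDZ a T S : compact_distribution T ->
  compact_distribution S -> compact_distribution (fun phi => a * T phi + S phi).
Proof.
move=> /compact_distributionP[lT [C [N [r [C0 HC]]]]].
move=> /compact_distributionP[lS [C' [N' [r' [C0' HC']]]]].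
apply/compact_distributionP; split.
  by move=> b phi psi sphi spsi; rewrite lT// lS//; ring.
exists (`|a| * C + C'), (maxn N N'), (Num.max r r'); split.
  by rewrite addr_ge0// mulr_ge0.
move=> phi M sphi M0 HM; apply: le_trans (ler_normD _ _) _.
rewrite mulrDl normrM -mulrA lerD// ?ler_wpM2l//.
- apply: HC => // x bx; apply: partials_leW (HM x _); rewrite ?leq_maxl//.
  by apply: box_le bx; rewrite le_max lexx.
- apply: HC' => // x bx; apply: partials_leW (HM x _); rewrite ?leq_maxr//.
  by apply: box_le bx; rewrite le_max lexx orbT.
Qed.

Lemma compact_distributionD T S : compact_distribution T ->
  compact_distribution S -> compact_distribution (fun phi => T phi + S phi).
Proof.
move=> cT cS; have := compact_distributionDZ 1 cT cS; congr compact_distribution.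
by apply/funext => phi; rewrite mul1r.
Qed.

Lemma compact_distributionZ a T : compact_distribution T ->
  compact_distribution (fun phi => a * T phi).
Proof.
move=> cT; have := compact_distributionDZ a cT compact_distribution0.
by congr compact_distribution; apply/funext => phi; rewrite addr0.
Qed.

Lemma compact_distributionB T S : compact_distribution T ->
  compact_distribution S -> compact_distribution (fun phi => T phi - S phi).
Proof.
move=> cT cS; have := compact_distributionDZ (-1) cS cT; congr compact_distribution.
by apply/funext => phi; rewrite mulN1r addrC.
Qed.

Lemma compact_distribution_sum (I : Type) (s : seq I) (P : pred I) (F : I -> functional R) :
  (forall i, compact_distribution (F i)) ->
  compact_distribution (fun phi => \sum_(i <- s | P i) F i phi).
Proof.
move=> cF; elim: s => [|i s IH].
  by under eq_fun do rewrite big_nil; exact: compact_distribution0.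
under eq_fun do rewrite big_cons.
by case: (P i); [exact: compact_distributionD|exact: IH].
Qed.

Lemma compact_distribution_partial i T : compact_distribution T ->
  compact_distribution (distr_partial i T).
Proof.
move=> /compact_distributionP[lT [C [N [r [C0 HC]]]]].
apply/compact_distributionP; split.
  move=> a phi psi sphi spsi; rewrite /distr_partial.
  have := partialsDZ [:: i] a sphi spsi; rewrite /= => ->.
  have s1 := smooth_partial i sphi; have s2 := smooth_partial i spsi.
  by rewrite lT//; ring.
exists C, N.+1, r; split=> // phi M sphi M0 HM.
rewrite /distr_partial normrN; apply: (HC _ _ (smooth_partial i sphi) M0).
by move=> x bx; apply: partials_le_partial; exact: HM.
Qed.

Lemma box_along r i x t : box r x -> 0 <= t <= 1 -> box r (along i (0 : R) x t).
Proof.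
move=> bx /andP[t0 t1] j; have [->|ji] := eqVneq j i; last first.
  by rewrite along_coord_neq.
rewrite along_coord add0r subr0 normrM (ger0_norm t0).
by apply: le_trans (bx i); rewrite ler_piMl.
Qed.

Lemma partials_le_antiderivative N i phi r M : smooth phi -> 0 <= r ->
  (forall x, box r x -> partials_le N phi x M) ->
  forall x, box r x -> partials_le N (antiderivative i 0 phi) x ((r + 1) * M).
Proof.
move=> + r0; elim: N phi => [|N IH] phi sphi HM x bx.
  move=> s; rewrite leqn0 size_eq0 => /eqP ->.
  apply: le_trans (antiderivative_norm_le (M := M) sphi _) _.
    by move=> t t01; apply: (HM _ (box_along i bx t01) [::]).
  have M0 := partials_le_ge0 (HM x bx).
  by rewrite subr0 ler_wpM2r//; apply: le_trans (bx i) _; rewrite lerDl.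
have HM' y : box r y -> partials_le N phi y M.
  by move=> yr; apply: partials_leW (HM y yr).
apply: partials_leS; first exact: (IH _ sphi HM' x bx [::]).
move=> j; have [->|ji] := eqVneq j i.
  rewrite partial_antiderivative//; apply: partials_leW (HM' x bx) => //.
  by rewrite mulrDl mul1r lerDr mulr_ge0// (partials_le_ge0 (HM x bx)).
rewrite partial_antiderivative_neq//.
apply: (IH _ (smooth_partial j sphi) _ x bx).
by move=> y yr; apply: partials_le_partial; exact: HM.
Qed.

Lemma compact_distribution_antiderivative i T : compact_distribution T ->
  compact_distribution (fun phi => T (antiderivative i 0 phi)).
Proof.
move=> /compact_distributionP[lT [C [N [r [C0 HC]]]]].
apply/compact_distributionP; split.
  move=> a phi psi sphi spsi; rewrite (antiderivativeDZ i 0 a sphi spsi).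
  exact: (lT a _ _ (smooth_antiderivative i 0 sphi) (smooth_antiderivative i 0 spsi)).
exists (C * (`|r| + 1)), N, `|r|; split; first by rewrite mulr_ge0// addr_ge0.
move=> phi M sphi M0 HM; rewrite -mulrA; apply: HC.
- exact: smooth_antiderivative.
- by rewrite mulr_ge0// addr_ge0.
- move=> x bx; apply: (partials_le_antiderivative i sphi (normr_ge0 r) HM).
  by apply: box_le bx; exact: ler_norm.
Qed.

(** Transposed integration: S phi is minus T of the antiderivative of phi. Integrating
    [partial i phi] returns [phi] up to a function independent of x_i, and [T] annihilates that
    error by hypothesis. *)
Lemma distr_partial_surj i T : compact_distribution T ->
  (forall phi, smooth phi -> partial i phi = (fun=> 0) -> T phi = 0) ->
  exists2 S, compact_distribution S &
    forall phi, smooth phi -> distr_partial i S phi = T phi.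
Proof.
move=> cT H; have [lT _] := (compact_distributionP T).1 cT.
exists (fun phi => -1 * T (antiderivative i 0 phi)).
  exact: (compact_distributionZ (-1) (compact_distribution_antiderivative i cT)).
move=> phi sphi; rewrite /distr_partial mulN1r opprK.
have s1 := smooth_partial i sphi; have s2 := smooth_antiderivative i 0 s1.
apply/eqP; rewrite -subr_eq0 -linear_on_smoothB//; apply/eqP; apply: H.
  exact: smoothB.
have := partialsB [:: i] s2 sphi; rewrite /= => ->.
by rewrite partial_antiderivative//; apply/funext => x; rewrite subrr.
Qed.

End CompactDistributions.

#[global] Opaque compact_distribution.

(** * Solving the Saint-Venant relation by division *)

Section DivisionByGradient.
Context {R : realType}.
Implicit Types (phi psi : 'rV[R]_2 -> R) (T S : functional R).

Definition partial_pow (a b : nat) phi : 'rV[R]_2 -> R :=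
  iter a (partial 0) (iter b (partial 1) phi).

Lemma smooth_iter_partial i n phi : smooth phi -> smooth (iter n (partial i) phi).
Proof. by move=> sphi; elim: n => [//|n IH]; exact: smooth_partial. Qed.

Lemma smooth_partial_pow a b phi : smooth phi -> smooth (partial_pow a b phi).
Proof. by move=> sphi; do 2 apply: smooth_iter_partial. Qed.

Lemma iter_partialC i j n phi : smooth phi ->
  iter n (partial i) (partial j phi) = partial j (iter n (partial i) phi).
Proof.
move=> sphi; elim: n => [//|n IH]; rewrite !iterS IH.
exact/partialC/smooth_iter_partial.
Qed.

Lemma partial_powSl a b phi : smooth phi ->
  partial_pow a.+1 b phi = partial_pow a b (partial 0 phi).
Proof. by move=> sphi; rewrite /partial_pow (iter_partialC 1 0)// iterSr. Qed.

Lemma iter_partialDZ i n (a : R) phi psi : smooth phi -> smooth psi ->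
  iter n (partial i) (fun x => a * phi x + psi x) =
  fun x => a * iter n (partial i) phi x + iter n (partial i) psi x.
Proof.
have itE f : iter n (partial i) f = partials (nseq n i) f.
  by elim: n => //= n ->.
by rewrite !itE; exact: partialsDZ.
Qed.

Lemma partial_powDZ a b (c : R) phi psi : smooth phi -> smooth psi ->
  partial_pow a b (fun x => c * phi x + psi x) =
  fun x => c * partial_pow a b phi x + partial_pow a b psi x.
Proof.
move=> sphi spsi; rewrite /partial_pow (iter_partialDZ _ _ _ sphi spsi).
exact: (iter_partialDZ _ _ _ (smooth_iter_partial _ _ sphi) (smooth_iter_partial _ _ spsi)).
Qed.

Lemma compact_distribution_partial_pow a b T : compact_distribution T ->
  compact_distribution (fun phi => T (partial_pow a b phi)).
Proof.
have cD i S : compact_distribution S ->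
    compact_distribution (fun phi => S (partial i phi)).
  move=> /(compact_distribution_partial i) /(compact_distributionZ (-1)).
  by congr compact_distribution; apply/funext => phi; rewrite /distr_partial mulN1r opprK.
have cI i n S : compact_distribution S ->
    compact_distribution (fun phi => S (iter n (partial i) phi)).
  elim: n S => [//|n IH] S /(cD i)/IH; congr compact_distribution.
by move=> /(cI 0 a)/(cI 1 b).
Qed.

(* Induction on m: for phi = d_1^m psi with d_0 psi = 0 the hypothesis reduces to
   h_0 phi = 0, hence h_0 = d_0 v_0; then d_0 cancels from the relation for
   h_1 - d_1 v_0, h_2, ..., h_m. *)
Theorem divide_by_gradient (m : nat) (h : nat -> functional R) :
  (forall a, compact_distribution (h a)) ->
  (forall phi, smooth phi ->
    \sum_(a < m.+1) (-1) ^+ a * h a (partial_pow a (m - a) phi) = 0) ->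
  exists2 v : nat -> functional R, forall a, compact_distribution (v a) &
    forall phi a, smooth phi -> (a <= m)%N -> h a phi =
      (if (a < m)%N then distr_partial 0 (v a) phi else 0) +
      (if (0 < a)%N then distr_partial 1 (v a.-1) phi else 0).
Proof.
elim: m h => [|m IH] h ch H.
  exists (fun=> fun=> 0); first by move=> _; exact: compact_distribution0.
  move=> phi a sphi; rewrite leqn0 => /eqP -> /=.
  by have := H _ sphi; rewrite big_ord1 expr0 mul1r addr0.
have lh a : linear_on_smooth (h a) by have [] := (compact_distributionP (h a)).1 (ch a).
have h00 phi : smooth phi -> partial 0 phi = (fun=> 0) -> h 0%N phi = 0.
  move=> sphi phi0.
  pose psi n := iter n (antiderivative 1 0) phi.
  have spsi n : smooth (psi n).
    by elim: n => [|n IHn]; [exact: sphi|exact: smooth_antiderivative].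
  have psi0 n : partial 0 (psi n) = fun=> 0.
    elim: n => // n IHn; have n01 : (0 : 'I_2) != 1 by [].
    rewrite /psi iterS (partial_antiderivative_neq 0 (spsi n) n01) IHn.
    by apply/funext => x; apply: antiderivative0.
  have psiE n : iter n (partial 1) (psi n) = phi.
    elim: n => // n IHn; rewrite iterSr /psi iterS.
    by rewrite (partial_antiderivative 1 0 (spsi n)).
  have := H _ (spsi m.+1); rewrite big_ord_recl expr0 mul1r subn0.
  have -> : partial_pow 0 m.+1 (psi m.+1) = phi by exact: psiE.
  rewrite big1 ?addr0// => a _.
  rewrite lift0 (partial_powSl _ _ (spsi m.+1)) psi0.
  rewrite (_ : partial_pow _ _ _ = fun=> 0) ?linear_on_smooth0 ?mulr0//.
  have it0 i n : iter n (partial i) (fun=> 0 : R) = fun=> 0.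
    by elim: n => //= n ->; rewrite partial_cst.
  by rewrite /partial_pow !it0.
have [v0 cv0 v0E] := distr_partial_surj (ch 0%N) h00.
pose h' a : functional R := if a is 0%N then fun phi => h 1%N phi - distr_partial 1 v0 phi
  else h a.+1.
have ch' a : compact_distribution (h' a).
  case: a => [|a]; last exact: ch.
  apply: compact_distributionB; first exact: ch.
  exact: compact_distribution_partial.
have H' phi : smooth phi ->
    \sum_(a < m.+1) (-1) ^+ a * h' a (partial_pow a (m - a) phi) = 0.
  (* Every smooth [phi] is [partial 0 psi], which is what allows a factor d_0 to be cancelled. The
     term a = 0 then becomes - v0 (d_1^(m+1) phi), which merges with [h 1] into [h' 0]. *)
  move=> sphi; set psi := antiderivative 0 0 phi.
  have spsi : smooth psi by exact: smooth_antiderivative.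
  have psiE : partial 0 psi = phi by exact: partial_antiderivative.
  have := H _ spsi; rewrite big_ord_recl expr0 mul1r subn0.
  under eq_bigr => a _.
    rewrite lift0 subSS (partial_powSl _ _ spsi) psiE exprS -mulrA mulN1r.
    over.
  rewrite sumrN => /eqP; rewrite subr_eq0 => /eqP E.
  move: E; rewrite !big_ord_recl !expr0 !mul1r !subn0.
  under [X in _ = _ + X -> _]eq_bigr => a _ do
    rewrite lift0 -[h _]/(h' a.+1) -lift0.
  move=> E.
  rewrite [h' ord0]/= addrAC; apply/eqP; rewrite subr_eq0; apply/eqP.
  transitivity (h 0%N (partial_pow 0 m.+1 psi)); first by rewrite E.
  rewrite -v0E; last exact: smooth_partial_pow.
  rewrite /distr_partial; congr (- v0 _).
  by rewrite -[partial_pow 0 _ psi]/(iter m.+1 _ psi) -(iter_partialC _ _ _ spsi) psiE.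
have [v cv vE] := IH h' ch' H'.
exists (fun a => if a is a'.+1 then v a' else v0); first by case.
move=> phi [|[|a]] sphi am /=.
- by rewrite addr0 v0E.
- by have := vE phi 0%N sphi isT; rewrite /= addr0 ltnS => <-; rewrite subrK.
- exact: (vE phi a.+1 sphi am).
Qed.

End DivisionByGradient.

(** * Bernstein operators and polynomial approximation on a box *)

Section BernsteinOperator.
Context {R : realType}.
Implicit Types (t : R) (f g : nat -> R).

(* the expectation of f under the binomial law with n trials of probability t *)
Fixpoint binomial_mean n t f : R :=
  if n is n'.+1 then t * binomial_mean n' t (f \o S) + (1 - t) * binomial_mean n' t f
  else f 0%N.

Lemma binomial_meanDZ n t a f g : binomial_mean n t (fun i => a * f i + g i) =
  a * binomial_mean n t f + binomial_mean n t g.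
Proof. by elim: n f g => [//|n IH] f g /=; rewrite /comp !IH; ring. Qed.

Lemma binomial_mean_cst n t c : binomial_mean n t (fun=> c) = c.
Proof. by elim: n => [//|n IH] /=; rewrite /comp IH; ring. Qed.

(** Variance plus squared bias. The free centre [c] is needed for the induction, since shifting the
    index replaces it by c - 1. *)
Lemma binomial_mean_sqr n t c :
  binomial_mean n t (fun i => (i%:R - c) ^+ 2) = n%:R * (t * (1 - t)) + (n%:R * t - c) ^+ 2.
Proof.
elim: n c => [|n IH] c /=; first by rewrite !mul0r !add0r.
have -> : (fun i => (i%:R - c) ^+ 2) \o S = (fun i : nat => (i%:R - (c - 1)) ^+ 2).
  by apply/funext => i /=; rewrite -natr1; ring.
by rewrite !IH -natr1; ring.
Qed.

Lemma le_binomial_mean n t f g : 0 <= t <= 1 ->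
  (forall i, (i <= n)%N -> f i <= g i) -> binomial_mean n t f <= binomial_mean n t g.
Proof.
move=> /andP[t0 t1]; elim: n f g => [|n IH] f g fg /=; first exact: fg.
apply: lerD.
- by rewrite ler_wpM2l//; apply: IH => i ni; exact: (fg i.+1).
- rewrite ler_wpM2l ?subr_ge0//; apply: IH => i ni; apply: fg; exact: leqW.
Qed.

Lemma binomial_meanB n t f g : binomial_mean n t (fun i => f i - g i) =
  binomial_mean n t f - binomial_mean n t g.
Proof.
rewrite -[RHS]addrC -mulN1r -binomial_meanDZ; congr binomial_mean.
by apply/funext => i; rewrite mulN1r addrC.
Qed.

Lemma binomial_mean_norm n t f : 0 <= t <= 1 ->
  `|binomial_mean n t f| <= binomial_mean n t (fun i => `|f i|).
Proof.
move=> t01; rewrite ler_norml -[X in X <= _ <= _]mulN1r; apply/andP; split.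
- rewrite -[X in X <= _]addr0 -[X in _ + X](binomial_mean_cst n t 0).
  rewrite -binomial_meanDZ; apply: le_binomial_mean => // i _.
  by rewrite addr0 mulN1r lerNl -normrN ler_norm.
- by apply: le_binomial_mean => // i _; exact: ler_norm.
Qed.

(** In place of the Cauchy-Schwarz inequality, |u| <= u^2 / eta + eta is averaged over u = t - i/n,
    whose mean square is t (1 - t) / n <= 1 / n. *)
Lemma binomial_mean_dist n t (eta : R) : (0 < n)%N -> 0 <= t <= 1 -> 0 < eta ->
  binomial_mean n t (fun i => `|t - i%:R / n%:R|) <= eta + (n%:R * eta)^-1.
Proof.
move=> n0 t01 eta0; have nR : 0 < n%:R :> R by rewrite ltr0n.
have n2 : n%:R ^+ 2 * eta != 0 by rewrite lt0r_neq0// mulr_gt0// exprn_gt0.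
have nn : n%:R != 0 :> R by rewrite lt0r_neq0.
apply: (@le_trans _ _ (binomial_mean n t (fun i =>
    (n%:R ^+ 2 * eta)^-1 * (i%:R - n%:R * t) ^+ 2 + eta))).
  apply: le_binomial_mean => // i _; set u := t - _.
  have -> : (n%:R ^+ 2 * eta)^-1 * (i%:R - n%:R * t) ^+ 2 = u ^+ 2 / eta.
    rewrite /u; field; by rewrite nn lt0r_neq0.
  rewrite -(ler_pM2r eta0) mulrDl divfK ?lt0r_neq0// -[u ^+ 2]real_normK ?num_real//.
  have : 0 <= `|u| by [].
  have : 0 <= (`|u| - eta) ^+ 2 by exact: sqr_ge0.
  by nra.
rewrite binomial_meanDZ binomial_mean_cst binomial_mean_sqr subrr expr0n addr0 addrC.
rewrite lerD2l.
have -> : (n%:R ^+ 2 * eta)^-1 * (n%:R * (t * (1 - t))) = (t * (1 - t)) * (n%:R * eta)^-1.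
  by field; rewrite nn lt0r_neq0.
rewrite ler_piMl ?invr_ge0 ?mulr_ge0 ?ltW//.
by move: t01 => /andP[? ?]; nra.
Qed.

End BernsteinOperator.

Section PolynomialDensity.
Context {R : realType}.
Implicit Types (phi psi : 'rV[R]_2 -> R) (x : 'rV[R]_2).

Inductive polynomial_function : ('rV[R]_2 -> R) -> Prop :=
| polynomial_monomial c a b :
    polynomial_function (fun x => c * (x 0 0 ^+ a * x 0 1 ^+ b))
| polynomial_add phi psi : polynomial_function phi -> polynomial_function psi ->
    polynomial_function (fun x => phi x + psi x).

Lemma smooth_monomial a b : smooth (fun x : 'rV[R]_2 => x 0 0 ^+ a * x 0 1 ^+ b).
Proof. by apply: smoothM; apply: smoothX; exact: smooth_coord. Qed.

Lemma smooth_polynomial phi : polynomial_function phi -> smooth phi.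
Proof.
elim=> {phi} [c a b|phi psi _ s1 _ s2].
  exact: (smoothZ c (smooth_monomial a b)).
exact: smoothD.
Qed.

Lemma eq_polynomial phi psi : polynomial_function phi -> phi =1 psi ->
  polynomial_function psi.
Proof. by move=> p /funext <-. Qed.

Lemma polynomialZ c phi : polynomial_function phi ->
  polynomial_function (fun x => c * phi x).
Proof.
elim=> {phi} [d a b|phi psi _ s1 _ s2].
  apply: (eq_polynomial (polynomial_monomial (c * d) a b)) => x.
  by rewrite -mulrA.
apply: (eq_polynomial (polynomial_add s1 s2)) => x; by rewrite mulrDr.
Qed.

Lemma polynomial_cst c : polynomial_function (fun=> c).
Proof.
apply: (eq_polynomial (polynomial_monomial c 0 0)) => x.
by rewrite !expr0 !mulr1.
Qed.

Lemma polynomial_coordM i phi : polynomial_function phi ->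
  polynomial_function (fun x => x 0 i * phi x).
Proof.
elim=> {phi} [d a b|phi psi _ s1 _ s2].
  have [->|->] := ord2P i.
    apply: (eq_polynomial (polynomial_monomial d a.+1 b)) => x.
    by rewrite exprS; ring.
  apply: (eq_polynomial (polynomial_monomial d a b.+1)) => x.
  by rewrite exprS; ring.
apply: (eq_polynomial (polynomial_add s1 s2)) => x; by rewrite mulrDr.
Qed.

Lemma polynomial_binomial_mean n i (u v : R) (g : nat -> 'rV[R]_2 -> R) :
  (forall k, polynomial_function (g k)) ->
  polynomial_function (fun x => binomial_mean n (u * x 0 i + v) (fun k => g k x)).
Proof.
elim: n g => [|n IH] g pg /=; first exact: pg.
have p1 := IH _ (fun k => pg k.+1); have p0 := IH _ pg.
have H1 := polynomial_add (polynomialZ u (polynomial_coordM i p1)) (polynomialZ v p1).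
have H0 := polynomial_add (polynomialZ (- u) (polynomial_coordM i p0))
  (polynomialZ (1 - v) p0).
apply: (eq_polynomial (polynomial_add H1 H0)) => x; rewrite /comp /=; ring.
Qed.

Lemma polynomial_antiderivative i c phi : polynomial_function phi ->
  polynomial_function (antiderivative i c phi).
Proof.
elim=> {phi} [d a b|phi psi pphi s1 ppsi s2]; last first.
  apply: (eq_polynomial (polynomial_add s1 s2)) => x.
  have := antiderivativeDZ i c 1 (smooth_polynomial pphi) (smooth_polynomial ppsi).
  move=> /(congr1 (fun f => f x)); rewrite mul1r => <-.
  by congr (antiderivative _ _ _ x); apply/funext => y; rewrite mul1r.
have dX j n x : has_partial j (fun x : 'rV[R]_2 => x 0 j ^+ n.+1) x (n.+1%:R * x 0 j ^+ n).
  elim: n => [|n IH].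
    apply: has_partial_eq (_ : has_partial j (fun x : 'rV[R]_2 => x 0 j) x _) _.
      exact: has_partial_coord.
    by rewrite eqxx mul1r expr0.
  have := has_partialM (has_partial_coord j j x) IH.
  under [X in has_partial _ X]eq_fun do rewrite -exprS.
  by move=> H; apply: (has_partial_eq H); rewrite eqxx mul1r -natr1 !exprS; ring.
have dX0 j k n x : j != k -> has_partial j (fun x : 'rV[R]_2 => x 0 k ^+ n) x 0.
  move=> jk; elim: n => [|n IH]; first by under [X in has_partial _ X]eq_fun do
    rewrite expr0; exact: has_partial_cst.
  have := has_partialM (has_partial_coord j k x) IH.
  under [X in has_partial _ X]eq_fun do rewrite -exprS.
  by move=> H; apply: (has_partial_eq H); rewrite (negbTE jk) mul0r mulr0 addr0.
have [->|->] := ord2P i.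
- pose phi (x : 'rV[R]_2) := (d / a.+1%:R) * (x 0 0 ^+ a.+1 * x 0 1 ^+ b).
  have sphi : smooth phi := smoothZ _ (smooth_monomial _ _).
  have E : (fun x : 'rV[R]_2 => d * (x 0 0 ^+ a * x 0 1 ^+ b)) = partial 0 phi.
    apply/esym/has_partial_partial => x.
    have H := has_partialZ (d / a.+1%:R) (has_partialM (dX 0 a x) (dX0 0 1 b x isT)).
    by apply: (has_partial_eq H); rewrite mulr0 addr0 !mulrA divfK// pnatr_eq0.
  have P := polynomial_add (polynomial_monomial (d / a.+1%:R) a.+1 b)
    (polynomial_monomial (- (d / a.+1%:R * c ^+ a.+1)) 0 b).
  apply: (eq_polynomial P) => x; rewrite E antiderivative_partial// /phi.
  rewrite along_coord mul0r addr0 along_coord_neq// expr0; ring.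
- pose phi (x : 'rV[R]_2) := (d / b.+1%:R) * (x 0 0 ^+ a * x 0 1 ^+ b.+1).
  have sphi : smooth phi := smoothZ _ (smooth_monomial _ _).
  have E : (fun x : 'rV[R]_2 => d * (x 0 0 ^+ a * x 0 1 ^+ b)) = partial 1 phi.
    apply/esym/has_partial_partial => x.
    have H := has_partialZ (d / b.+1%:R) (has_partialM (dX0 1 0 a x isT) (dX 1 b x)).
    apply: (has_partial_eq H); rewrite mul0r add0r.
    by rewrite [X in _ * X]mulrCA !mulrA divfK// pnatr_eq0.
  have P := polynomial_add (polynomial_monomial (d / b.+1%:R) a b.+1)
    (polynomial_monomial (- (d / b.+1%:R * c ^+ b.+1)) a 0).
  apply: (eq_polynomial P) => x; rewrite E antiderivative_partial// /phi.
  rewrite along_coord mul0r addr0 along_coord_neq// expr0; ring.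
Qed.

Lemma point0 (a b : R) : point a b 0 0 = a.
Proof. by rewrite !mxE /= mulr1 mulr0 addr0. Qed.

Lemma point1 (a b : R) : point a b 0 1 = b.
Proof. by rewrite !mxE /= mulr1 mulr0 add0r. Qed.

Lemma pointK x : point (x 0 0) (x 0 1) = x.
Proof.
apply/rowP => i; have [->|->] := ord2P i; first by rewrite point0.
by rewrite point1.
Qed.

Lemma box_point (r a b : R) : `|a| <= r -> `|b| <= r -> box r (point a b).
Proof.
by move=> ar br i; have [->|->] := ord2P i; rewrite ?point0 ?point1.
Qed.

Lemma convex_norm_le (r u v t : R) : `|u| <= r -> `|v| <= r -> 0 <= t <= 1 ->
  `|u + t * (v - u)| <= r.
Proof.
move=> ur vr /andP[t0 t1].
have -> : u + t * (v - u) = (1 - t) * u + t * v by ring.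
apply: le_trans (ler_normD _ _) _; rewrite !normrM (ger0_norm t0).
by rewrite (ger0_norm (_ : 0 <= 1 - t)) ?subr_ge0//; nra.
Qed.

Lemma lipschitz_on_box phi r : smooth phi -> exists2 M, 0 <= M &
  forall a b a' b', `|a| <= r -> `|b| <= r -> `|a'| <= r -> `|b'| <= r ->
    `|phi (point a b) - phi (point a' b')| <= M * (`|a - a'| + `|b - b'|).
Proof.
move=> sphi.
have [M M0 HM] := partials_le_compact 1 sphi (@compact_box R r).
have HMi i x : box r x -> `|partial i phi x| <= M by move=> bx; exact: (HM x bx [:: i]).
exists M => // a b a' b' ar br ar' br'.
rewrite -(subrKA (phi (point a' b))) mulrDr.
apply: le_trans (ler_normD _ _) (lerD _ _).
- have -> : point a b = point a' b + (a - a') *: delta_mx 0 0.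
    by apply/rowP => i; rewrite !mxE; ring.
  apply: partial_mvt => // t t01; apply: HMi.
  have -> : point a' b + (t * (a - a')) *: delta_mx 0 0 = point (a' + t * (a - a')) b.
    by apply/rowP => i; rewrite !mxE; ring.
  by apply: box_point => //; exact: convex_norm_le.
- have -> : point a' b = point a' b' + (b - b') *: delta_mx 0 1.
    by apply/rowP => i; rewrite !mxE; ring.
  apply: partial_mvt => // t t01; apply: HMi.
  have -> : point a' b' + (t * (b - b')) *: delta_mx 0 1 = point a' (b' + t * (b - b')).
    by apply/rowP => i; rewrite !mxE; ring.
  by apply: box_point => //; exact: convex_norm_le.
Qed.

Lemma weierstrass_box phi r e : smooth phi -> 0 < r -> 0 < e ->
  exists2 q, polynomial_function q & forall x, box r x -> `|phi x - q x| <= e.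
Proof.
move=> sphi r0 e0.
have [M M0 HM] := lipschitz_on_box r sphi.
(* Each coordinate contributes an error 2 r M * 2 eta, so the total is 8 r M eta <= e; M + 1 avoids
   division by zero. The choice n > eta^-2 below makes the second term 1/(n eta) of
   [binomial_mean_dist] at most eta. *)
pose eta := e / (8 * r * (M + 1)).
have M1 : 0 < M + 1 by rewrite ltr_wpDl.
have eta0 : 0 < eta by rewrite divr_gt0// !mulr_gt0.
pose n := (Num.truncn (eta ^- 2)).+1.
have n0 : 0 < n%:R :> R by rewrite ltr0n.
have nE : (n%:R * eta)^-1 <= eta.
  have n1 : 0 < n%:R * eta by exact: mulr_gt0.
  rewrite -(ler_pM2r n1) mulVf ?(lt0r_neq0 n1)//.
  rewrite mulrCA -expr2 -ler_pdivrMr ?exprn_gt0// div1r.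
  by apply: ltW; rewrite -truncn_lt_nat ?invr_ge0 ?exprn_ge0 ?ltW.
pose node (i : nat) : R := - r + 2 * r * (i%:R / n%:R).
have node_r i : (i <= n)%N -> `|node i| <= r.
  move=> ni; have i0 : 0 <= i%:R / n%:R :> R by rewrite divr_ge0.
  have i1 : i%:R / n%:R <= 1 :> R by rewrite ler_pdivrMr// mul1r ler_nat.
  by rewrite ler_norml /node; apply/andP; split; nra.
pose par (y : R) := (2 * r)^-1 * y + 2^-1.
have parE y : y = - r + 2 * r * par y by rewrite /par; field; rewrite lt0r_neq0.
have par01 y : `|y| <= r -> 0 <= par y <= 1.
  move=> yr; have := parE y; move: yr; rewrite ler_norml => /andP[y1 y2] E.
  by apply/andP; split; nra.
pose q x := binomial_mean n (par (x 0 0)) (fun i =>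
    binomial_mean n (par (x 0 1)) (fun j => phi (point (node i) (node j)))).
exists q.
  apply: polynomial_binomial_mean => i; apply: polynomial_binomial_mean => j.
  exact: polynomial_cst.
move=> x bx; rewrite /q; have t0 := par01 _ (bx 0); have t1 := par01 _ (bx 1).
rewrite -{1}(binomial_mean_cst n (par (x 0 0)) (phi x)) -binomial_meanB.
apply: le_trans (binomial_mean_norm _ _ t0) _.
apply: (@le_trans _ _ (binomial_mean n (par (x 0 0)) (fun i =>
    (2 * r * M) * `|par (x 0 0) - i%:R / n%:R| + (2 * r * M * (2 * eta))))).
  apply: le_binomial_mean => // i ni.
  rewrite -{1}(binomial_mean_cst n (par (x 0 1)) (phi x)) -binomial_meanB.
  apply: le_trans (binomial_mean_norm _ _ t1) _.
  apply: (@le_trans _ _ (binomial_mean n (par (x 0 1)) (fun j =>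
    (2 * r * M) * `|par (x 0 1) - j%:R / n%:R| +
    (2 * r * M) * `|par (x 0 0) - i%:R / n%:R|))).
    apply: le_binomial_mean => // j nj.
    rewrite -{1}(pointK x).
    apply: le_trans (HM _ _ _ _ (bx 0) (bx 1) (node_r _ ni) (node_r _ nj)) _.
    have nodeE y k : `|y - node k| = 2 * r * `|par y - k%:R / n%:R|.
      rewrite {1}(parE y) /node.
      have -> : - r + 2 * r * par y - (- r + 2 * r * (k%:R / n%:R)) =
        2 * r * (par y - k%:R / n%:R) by ring.
      by rewrite normrM ger0_norm// mulr_ge0// ltW.
    by rewrite !nodeE le_eqVlt; apply/orP; left; apply/eqP; ring.
  rewrite binomial_meanDZ binomial_mean_cst addrC lerD2l ler_wpM2l ?mulr_ge0 ?(ltW r0)//.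
  apply: le_trans (binomial_mean_dist _ t1 eta0) _ => //.
  have -> : 2 * eta = eta + eta by ring.
  by rewrite lerD2l.
rewrite binomial_meanDZ binomial_mean_cst.
apply: (@le_trans _ _ (2 * r * M * (2 * eta) + 2 * r * M * (2 * eta))).
  rewrite lerD2r ler_wpM2l ?mulr_ge0 ?(ltW r0)//.
  apply: le_trans (binomial_mean_dist _ t0 eta0) _ => //.
  have -> : 2 * eta = eta + eta by ring.
  by rewrite lerD2l.
have -> : 2 * r * M * (2 * eta) + 2 * r * M * (2 * eta) = M / (M + 1) * e.
  by rewrite /eta; field; rewrite !lt0r_neq0.
apply: ler_piMl; first exact: ltW.
by rewrite ler_pdivrMr// mul1r lerDl.
Qed.

End PolynomialDensity.

Lemma eq0_norm_le_eps (R : realType) (K a : R) :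
  (forall e, 0 < e -> `|a| <= K * e) -> a = 0.
Proof.
move=> H; apply/eqP/negPn/negP => a0; have an : 0 < `|a| by rewrite normr_gt0.
have K1 : 0 < `|K| + 1 by rewrite ltr_wpDl.
have := H (`|a| / (2 * (`|K| + 1))) (divr_gt0 an (mulr_gt0 (ltr0n _ 2) K1)).
apply/negP; rewrite -ltNge mulrCA gtr_pMr// ltr_pdivrMr ?mulr_gt0//.
by rewrite mul1r; have := ler_norm K; nra.
Qed.

(** * A compactly supported distribution is determined by its moments *)

Section MonomialsDetermine.
Context {R : realType}.
Implicit Types (phi psi : 'rV[R]_2 -> R) (x : 'rV[R]_2) (T : functional R).

Let iterA (c : R) m n phi : 'rV[R]_2 -> R :=
  iter m (antiderivative 0 c) (iter n (antiderivative 1 c) phi).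

Lemma smooth_iter_antiderivative i (c : R) n phi : smooth phi ->
  smooth (iter n (antiderivative i c) phi).
Proof. by move=> sphi; elim: n => [|n IH]; [exact: sphi|exact: smooth_antiderivative]. Qed.

Let smooth_iterA c m n phi : smooth phi -> smooth (iterA c m n phi).
Proof. by move=> sphi; do 2 apply: smooth_iter_antiderivative. Qed.

Let partial_iterA0 c m n phi : smooth phi ->
  partial 0 (iterA c m.+1 n phi) = iterA c m n phi.
Proof. by move=> sphi; exact: (partial_antiderivative 0 c (smooth_iterA c m n sphi)). Qed.

Let partial_iterA1 c m n phi : smooth phi ->
  partial 1 (iterA c m n.+1 phi) = iterA c m n phi.
Proof.
move=> sphi; elim: m => [|m IH].
  exact: (partial_antiderivative 1 c (smooth_iter_antiderivative 1 c n sphi)).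
have n10 : (1 : 'I_2) != 0 by [].
rewrite [iterA c m.+1 _ _]iterS.
by rewrite (partial_antiderivative_neq c (smooth_iterA c m n.+1 sphi) n10) IH.
Qed.

(** Every partial undoes one antiderivative, so derivatives of order at most N of the N-fold
    integral are again iterated integrals, controlled by the sup norm of [phi] alone. *)
Let partials_iterA c s m n phi : smooth phi -> (size s <= m)%N -> (size s <= n)%N ->
  exists m' n', [/\ (m' <= m)%N, (n' <= n)%N &
    partials s (iterA c m n phi) = iterA c m' n' phi].
Proof.
move=> sphi sm sn.
suff [m' [n' [? ? ? ? ?]]] : exists m' n', [/\ (m' <= m)%N, (n' <= n)%N,
    (m - m' <= size s)%N, (n - n' <= size s)%N &
    partials s (iterA c m n phi) = iterA c m' n' phi] by exists m', n'.
elim: s sm sn => [|i s IH] /= sm sn.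
  by exists m, n; split; rewrite ?subnn.
have [m' [n' [mm nn dm dn E]]] := IH (ltnW sm) (ltnW sn); rewrite E.
have [->|->] := ord2P i.
- have m'0 : (0 < m')%N by lia.
  exists m'.-1, n'; split; [lia|lia|lia|lia|].
  by rewrite -{1}(prednK m'0) partial_iterA0.
- have n'0 : (0 < n')%N by lia.
  exists m', n'.-1; split; [lia|lia|lia|lia|].
  by rewrite -{1}(prednK n'0) partial_iterA1.
Qed.

Let box_along_edge i (r : R) x t : box r x -> 0 <= t <= 1 -> box r (along i (- r) x t).
Proof.
move=> bx /andP[t0 t1] j; have [->|ji] := eqVneq j i; last first.
  by rewrite along_coord_neq.
rewrite along_coord; have := bx i; rewrite !ler_norml => /andP[? ?].
by apply/andP; split; nra.
Qed.

Let iter_antiderivative_le i (r e : R) n phi : 0 <= r -> 0 <= e -> smooth phi ->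
  (forall x, box r x -> `|phi x| <= e) -> forall x, box r x ->
  `|iter n (antiderivative i (- r)) phi x| <= (2 * r + 1) ^+ n * e.
Proof.
move=> r0 e0 sphi H; elim: n => [|n IH] x bx; first by rewrite mul1r H.
rewrite iterS exprS -mulrA.
apply: le_trans (antiderivative_norm_le (M := (2 * r + 1) ^+ n * e) _ _) _.
- exact: smooth_iter_antiderivative.
- by move=> t t01; apply: IH; exact: box_along_edge.
- rewrite ler_wpM2r ?mulr_ge0 ?exprn_ge0 ?addr_ge0 ?mulr_ge0//.
  by have := bx i; rewrite !ler_norml => /andP[? ?]; apply/andP; split; lra.
Qed.

Lemma linear_on_smooth_polynomial T : linear_on_smooth T ->
  (forall a b, T (fun x => x 0 0 ^+ a * x 0 1 ^+ b) = 0) ->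
  forall q, polynomial_function q -> T q = 0.
Proof.
move=> lT H q; elim=> {q} [c a b|p q pp Tp pq Tq].
  by rewrite (linear_on_smoothZ c lT (smooth_monomial a b)) H mulr0.
by rewrite (linear_on_smoothD lT (smooth_polynomial pp) (smooth_polynomial pq)) Tp Tq addr0.
Qed.

(* T sees N derivatives.  Cut off phi, approximate d_0^N d_1^N phi by a polynomial
   and integrate N times in each variable from an edge where phi vanishes. *)
Theorem seminorm_bounded_monomials_eq0 T : linear_on_smooth T -> seminorm_bounded T ->
  (forall a b, T (fun x => x 0 0 ^+ a * x 0 1 ^+ b) = 0) ->
  forall phi, smooth phi -> T phi = 0.
Proof.
move=> lT [C [N [r [C0 HC]]]] Tmon phi sphi.
have Tpol := linear_on_smooth_polynomial lT Tmon.
have [chi [schi chi1 chi0]] := box_cutoff (`|r| + 1).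
pose phi1 x := chi x * phi x.
have sphi1 : smooth phi1 := smoothM schi sphi.
have TE : T phi = T phi1.
  apply/eqP; rewrite -subr_eq0 -(linear_on_smoothB lT sphi sphi1) -normr_le0 -(mulr0 C).
  apply: (HC _ _ (smoothB sphi sphi1) (lexx 0)).
  move=> x bx; have [W [oW rW Wr]] : exists W : set 'rV[R]_2,
      [/\ open W, box `|r| `<=` W & W `<=` box (`|r| + 1)].
    by apply: box_interior; rewrite ltrDl.
  apply: (partials_le0_open oW) => //; first by apply: rW; exact: (box_le (ler_norm r)).
  by move=> y /Wr /chi1; rewrite /phi1 => ->; rewrite mul1r subrr.
(* The cut-off function vanishes outside the box of radius |r| + 2, hence on the edges x_i = - rho.
   Integration from these edges therefore recovers it from its derivatives without boundary
   terms. *)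
pose rho := `|r| + 1 + 2; have rho0 : 0 < rho by rewrite /rho -addrA ltr_wpDl.
pose van psi := forall x, ~ box (`|r| + 1 + 1) x -> psi x = 0.
have van_partial psi i : van psi -> van (partial i psi).
  move=> v x nx; apply/eqP; rewrite -normr_le0.
  have nsx : ~ supp psi x by move=> /(supp_sub (@closed_box _ _) v).
  exact: (@partials_le_notin_supp _ psi 1 x 0 nsx (lexx 0) [:: i]).
have vanE psi i : smooth psi -> van psi -> antiderivative i (- rho) (partial i psi) = psi.
  move=> spsi v; apply/funext => x; rewrite antiderivative_partial// [X in _ - X]v ?subr0//.
  move=> /(_ i); rewrite along_coord mul0r addr0 normrN (gtr0_norm rho0).
  by rewrite /rho lerD2l; apply/negP; rewrite -ltNge ltr1n.
have vanIt psi i n : smooth psi -> van psi -> van (iter n (partial i) psi) /\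
    iter n (antiderivative i (- rho)) (iter n (partial i) psi) = psi.
  move=> spsi v; elim: n => [//|n [vn E]]; split; first exact: van_partial.
  by rewrite iterSr [iter n.+1 (partial i) _]iterS (vanE _ i (smooth_iter_partial i n spsi) vn).
have vphi1 : van phi1 by move=> x /chi0; rewrite /phi1 => ->; rewrite mul0r.
pose g0 := iter N (partial 1) (iter N (partial 0) phi1).
have sg0 : smooth g0 := smooth_iter_partial 1 N (smooth_iter_partial 0 N sphi1).
have phi1E : phi1 = iterA (- rho) N N g0.
  have [v0 E0] := vanIt phi1 0 N sphi1 vphi1.
  have [_ E1] := vanIt _ 1 N (smooth_iter_partial 0 N sphi1) v0.
  by rewrite /iterA /g0 E1 E0.
rewrite TE; pose L := (2 * rho + 1) ^+ N * (2 * rho + 1) ^+ N.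
apply: (@eq0_norm_le_eps _ (C * L)) => e e0.
have [q pq Hq] := weierstrass_box sg0 rho0 e0.
have sq := smooth_polynomial pq.
pose g x := g0 x - q x.
have sg : smooth g := smoothB sg0 sq.
have ge x : box rho x -> `|g x| <= e by exact: Hq.
pose P := iterA (- rho) N N q.
have pP : polynomial_function P.
  have pit i n f : polynomial_function f ->
      polynomial_function (iter n (antiderivative i (- rho)) f).
    by move=> pf; elim: n => [//|n IH]; exact: polynomial_antiderivative.
  exact: (pit 0 N _ (pit 1 N _ pq)).
have itB i n f h : smooth f -> smooth h ->
    iter n (antiderivative i (- rho)) (fun x => f x - h x) =
    fun x => iter n (antiderivative i (- rho)) f x - iter n (antiderivative i (- rho)) h x.
  move=> sf sh; elim: n => [//|n IH]; rewrite iterS IH.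
  have s1 := smooth_iter_antiderivative i (- rho) n sf.
  have s2 := smooth_iter_antiderivative i (- rho) n sh.
  rewrite [X in antiderivative _ _ X](_ : _ = (fun x =>
    -1 * iter n (antiderivative i (- rho)) h x + iter n (antiderivative i (- rho)) f x)).
    by rewrite (antiderivativeDZ i (- rho) (-1) s2 s1); apply/funext => x; rewrite mulN1r addrC.
  by apply/funext => x; rewrite mulN1r addrC.
have E : (fun x => phi1 x - P x) = iterA (- rho) N N g.
  rewrite /iterA /g (itB 1 N _ _ sg0 sq).
  rewrite (itB 0 N _ _ (smooth_iter_antiderivative 1 _ _ sg0)
    (smooth_iter_antiderivative 1 _ _ sq)).
  by rewrite {1}phi1E.
have -> : T phi1 = T (iterA (- rho) N N g).
  rewrite -E (linear_on_smoothB lT sphi1 (smooth_polynomial pP)).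
  by rewrite (Tpol _ pP) subr0.
have d1 : 1 <= 2 * rho + 1 by rewrite lerDr mulr_ge0// ltW.
rewrite -mulrA; apply: HC.
- exact: smooth_iterA.
- by rewrite !mulr_ge0 ?exprn_ge0 ?(le_trans ler01 d1)// ltW.
move=> x bx s sN.
have bx' : box rho x.
  by apply: (box_le _ bx); rewrite /rho -addrA; apply: le_trans (ler_norm r) _; rewrite lerDl.
have [m' [n' [mN nN ->]]] := partials_iterA (- rho) sg sN sN.
have e1 : 0 <= (2 * rho + 1) ^+ n' * e by rewrite mulr_ge0 ?exprn_ge0 ?(le_trans ler01 d1)// ltW.
apply: le_trans (iter_antiderivative_le 0 m' (ltW rho0) e1
  (smooth_iter_antiderivative 1 (- rho) n' sg)
  (iter_antiderivative_le 1 n' (ltW rho0) (ltW e0) sg ge) bx') _.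
rewrite mulrA ler_wpM2r ?(ltW e0)// ler_pM ?exprn_ge0 ?(le_trans ler01 d1)//.
- exact: ler_weXn2l.
- exact: ler_weXn2l.
Qed.

End MonomialsDetermine.

(** * Closure properties in one variable; sine and cosine *)

Section Smooth1Closure.
Context {R : realType}.
Implicit Types B C : R -> R.

Lemma smooth1_cst (c : R) : smooth1 (fun=> c).
Proof. exact/smooth1_coord/smooth_cst. Qed.

Lemma smooth1_id : smooth1 (fun t : R => t).
Proof. exact: (smooth1_coord (smooth_coord 0)). Qed.

Lemma smooth1D B C : smooth1 B -> smooth1 C -> smooth1 (fun t => B t + C t).
Proof.
move=> /smooth1_expr sB /smooth1_expr sC; apply: smooth1_coord; exact: (smoothD sB sC).
Qed.

Lemma smooth1M B C : smooth1 B -> smooth1 C -> smooth1 (fun t => B t * C t).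
Proof.
move=> /smooth1_expr sB /smooth1_expr sC; apply: smooth1_coord; exact: (smoothM sB sC).
Qed.

Lemma smooth1X n : smooth1 (fun v : R => v ^+ n).
Proof.
elim: n => [|n IH]; first by under eq_fun do rewrite expr0; exact: smooth1_cst.
by under eq_fun do rewrite exprS; exact: (smooth1M smooth1_id IH).
Qed.

Lemma smooth1_comp B C : smooth1 B -> smooth1 C -> smooth1 (fun t => B (C t)).
Proof. by move=> sB /smooth1_expr sC; apply: smooth1_coord; exact: (smooth_comp1 sB sC). Qed.

Lemma smooth1_derivative B B' : smooth1 B -> (forall t : R, is_derive t 1 B (B' t)) ->
  smooth1 B'.
Proof.
move=> /smooth1_derive[B1 sB1 dB1] dB; suff -> : B' = B1 by [].
by apply/funext => t; have [_ <-] := dB t; have [_ <-] := dB1 t.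
Qed.

Lemma derive_eq0_outside B B' (d : R) : (forall t : R, is_derive t 1 B (B' t)) ->
  (forall v, d < `|v| -> B v = 0) -> forall v, d < `|v| -> B' v = 0.
Proof.
move=> dB B0 v dv; have [_ <-] := dB v.
have D0 : is_derive v (1 : R) B 0.
  apply: (@near_eq_is_derive R R R (fun=> 0) B v 1 0).
  near=> w; apply/esym/B0.
  near: w; have /cvgrPdist_lt := @norm_continuous R R v.
  have vd : 0 < `|v| - d by rewrite subr_gt0.
  move=> /(_ _ vd); apply: filterS => w.
  by move=> /(le_lt_trans (ler_norm _)); lra.
by have [_ ->] := D0.
Unshelve. all: by end_near. Qed.

Lemma is_derive1M B C (B' C' t : R) : is_derive t 1 B B' -> is_derive t 1 C C' ->
  is_derive t 1 (fun s => B s * C s) (B' * C t + B t * C').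
Proof.
move=> dB dC; apply: (is_derive_eq (is_deriveM dB dC)).
by rewrite /GRing.scale /= addrC mulrC.
Qed.

Lemma is_derive1D B C (B' C' t : R) : is_derive t 1 B B' -> is_derive t 1 C C' ->
  is_derive t 1 (fun s => B s + C s) (B' + C').
Proof. by move=> dB dC; exact: (is_deriveD dB dC). Qed.

Lemma is_derive1Z B (a B' t : R) : is_derive t 1 B B' ->
  is_derive t 1 (fun s => a * B s) (a * B').
Proof. by move=> dB; exact: (is_deriveZ a dB). Qed.

(** Differentiating the cosine is a shift by pi/2, which gives the tower of derivatives in closed
    form. *)
Lemma smooth1_cos_shift (c : R) : smooth1 (fun t => cos (t + c)).
Proof.
exists (fun n t => cos (t + (c + n%:R * (pi / 2)))).
  by apply/funext => t; rewrite mul0r addr0.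
move=> n t.
have dl : is_derive t 1 (fun s : R => s + (c + n%:R * (pi / 2))) 1.
  by apply: (is_derive_eq (is_derive1D (is_derive_id t 1) (is_derive_cst _ t 1)));
    rewrite addr0.
apply: (is_derive_eq (is_derive1_chain dl (is_derive_cos _))).
rewrite mulr1 -cosDpihalf -natr1; congr cos; ring.
Qed.

Lemma smooth1_cos : smooth1 (@cos R).
Proof. by have := smooth1_cos_shift 0; under eq_fun do rewrite addr0. Qed.

Lemma smooth1_sin : smooth1 (@sin R).
Proof. by have := smooth1_cos_shift (- (pi / 2)); under eq_fun do rewrite cosBpihalf. Qed.

Lemma sin_norm_le (t : R) : `|sin t| <= `|t|.
Proof.
wlog t0 : t / 0 <= t.
  move=> H; have [/H//|/ltW tn] := leP 0 t.
  have -> : `|sin t| = `|sin (- t)| by rewrite sinN normrN.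
  by rewrite -(normrN t); apply: H; rewrite oppr_ge0.
have csin : {within `[0, t], continuous (@sin R)}.
  by apply: continuous_subspaceT; exact: continuous_sin.
have [x _ E] := MVT_segment t0 (fun x _ => is_derive_sin x) csin.
move: E; rewrite sin0 !subr0 => ->.
by rewrite normrM ler_piMl// cos_max.
Qed.

End Smooth1Closure.

Lemma continuous_one (R : realType) : continuous (fun _ : R => 1 : R).
Proof. by move=> t; exact: cvg_cst. Qed.

Lemma le_sqr_norm (R : realDomainType) (u v : R) : 0 <= u -> u <= `|v| -> u ^+ 2 <= v ^+ 2.
Proof. by move=> u0 uv; rewrite -[v ^+ 2]real_normK ?num_real// lerXn2r ?nnegrE. Qed.

Lemma norm_le_sqr (R : realDomainType) (u v : R) : `|u| <= v -> u ^+ 2 <= v ^+ 2.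
Proof.
by move=> uv; rewrite -[u ^+ 2]real_normK ?num_real// lerXn2r ?nnegrE ?(le_trans _ uv).
Qed.

(** * Back-projections of functions of the signed distance *)

Section RayIntegral.
Context {R : realType}.
Variable c : 'rV[R]_2.
Implicit Types (x : 'rV[R]_2) (B C : R -> R) (k : R -> R).

Definition centered (i : 'I_2) x : R := x 0 i - c 0 i.

Lemma smooth_centered i : smooth (centered i).
Proof. exact: (smoothB (smooth_coord i) (smooth_cst _)). Qed.

Lemma has_partial_centered i j x : has_partial i (centered j) x (i == j)%:R.
Proof.
have H := has_partialD (has_partial_coord i j x) (has_partial_cst i (- c 0 j) x).
by apply: (has_partial_eq H); rewrite addr0.
Qed.

Lemma continuous_norm_centered i : continuous (fun x => `|centered i x|).
Proof.
have cc : continuous (centered i) := smooth_continuous (smooth_centered i).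
by move=> x; exact: (cvg_norm (cc x)).
Qed.

Lemma closed_centered_box (d : R) : closed [set x | forall i, `|centered i x| <= d].
Proof.
have cle i := @closed_comp _ _ _ [set y : R | y <= d]
  (fun x _ => @continuous_norm_centered i x) (@closed_le _ d).
have := closedI (cle 0) (cle 1); congr closed; apply/seteqP; split => x /=.
  by move=> [h0 h1] i; have [->|->] := ord2P i.
by move=> h; split.
Qed.

Lemma compact_centered_box (d : R) : compact [set x | forall i, `|centered i x| <= d].
Proof.
apply: (subclosed_compact (@closed_centered_box d) (@compact_box R (d + `|c|))) => x ri i.
have -> : x 0 i = centered i x + c 0 i by rewrite subrK.
by apply: le_trans (ler_normD _ _) (lerD (ri i) (norm_coord_le c i)).
Qed.

(** These are the components of [perp (unit_vector theta)]. *)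
Definition normal (i : 'I_2) (theta : R) : R :=
  if i == 0 then - sin theta else cos theta.

Lemma normal0 theta : normal 0 theta = - sin theta. Proof. by []. Qed.
Lemma normal1 theta : normal 1 theta = cos theta. Proof. by []. Qed.

(* signed distance of the point c from the line through x with direction angle
   theta, and abscissa of x on this line *)
Definition ray_dist x theta : R :=
  centered 0 x * normal 0 theta + centered 1 x * normal 1 theta.
Definition ray_abscissa x theta : R :=
  centered 0 x * cos theta + centered 1 x * sin theta.

Definition sqdist x : R := centered 0 x ^+ 2 + centered 1 x ^+ 2.

Lemma smooth_sqdist : smooth sqdist.
Proof. exact: (smoothD (smoothX 2 (smooth_centered 0)) (smoothX 2 (smooth_centered 1))). Qed.

Lemma sqdist_ray x theta :
  sqdist x = ray_dist x theta ^+ 2 + ray_abscissa x theta ^+ 2.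
Proof.
rewrite /ray_dist /ray_abscissa /sqdist normal0 normal1.
have -> : centered 0 x ^+ 2 + centered 1 x ^+ 2 =
  (centered 0 x ^+ 2 + centered 1 x ^+ 2) * (cos theta ^+ 2 + sin theta ^+ 2).
  by rewrite cos2Dsin2 mulr1.
ring.
Qed.

Lemma sqdist_normal x theta (i : 'I_2) : sqdist x * normal i theta =
  centered i x * ray_dist x theta +
  ray_abscissa x theta * (if i == 0 then - centered 1 x else centered 0 x).
Proof.
by have [->|->] := ord2P i; rewrite /ray_dist /ray_abscissa /sqdist /normal /=; ring.
Qed.

Lemma continuous_normal i : continuous (normal i).
Proof.
have [->|->] := ord2P i => t; last exact: continuous_cos.
exact: (cvgN (@continuous_sin R t)).
Qed.

Lemma is_derive_ray_dist x (t : R) :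
  is_derive t 1 (ray_dist x) (- ray_abscissa x t).
Proof.
have dN : is_derive t 1 (fun t : R => - sin t) (- cos t) := is_deriveN (is_derive_sin t).
apply: (is_derive_eq (is_derive1D (is_derive1Z (centered 0 x) dN)
  (is_derive1Z (centered 1 x) (is_derive_cos t)))).
by rewrite /ray_abscissa; ring.
Qed.

Lemma is_derive_ray_abscissa x (t : R) :
  is_derive t 1 (ray_abscissa x) (ray_dist x t).
Proof.
apply: (is_derive_eq (is_derive1D (is_derive1Z (centered 0 x) (is_derive_cos t))
  (is_derive1Z (centered 1 x) (is_derive_sin t)))).
by rewrite /ray_dist normal0 normal1.
Qed.

Lemma continuous_ray_dist x : continuous (ray_dist x).
Proof.
by move=> t; apply/differentiable_continuous/derivable1_diffP; case: (is_derive_ray_dist x t).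
Qed.

Lemma continuous_ray_abscissa x : continuous (ray_abscissa x).
Proof.
by move=> t; apply/differentiable_continuous/derivable1_diffP; case: (is_derive_ray_abscissa x t).
Qed.

Lemma ray_dist2pi x : ray_dist x (2 * pi) = ray_dist x 0.
Proof.
by rewrite /ray_dist !normal0 !normal1 (mulr_natl pi 2) cos2pi sin2pi cos0 sin0.
Qed.

Lemma ray_abscissa2pi x : ray_abscissa x (2 * pi) = ray_abscissa x 0.
Proof. by rewrite /ray_abscissa (mulr_natl pi 2) cos2pi sin2pi cos0 sin0. Qed.

(** The back-projection, with angular weight [k], of the function of lines that applies [B] to the
    signed distance from [c]. The adjoint of the mixed ray transform takes this form on the test
    functions used below. *)
Definition ray_integral k B x : R :=
  segment_integral 0 (2 * pi) (fun theta => k theta * B (ray_dist x theta)).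

Let pi2_gt0 : 0 < 2 * pi :> R.
Proof. by rewrite mulr_gt0// pi_gt0. Qed.

Lemma ray_family k B : continuous k -> smooth1 B ->
  smooth_family (fun x theta => k theta * B (ray_dist x theta)).
Proof.
move=> ck sB; apply: (@smooth_family_mul _ (fun _ theta => k theta)).
  exact: smooth_family_param.
apply: (@smooth_family_comp1 _ B ray_dist sB).
by apply: smooth_family_add; (apply: smooth_family_mul;
  [exact: (smooth_family_smooth (smooth_centered _))
  |exact: (smooth_family_param (@continuous_normal _))]).
Qed.

Lemma smooth_ray_integral k B : continuous k -> smooth1 B -> smooth (ray_integral k B).
Proof.
move=> ck sB; exact: (smooth_segment_integral (ltW pi2_gt0) (ray_family ck sB)).
Qed.

(** Iterating this rule is how monomials in the normal, that is in perp xi, appear as angular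
    weights. *)
Lemma partial_ray_integral i k B B' : continuous k -> smooth1 B ->
  (forall t : R, is_derive t 1 B (B' t)) ->
  partial i (ray_integral k B) = ray_integral (fun theta => k theta * normal i theta) B'.
Proof.
move=> ck sB dB; have sB' := smooth1_derivative sB dB.
have ckn : continuous (fun theta => k theta * normal i theta).
  by move=> t; exact: (cvgM (ck t) (@continuous_normal i t)).
apply: (partial_segment_integral (ltW pi2_gt0) (ray_family ck sB) (ray_family ckn sB')).
move=> x t.
have du : has_partial i (ray_dist ^~ t) x (normal i t).
  have H := has_partialD
    (has_partialM (has_partial_centered i 0 x) (has_partial_cst i (normal 0 t) x))
    (has_partialM (has_partial_centered i 1 x) (has_partial_cst i (normal 1 t) x)).
  apply: (has_partial_eq H).
  by have [->|->] := ord2P i; rewrite /= !mulr0 !mul1r !mul0r !addr0 ?add0r.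
apply: (has_partial_eq (has_partialZ (k t) (has_partial_comp du (dB _)))).
by rewrite [B' _ * _]mulrC mulrA.
Qed.

Let continuous_comp_ray k B x : continuous k -> smooth1 B ->
  continuous (fun theta => k theta * B (ray_dist x theta)).
Proof. by move=> ck sB; exact: (smooth_family_slice (ray_family ck sB)). Qed.

Local Notation Psi := (ray_integral (fun=> 1)).

Lemma ray_integralDZ k a B C x : continuous k -> smooth1 B -> smooth1 C ->
  ray_integral k (fun v => a * B v + C v) x = a * ray_integral k B x + ray_integral k C x.
Proof.
move=> ck sB sC; rewrite /ray_integral.
have cB := @continuous_comp_ray _ _ x ck sB; have cC := @continuous_comp_ray _ _ x ck sC.
have caB : continuous (fun theta => a * (k theta * B (ray_dist x theta))).
  by move=> t; exact: (cvgM (cvg_cst _) (cB t)).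
rewrite -segment_integralZ// -segment_integralD//.
by apply: eq_segment_integral => t _; ring.
Qed.

(* |x|^2 eta_i = x_i u + w (J x)_i with u, w the distance and abscissa, and the
   second term contributes the integral of the theta-derivative of B(u) *)
Lemma sqdist_partial_ray_integral i B B' x : smooth1 B ->
  (forall t : R, is_derive t 1 B (B' t)) ->
  sqdist x * partial i (Psi B) x = centered i x * Psi (fun v => v * B' v) x.
Proof.
move=> sB dB; have sB' := smooth1_derivative sB dB.
rewrite (partial_ray_integral i (@continuous_one R) sB dB) /ray_integral.
pose d := if i == 0 then - centered 1 x else centered 0 x.
have c1 : continuous (fun theta => 1 * normal i theta * B' (ray_dist x theta)).
  apply: continuous_comp_ray => // t.
  exact: (cvgM (cvg_cst _) (@continuous_normal i t)).
have c2 : continuous (fun theta => 1 * (ray_dist x theta * B' (ray_dist x theta))).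
  exact: (@continuous_comp_ray _ (fun v => v * B' v) x (@continuous_one R) (smooth1M smooth1_id sB')).
have c3 : continuous (fun theta => - ray_abscissa x theta * B' (ray_dist x theta)).
  apply: (@continuous_comp_ray (fun t => - ray_abscissa x t)) => // t.
  exact: (cvgN (@continuous_ray_abscissa x t)).
have d3 (t : R) : is_derive t 1 (fun t => B (ray_dist x t))
    (- ray_abscissa x t * B' (ray_dist x t)).
  by rewrite mulrC; exact: (is_derive1_chain (is_derive_ray_dist x t) (dB _)).
have := segment_integral_derive pi2_gt0 c3 d3; rewrite ray_dist2pi subrr => I0.
have {}I0 : segment_integral 0 (2 * pi) (fun t =>
    - d * (- ray_abscissa x t * B' (ray_dist x t))) = 0.
  by rewrite segment_integralZ// I0 mulr0.
rewrite -!segment_integralZ// -[RHS]addr0 -[X in _ = _ + X]I0 -segment_integralD//.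
- apply: eq_segment_integral => t _; rewrite mul1r mulrA sqdist_normal -/d; ring.
- by move=> t; exact: (cvgM (cvg_cst _) (c2 t)).
- by move=> t; exact: (cvgM (cvg_cst _) (c3 t)).
Qed.

(* |x|^2 = u^2 + w^2 and an integration by parts in theta *)
Lemma sqdist_ray_integral C C' x : smooth1 C ->
  (forall t : R, is_derive t 1 C (C' t)) ->
  sqdist x * Psi C' x = Psi (fun v => v ^+ 2 * C' v + v * C v) x.
Proof.
move=> sC dC; have sC' := smooth1_derivative sC dC.
rewrite /ray_integral.
have sq : smooth1 (fun v : R => v ^+ 2 * C' v + v * C v).
  exact: (smooth1D (smooth1M (smooth1X 2) sC') (smooth1M smooth1_id sC)).
have c1 := @continuous_comp_ray _ _ x (@continuous_one R) sC'.
have c2 := @continuous_comp_ray _ _ x (@continuous_one R) sq.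
have d3 (t : R) : is_derive t 1 (fun t => C (ray_dist x t) * ray_abscissa x t)
    (C' (ray_dist x t) * - ray_abscissa x t * ray_abscissa x t +
     C (ray_dist x t) * ray_dist x t).
  exact: (is_derive1M (is_derive1_chain (is_derive_ray_dist x t) (dC _))
    (is_derive_ray_abscissa x t)).
have c3 : continuous (fun t => C' (ray_dist x t) * - ray_abscissa x t * ray_abscissa x t +
     C (ray_dist x t) * ray_dist x t).
  have cu := @continuous_ray_dist x; have cw := @continuous_ray_abscissa x.
  have cCu : continuous (fun t => C (ray_dist x t)).
    by move=> t; exact: (cvg_comp _ _ (cu t) (@smooth1_continuous _ _ sC (ray_dist x t))).
  have cC'u : continuous (fun t => C' (ray_dist x t)).
    by move=> t; exact: (cvg_comp _ _ (cu t) (@smooth1_continuous _ _ sC' (ray_dist x t))).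
  move=> t; exact: (cvgD (cvgM (cvgM (cC'u t) (cvgN (cw t))) (cw t)) (cvgM (cCu t) (cu t))).
have := segment_integral_derive pi2_gt0 c3 d3.
rewrite ray_dist2pi ray_abscissa2pi subrr => I0.
rewrite -segment_integralZ// -[LHS]addr0 -[X in _ + X = _]I0 -segment_integralD//; last first.
  by move=> t; exact: (cvgM (cvg_cst _) (c1 t)).
apply: eq_segment_integral => t _; rewrite (sqdist_ray x t); ring.
Qed.

End RayIntegral.

(** * Rescaled back-projections away from the centre *)

Section SmoothPositiveClamp.
Context {R : realType}.

(** Composed with |z|^2, such a function has smooth real powers on the whole plane and still equals
    |z|^2 away from the centre. *)
Lemma smooth_clamp_exists (a : R) : 0 < a -> exists M : R -> R,
  [/\ smooth1 M, forall t, 0 < M t & forall t, 2 * a <= t -> M t = t].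
Proof.
move=> a0; have [k [sk k01 k0 k1]] := @smooth_step_exists R.
pose s t := k (a^-1 * t + (- 1)).
have ss : smooth1 s.
  apply: (smooth1_comp sk).
  exact: (smooth1D (smooth1M (smooth1_cst _) smooth1_id) (smooth1_cst _)).
exists (fun t => a + s t * (t - a)); split.
- apply: (smooth1D (smooth1_cst _) (smooth1M ss _)).
  exact: (smooth1D smooth1_id (smooth1_cst _)).
- move=> t; have /andP[s0 s1] := k01 (a^-1 * t + (- 1)); rewrite -/(s t) in s0 s1.
  have [ta|ta] := leP t a.
    have -> : s t = 0 by apply: k0; rewrite subr_le0 mulrC ler_pdivrMr// mul1r.
    by rewrite mul0r addr0.
  by rewrite ltr_wpDr// mulr_ge0// subr_ge0 ltW.
- move=> t ta; have -> : s t = 1.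
    by apply: k1; rewrite lerBrDr mulrC ler_pdivlMr.
  by rewrite mul1r addrC subrK.
Qed.

End SmoothPositiveClamp.

Section RescaledRayIntegral.
Context {R : realType}.
Variables (c : 'rV[R]_2) (A W : set 'rV[R]_2) (Q : 'rV[R]_2 -> R).
Hypotheses (oW : open W) (AW : A `<=` W) (cA : compact A).
Hypotheses (sQ : smooth Q) (Q0 : forall x, 0 < Q x).
Hypothesis QW : forall x, W x -> Q x = sqdist c x.
Implicit Types (x : 'rV[R]_2) (b : R -> R).

Definition rescale (delta : R) b (v : R) : R := delta^-1 * b (delta^-1 * v).

Lemma smooth1_rescale delta b : smooth1 b -> smooth1 (rescale delta b).
Proof.
move=> sb; apply: (smooth1M (smooth1_cst _)); apply: (smooth1_comp sb).
exact: (smooth1M (smooth1_cst _) smooth1_id).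
Qed.

Local Notation Psi := (ray_integral c (fun=> 1)).

(** On [W] this is |z| times the back-projection. For small delta the latter is close to a constant
    over |z|, so the product is close to a constant. *)
Definition rescaled_ray delta b x : R := Q x `^ 2^-1 * Psi (rescale delta b) x.

Lemma smooth_Q_powR (s : R) : smooth (fun x => Q x `^ s).
Proof. exact: smooth_powR. Qed.

Lemma smooth_rescaled_ray delta b : smooth1 b -> smooth (rescaled_ray delta b).
Proof.
move=> sb; apply: (smoothM (smooth_Q_powR _)).
exact: (smooth_ray_integral c (@continuous_one R) (smooth1_rescale delta sb)).
Qed.

Lemma has_partial_sqdist i x : has_partial i (sqdist c) x (2 * centered c i x).
Proof.
have H (j : 'I_2) := has_partialM (has_partial_centered c i j x)
  (has_partial_centered c i j x).
have H01 := has_partialD (H 0) (H 1).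
have -> : sqdist c = (fun x => centered c 0 x * centered c 0 x +
    centered c 1 x * centered c 1 x) by apply/funext => y; rewrite /sqdist !expr2.
by apply: (has_partial_eq H01); have [->|->] := ord2P i; rewrite /=; ring.
Qed.

Lemma partial_Q i x : W x -> partial i Q x = 2 * centered c i x.
Proof.
move=> Wx; have := @eq_partials_open _ W [:: i] Q (sqdist c) oW QW x Wx.
by rewrite /= => ->; exact: (has_partial_val (has_partial_sqdist i x)).
Qed.

Lemma partial_Q_powR i (s : R) x : W x ->
  partial i (fun x => Q x `^ s) x = 2 * s * centered c i x * Q x `^ (s - 1).
Proof.
move=> Wx; have H := has_partial_comp (smooth_has_partial i x sQ)
  (@is_derive1_powR _ s _ (Q0 x)).
by rewrite (has_partial_val H) partial_Q//; ring.
Qed.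

Lemma Q_powRD (s t : R) x : Q x `^ (s + t) = Q x `^ s * Q x `^ t.
Proof. by rewrite powRD// lt0r_neq0 ?implybT. Qed.

Lemma Q_powR1 (s : R) x : Q x `^ (s - 1) * Q x = Q x `^ s.
Proof. by rewrite -{2}[Q x]powRr1 ?(ltW (Q0 x))// -Q_powRD subrK. Qed.

(** When b' is the derivative of b, this is v (v^2 b)', the profile left by the two integrations by
    parts in [partial_rescaled_ray]. *)
Definition second_moment (b b' : R -> R) (v : R) : R := 2 * v ^+ 2 * b v + v ^+ 3 * b' v.

Lemma smooth1_second_moment b b' : smooth1 b -> smooth1 b' ->
  smooth1 (second_moment b b').
Proof.
move=> sb sb'; exact: (smooth1D (smooth1M (smooth1M (smooth1_cst 2) (smooth1X 2)) sb)
  (smooth1M (smooth1X 3) sb')).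
Qed.

(** The key gain. With B the rescaled profile and C = v B, [sqdist_partial_ray_integral] and the
    derivative of |z| give z_i / |z| times the back-projection of C'. Then [sqdist_ray_integral]
    trades C' for v^2 C' + v C over |z|^2, and the two extra powers of v, where |v| <= delta on the
    support, are the factor delta^2. *)
Lemma partial_rescaled_ray i delta b b' x : smooth1 b ->
  (forall t : R, is_derive t 1 b (b' t)) -> 0 < delta -> W x ->
  partial i (rescaled_ray delta b) x =
  delta ^+ 2 * (centered c i x * Q x `^ (- 2) * rescaled_ray delta (second_moment b b') x).
Proof.
move=> sb db d0 Wx; have sb' := smooth1_derivative sb db.
have dn0 : delta != 0 by rewrite lt0r_neq0.
pose B := rescale delta b; have sB : smooth1 B := smooth1_rescale delta sb.
pose B' v := delta^-1 * (b' (delta^-1 * v) * delta^-1).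
have dB (t : R) : is_derive t 1 B (B' t).
  apply: is_derive1Z; have dl : is_derive t 1 (fun v : R => delta^-1 * v) delta^-1.
    by apply: (is_derive_eq (is_derive1Z delta^-1 (is_derive_id t 1))); rewrite mulr1.
  exact: (is_derive1_chain dl (db _)).
have sB' := smooth1_derivative sB dB.
pose C v := v * B v; have sC : smooth1 C := smooth1M smooth1_id sB.
pose C' v := 1 * B v + v * B' v.
have dC (t : R) : is_derive t 1 C (C' t) := is_derive1M (is_derive_id t 1) (dB t).
have sC' := smooth1_derivative sC dC.
have sp : smooth (Psi B) := smooth_ray_integral c (@continuous_one R) sB.
have := partialM i (smooth_Q_powR 2^-1) sp; rewrite /rescaled_ray -/B => ->.
rewrite partial_Q_powR//.
have E1 := sqdist_partial_ray_integral c i x sB dB.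
have vB' : (fun v => v * B' v) = (fun v => -1 * B v + C' v).
  by apply/funext => v; rewrite /C'; ring.
rewrite vB' (ray_integralDZ c (-1) x (@continuous_one R) sB sC') in E1.
have E2 := sqdist_ray_integral c x sC dC.
have sd := smooth1_second_moment sb sb'.
have E3 : (fun v => v ^+ 2 * C' v + v * C v) =
    (fun v => delta ^+ 2 * rescale delta (second_moment b b') v + 0).
  apply/funext => v; rewrite /C' /C /B /B' /rescale /second_moment; field; exact: dn0.
rewrite E3 (ray_integralDZ c _ x (@continuous_one R) (smooth1_rescale delta sd) (smooth1_cst 0)) in E2.
have Z0 : Psi (fun=> 0) x = 0.
  rewrite /ray_integral (@eq_segment_integral _ _ _ _ (fun=> 0)).
    by rewrite segment_integral_cst ?mul0r// mulr_ge0// pi_ge0.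
  by move=> t _; rewrite mulr0.
rewrite Z0 addr0 -QW// in E2; rewrite -QW// in E1.
set P := Psi B x in E1 *; set PD := ray_integral _ _ (rescale _ _) x in E2 *.
set PC := ray_integral _ _ C' x in E1 E2.
set dP := partial i _ x in E1 *; set z := centered c i x in E1 *.
have q0 := Q0 x; set q := Q x in E1 E2 q0 *.
have qn : q != 0 by rewrite lt0r_neq0.
have rm : q `^ (2^-1 - 1) = q `^ 2^-1 / q.
  by rewrite -[in RHS](Q_powR1 2^-1 x) -/q mulfK.
have q2 : q `^ (- 2) = (q ^+ 2)^-1 by rewrite powRN powR_mulrn// ltW.
rewrite rm q2; set r := q `^ 2^-1.
have PCE : PC = delta ^+ 2 * PD / q by rewrite -E2 mulrC mulKf.
have dPE : dP = z * (-1 * P + PC) / q by rewrite -E1 mulrC mulKf.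
rewrite dPE PCE; field; exact: qn.
Qed.

Lemma partials_le_eq_open n phi psi x M : W x -> (forall y, W y -> phi y = psi y) ->
  partials_le n phi x M -> partials_le n psi x M.
Proof.
move=> Wx E H s sn; rewrite -(@eq_partials_open _ W s phi psi oW E x Wx); exact: H.
Qed.

Lemma bounded_of_support b : smooth1 b -> (forall v, 1 < `|v| -> b v = 0) ->
  exists2 S, 0 <= S & forall v, `|b v| <= S.
Proof.
move=> sb b0; have [M [_ HM]] : bounded_set (b @` `[(- 1 : R), 1]).
  apply: compact_bounded; apply: continuous_compact; last exact: segment_compact.
  by apply: continuous_subspaceT; exact: smooth1_continuous.
exists (`|M| + 1); first by rewrite addr_ge0.
move=> v; have [/b0 ->|v1] := ltP 1 `|v|; first by rewrite normr0 addr_ge0.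
apply: (HM (`|M| + 1)); first by rewrite ltr_pwDr// ler_norm.
by exists v => //=; rewrite in_itv /= -ler_norml.
Qed.

Lemma second_moment_support b b' : (forall t : R, is_derive t 1 b (b' t)) ->
  (forall v, 1 < `|v| -> b v = 0) -> forall v, 1 < `|v| -> second_moment b b' v = 0.
Proof.
move=> db b0 v v1.
by rewrite /second_moment b0// (derive_eq0_outside db b0 v1) !mulr0 addr0.
Qed.

Let weight i x : R := centered c i x * Q x `^ (- 2).

Let smooth_weight i : smooth (weight i).
Proof. exact: (smoothM (smooth_centered c i) (smooth_Q_powR _)). Qed.

Let weight_bound n : exists2 X, 0 <= X & forall x, A x -> forall i, partials_le n (weight i) x X.
Proof.
have [X0 X00 H0] := partials_le_compact n (smooth_weight 0) cA.
have [X1 X10 H1] := partials_le_compact n (smooth_weight 1) cA.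
exists (X0 + X1); first by rewrite addr_ge0.
move=> x Ax i; have [->|->] := ord2P i.
- by apply: partials_leW (H0 x Ax) => //; rewrite lerDl.
- by apply: partials_leW (H1 x Ax) => //; rewrite lerDr.
Qed.

Let partial_step n b b' K X delta x i : smooth1 b ->
  (forall t : R, is_derive t 1 b (b' t)) -> 0 < delta -> A x ->
  partials_le n (weight i) x X ->
  partials_le n (rescaled_ray delta (second_moment b b')) x (K / delta) ->
  partials_le n (partial i (rescaled_ray delta b)) x (2 ^+ n * X * K * delta).
Proof.
move=> sb db d0 Ax HX HK; have sb' := smooth1_derivative sb db.
have sth := smooth_rescaled_ray delta (smooth1_second_moment sb sb').
have H := partials_leZ (delta ^+ 2) (smoothM (smooth_weight i) sth)
  (partials_leM (smooth_weight i) sth HX HK).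
apply: (partials_le_eq_open (AW Ax) (phi := fun x => delta ^+ 2 *
    (weight i x * rescaled_ray delta (second_moment b b') x))).
  by move=> y Wy; rewrite (partial_rescaled_ray i sb db d0 Wy).
apply: partials_leW H => //; rewrite (ger0_norm (sqr_ge0 _)).
rewrite le_eqVlt; apply/orP; left; apply/eqP; field; exact: lt0r_neq0.
Qed.

(** The loss 1/delta is the supremum of the rescaled profile. It does not grow with the order: each
    derivative is a [rescaled_ray] of another profile, with a smooth weight and a factor delta^2.
    The profile must be quantified inside the induction. *)
Lemma rescaled_ray_bound n b : smooth1 b -> (forall v, 1 < `|v| -> b v = 0) ->
  exists2 K, 0 <= K & forall delta x, 0 < delta <= 1 -> A x ->
    partials_le n (rescaled_ray delta b) x (K / delta).
Proof.
have pi0 : 0 <= 2 * pi :> R by rewrite mulr_ge0// pi_ge0.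
elim: n b => [|n IH] b sb b0.
  have [S S0 HS] := bounded_of_support sb b0.
  have [Y Y0 HY] := partials_le_compact 0 (smooth_Q_powR 2^-1) cA.
  exists (Y * (S * (2 * pi))); first by rewrite !mulr_ge0 ?pi_ge0.
  move=> delta x /andP[d0 d1] Ax s; rewrite leqn0 size_eq0 => /eqP -> /=.
  rewrite /rescaled_ray normrM -mulrA ler_pM//; first exact: (HY x Ax [::]).
  rewrite -mulrA mulrCA [X in _ <= X]mulrC mulrAC.
  have := segment_integral_norm_le (M := S / delta) pi0
    (@smooth_family_slice _ _ x (ray_family c (@continuous_one R) (smooth1_rescale delta sb))) _.
  rewrite subr0 [_ * (2 * pi)]mulrAC; apply=> t _.
  rewrite mul1r /rescale normrM normfV (gtr0_norm d0) mulrC.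
  by rewrite ler_wpM2r// invr_ge0 ltW.
have [b' sb' db] := smooth1_derive sb.
have [K K0 HK] := IH _ sb b0.
have [K' K'0 HK'] := IH _ (smooth1_second_moment sb sb') (second_moment_support db b0).
have [X X0 HX] := weight_bound n.
exists (K + 2 ^+ n * X * K'); first by rewrite addr_ge0// !mulr_ge0// exprn_ge0.
move=> delta x /andP[d0 d1] Ax; have dd : 0 < delta <= 1 by rewrite d0.
have di : 0 <= delta^-1 by rewrite invr_ge0 ltW.
apply: partials_leS.
  apply: le_trans (HK delta x dd Ax [::] isT) _.
  by rewrite ler_wpM2r// lerDl !mulr_ge0// exprn_ge0.
move=> i; have := partial_step sb db d0 Ax (HX x Ax i) (HK' delta x dd Ax).
apply: partials_leW => //; apply: (@le_trans _ _ (2 ^+ n * X * K' / delta)).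
  rewrite ler_wpM2l ?mulr_ge0 ?exprn_ge0//.
  by apply: (le_trans d1); rewrite invf_ge1.
by rewrite ler_wpM2r// lerDr.
Qed.

(** The factor delta^2 of the gradient outweighs the loss 1/delta of the crude bound. *)
Lemma partial_rescaled_ray_bound n b : smooth1 b -> (forall v, 1 < `|v| -> b v = 0) ->
  exists2 K, 0 <= K & forall delta x i, 0 < delta <= 1 -> A x ->
    partials_le n (partial i (rescaled_ray delta b)) x (K * delta).
Proof.
move=> sb b0; have [b' sb' db] := smooth1_derive sb.
have [K' K'0 HK'] := rescaled_ray_bound n (smooth1_second_moment sb sb')
  (second_moment_support db b0).
have [X X0 HX] := weight_bound n.
exists (2 ^+ n * X * K'); first by rewrite !mulr_ge0// exprn_ge0.
move=> delta x i /andP[d0 d1] Ax; have dd : 0 < delta <= 1 by rewrite d0.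
exact: (partial_step sb db d0 Ax (HX x Ax i) (HK' delta x dd Ax)).
Qed.

End RescaledRayIntegral.

(** * An annulus around the centre *)

Section Annulus.
Context {R : realType}.
Variables (c : 'rV[R]_2) (eps rho : R).
Hypotheses (eps0 : 0 < eps) (eps_rho : eps <= rho).
Implicit Types x : 'rV[R]_2.

Definition annulus : set 'rV[R]_2 :=
  [set x | (exists i, eps <= `|centered c i x|) /\ forall i, `|centered c i x| <= rho].

(** The annulus is measured in the sup norm, this neighbourhood in the Euclidean one: on the annulus
    eps^2 <= |z|^2 <= 2 rho^2, and the constants leave room for strict inequalities. *)
Definition annulus_nbhs : set 'rV[R]_2 :=
  [set x | eps ^+ 2 / 2 < sqdist c x < 2 * rho ^+ 2 + 1].

Lemma open_annulus_nbhs : open annulus_nbhs.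
Proof.
have -> : annulus_nbhs = sqdist c @^-1` [set` `]eps ^+ 2 / 2, 2 * rho ^+ 2 + 1[].
  by apply/seteqP; split => x; rewrite /= in_itv.
by apply: open_comp => [x _|]; [exact: (smooth_continuous (smooth_sqdist c))|exact: interval_open].
Qed.

Lemma annulus_sub : annulus `<=` annulus_nbhs.
Proof.
move=> x [[i ei] ri]; have r0 := ri 0; have r1 := ri 1.
have := norm_le_sqr r0; have := norm_le_sqr r1.
have := le_sqr_norm (ltW eps0) ei.
have := sqr_ge0 (centered c 0 x); have := sqr_ge0 (centered c 1 x).
have : 0 < eps ^+ 2 by rewrite exprn_gt0.
rewrite /annulus_nbhs /= /sqdist.
by have [->|->] := ord2P i => ? ? ? ? ? ?; apply/andP; split; lra.
Qed.

Lemma compact_annulus : compact annulus.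
Proof.
have cge i : closed [set x | eps <= `|centered c i x|].
  by apply: (@closed_comp _ _ (fun x => `|centered c i x|) [set y | eps <= y]);
    [move=> x _; exact: continuous_norm_centered|exact: closed_ge].
have clA : closed annulus.
  have := closedI (closedU (cge 0) (cge 1)) (@closed_centered_box R c rho).
  congr closed; apply/seteqP; split => x /= [e ri]; split=> //.
    by case: e; [exists 0|exists 1].
  by case: e => i; have [->|->] := ord2P i; [left|right].
by apply: (subclosed_compact clA (@compact_centered_box R c rho)) => x [].
Qed.

Definition annulus_base : 'rV[R]_2 := c + point rho 0.

Lemma centered_point a b i : centered c i (c + point a b) = if i == 0 then a else b.
Proof.
rewrite /centered mxE addrAC subrr add0r.
by have [->|->] := ord2P i; rewrite ?point0 ?point1.
Qed.

Let rho0 : 0 < rho. Proof. exact: lt_le_trans eps_rho. Qed.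

Lemma annulus_base_in : annulus annulus_base.
Proof.
split; first by exists 0; rewrite centered_point eqxx gtr0_norm.
by move=> i; rewrite centered_point; case: ifP => _; rewrite ?normr0 ?gtr0_norm// ltW.
Qed.

(* The annulus (for the sup norm) is connected by axis-parallel segments. *)
Lemma annulus_variation phi M : smooth phi ->
  (forall x i, annulus x -> `|partial i phi x| <= M) ->
  forall x, annulus x -> `|phi x - phi annulus_base| <= 6 * rho * M.
Proof.
move=> sphi HM x Ax; have M0 : 0 <= M := le_trans (normr_ge0 _) (HM x 0 Ax).
pose P a b := c + point a b.
have annP a b : `|a| <= rho -> `|b| <= rho -> (eps <= `|a| \/ eps <= `|b|) ->
    annulus (P a b).
  move=> ar br ab; split.
    by case: ab => ?; [exists 0|exists 1]; rewrite centered_point.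
  by move=> i; rewrite centered_point; case: ifP.
have len (u v : R) : `|u| <= rho -> `|v| <= rho -> M * `|u - v| <= 2 * rho * M.
  move=> ur vr; rewrite mulrC ler_wpM2r//.
  by apply: le_trans (ler_normB _ _) _; lra.
have seg0 a a' b : `|a| <= rho -> `|a'| <= rho -> `|b| <= rho ->
    (eps <= `|b|) -> `|phi (P a b) - phi (P a' b)| <= 2 * rho * M.
  move=> ar ar' br eb; apply: le_trans (len _ _ ar ar').
  have -> : P a b = P a' b + (a - a') *: delta_mx 0 0.
    by apply/rowP => i; rewrite !mxE; ring.
  apply: partial_mvt => // t t01; apply: HM.
  have -> : P a' b + (t * (a - a')) *: delta_mx 0 0 = P (a' + t * (a - a')) b.
    by apply/rowP => i; rewrite !mxE; ring.
  by apply: annP => //; [exact: convex_norm_le|right].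
have seg1 a b b' : `|a| <= rho -> `|b| <= rho -> `|b'| <= rho ->
    (eps <= `|a|) -> `|phi (P a b) - phi (P a b')| <= 2 * rho * M.
  move=> ar br br' ea; apply: le_trans (len _ _ br br').
  have -> : P a b = P a b' + (b - b') *: delta_mx 0 1.
    by apply/rowP => i; rewrite !mxE; ring.
  apply: partial_mvt => // t t01; apply: HM.
  have -> : P a b' + (t * (b - b')) *: delta_mx 0 1 = P a (b' + t * (b - b')).
    by apply/rowP => i; rewrite !mxE; ring.
  by apply: annP => //; [exact: convex_norm_le|left].
pose a := centered c 0 x; pose b := centered c 1 x.
have [[i ei] ri] := Ax.
have ar : `|a| <= rho := ri 0; have br : `|b| <= rho := ri 1.
have rr : `|rho| <= rho by rewrite gtr0_norm.
have r0 : `|(0 : R)| <= rho by rewrite normr0 ltW.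
have er : eps <= `|rho| by rewrite gtr0_norm.
have -> : x = P a b.
  apply/rowP => j; rewrite mxE /a /b.
  by have [->|->] := ord2P j; rewrite ?point0 ?point1 /centered [RHS]addrC subrK.
have via : `|phi (P a rho) - phi annulus_base| <= 4 * rho * M.
  rewrite -(subrKA (phi (P rho rho))).
  apply: le_trans (ler_normD _ _) _.
  have := seg0 a rho rho ar rr rr er; have := seg1 rho rho 0 rr rr r0 er.
  by rewrite -/annulus_base /P; lra.
have rM : 0 <= rho * M by rewrite mulr_ge0// ltW.
(* A coordinate of modulus at least eps is kept fixed while the other one moves, so the path avoids
   the hole. At most three segments of length at most 2 rho lead to the base point, whence the
   constant 6 rho. *)
have [i0|i1] := ord2P i.
- rewrite -(subrKA (phi (P a rho))); apply: le_trans (ler_normD _ _) _.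
  rewrite i0 -/a in ei; have := seg1 a b rho ar br rr ei; move: via; lra.
- rewrite -(subrKA (phi (P rho b))); apply: le_trans (ler_normD _ _) _.
  rewrite i1 -/b in ei; have := seg0 a rho b ar rr br ei.
  by have := seg1 rho b 0 rr br r0 er; rewrite -/annulus_base /P; lra.
Qed.

End Annulus.

(** * Unique continuation for a scalar distribution *)

Lemma bump_exists (R : realType) : exists b : R -> R, [/\ smooth1 b,
  forall v, 0 <= b v, forall v, `|v| <= 2^-1 -> b v = 1 &
  forall v, 1 < `|v| -> b v = 0].
Proof.
have [k [sk k01 k0 k1]] := @smooth_step_exists R.
have lin (a d : R) : smooth1 (fun v => a * v + d).
  exact: (smooth1D (smooth1M (smooth1_cst _) smooth1_id) (smooth1_cst _)).
exists (fun v => k (2 * v + 2) * k (- 2 * v + 2)); split.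
- exact: (smooth1M (smooth1_comp sk (lin _ _)) (smooth1_comp sk (lin _ _))).
- by move=> v; have /andP[? _] := k01 (2 * v + 2);
    have /andP[? _] := k01 (- 2 * v + 2); rewrite mulr_ge0.
- by move=> v; rewrite ler_norml => /andP[? ?]; rewrite !k1 ?mulr1//; lra.
- move=> v v1; have [v0|v0] := leP 0 v.
    by rewrite [X in _ * X]k0 ?mulr0//; move: v1; rewrite ger0_norm//; lra.
  by rewrite k0 ?mul0r//; move: v1; rewrite ltr0_norm//; lra.
Qed.

Lemma partial_pow_partials (R : realType) a b (phi : 'rV[R]_2 -> R) :
  partial_pow a b phi = partials (nseq a 0 ++ nseq b 1) phi.
Proof.
have itE i n f : iter n (@partial R i) f = partials (nseq n i) f by elim: n => //= n ->.
by rewrite partials_cat -!itE.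
Qed.

Lemma partials_le_partial_pow (R : realType) N a b (phi : 'rV[R]_2 -> R) x M :
  partials_le (N + (a + b)) phi x M -> partials_le N (partial_pow a b phi) x M.
Proof.
move=> H s sN; rewrite partial_pow_partials -partials_cat; apply: H.
by rewrite !size_cat !size_nseq leq_add2r.
Qed.

Section ScalarUniqueContinuation.
Context {R : realType}.
Variables (T : functional R) (c : 'rV[R]_2) (d0 : R).
Hypotheses (cT : compact_distribution T) (d0_gt0 : 0 < d0).
Hypothesis T_near : forall phi, smooth phi ->
  (forall x, ~ (forall i, `|centered c i x| <= d0) -> phi x = 0) -> T phi = 0.
Hypothesis T_rays : forall B, smooth1 B -> (forall v, d0 < `|v| -> B v = 0) ->
  forall a b, T (partial_pow a b (ray_integral c (fun=> 1) B)) = 0.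
Implicit Types (phi psi : 'rV[R]_2 -> R) (x : 'rV[R]_2).

Let lT : linear_on_smooth T. Proof. by have [] := (compact_distributionP T).1 cT. Qed.

Let eps : R := d0 / 2.
Let eps0 : 0 < eps. Proof. by rewrite divr_gt0. Qed.

Lemma localize_to_annulus : exists (rho C : R) (N : nat), [/\ eps <= rho, 1 <= rho, 0 <= C &
  forall phi M, smooth phi -> 0 <= M ->
    (forall x, annulus c eps rho x -> partials_le N phi x M) -> `|T phi| <= C * M].
Proof.
have loT : locally_finite_order T by exact: compact_distribution_order.
have [r r0 Hr] := compact_distribution_cutoff cT.
have [chi [schi chi1 chi0]] := box_cutoff r.
have [k [sk k01 k0 k1]] := @smooth_step_exists R.
(* Here r + 1 + |c| encloses the support of the cutoff as seen from c; the terms eps and 1 secure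
   eps <= rho and 1 <= rho. *)
pose rho := r + 1 + `|c| + eps + 1.
have c0 : 0 <= `|c| by [].
have e2 : 0 < 2 * eps ^+ 2 by rewrite mulr_gt0// exprn_gt0.
(* This is 0 for |z|^2 <= 2 eps^2, hence on the inner box, and 1 for |z|^2 >= 4 eps^2 = d0^2, hence
   wherever some |z_i| >= d0. The region where it differs from 1 thus lies where [T] vanishes. *)
pose kap x := k ((2 * eps ^+ 2)^-1 * sqdist c x + (- 1)).
have ssq := smooth_sqdist c.
have skap : smooth kap.
  exact: (smooth_comp1 sk (smoothD (smoothZ _ ssq) (smooth_cst _))).
have sck : smooth (fun x => kap x * chi x) := smoothM skap schi.
have [C [N [C0 HC]]] : exists (C : R) (N : nat), 0 <= C /\
    forall phi M, smooth phi -> 0 <= M ->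
    (forall x, annulus c eps rho x -> partials_le N phi x M) -> `|T phi| <= C * M.
  apply: (localized_bound loT sck (@compact_annulus R c eps rho)).
  - move=> x nA; have [bx|/chi0 ->] := pselect (box (r + 1) x); last by rewrite mulr0.
    have rx i : `|centered c i x| <= rho.
      apply: le_trans (ler_normB _ _) _.
      by have := bx i; have := norm_coord_le c i; rewrite /rho; move: eps0; lra.
    have ex i : `|centered c i x| <= eps.
      by rewrite leNgt; apply/negP => /ltW exi; apply: nA; split => //; exists i.
    have h0 := norm_le_sqr (ex 0); have h1 := norm_le_sqr (ex 1).
    rewrite /kap k0 ?mul0r// subr_le0 mulrC ler_pdivrMr// mul1r /sqdist; lra.
  - move=> phi sphi; rewrite (Hr chi schi chi1 _ sphi).
    have s1 := smoothM schi sphi; have s2 := smoothM sck sphi.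
    apply/eqP; rewrite -subr_eq0 -(linear_on_smoothB lT s1 s2); apply/eqP.
    apply: T_near; first exact: smoothB.
    move=> x /existsNP[i /negP]; rewrite -ltNge => /ltW di.
    have hi := le_sqr_norm (ltW d0_gt0) di.
    have kap1 : kap x = 1.
      apply: k1; rewrite lerBrDr mulrC ler_pdivlMr//.
      have := sqr_ge0 (centered c 0 x); have := sqr_ge0 (centered c 1 x).
      have -> : (1 + 1) * (2 * eps ^+ 2) = d0 ^+ 2 by rewrite /eps; field.
      by move: hi; rewrite /sqdist; have [->|->] := ord2P i; lra.
    by rewrite kap1 mul1r subrr.
exists rho, C, N; split => //; rewrite /rho; move: eps0; lra.
Qed.

Theorem eq0_of_ray_integrals phi : smooth phi -> T phi = 0.
Proof.
have [rho [C [N [eps_rho rho1 C0 HC]]]] := localize_to_annulus.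
pose A := annulus c eps rho; pose W := annulus_nbhs c eps rho.
have oW : open W by exact: open_annulus_nbhs.
have AW : A `<=` W by exact: annulus_sub.
have cA : compact A by exact: compact_annulus.
(* The clamp fixes every value from 2 * (eps^2 / 4) on, which is the lower bound in
   [annulus_nbhs]. *)
have e4 : 0 < eps ^+ 2 / 4 by rewrite divr_gt0// exprn_gt0.
have [clamp [sclamp clamp0 clampE]] := smooth_clamp_exists e4.
have ssq := smooth_sqdist c.
pose Q x := clamp (sqdist c x).
have sQ : smooth Q := smooth_comp1 sclamp ssq.
have Q0 x : 0 < Q x by exact: clamp0.
have QW x : W x -> Q x = sqdist c x.
  by move=> /andP[Wx _]; apply: clampE; apply: ltW; apply: le_lt_trans Wx; lra.
pose Qp (s : R) x := Q x `^ s.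
have sQp s : smooth (Qp s) := smooth_Q_powR sQ Q0 s.
have sz i : smooth (centered c i) := smooth_centered c i.
have T_eq f g : smooth f -> smooth g -> (forall x, W x -> f x = g x) -> T f = T g.
  move=> sf sg fg; apply/eqP; rewrite -subr_eq0 -(linear_on_smoothB lT sf sg).
  rewrite -normr_le0 -(mulr0 C); apply: (HC _ _ (smoothB sf sg) (lexx 0)) => x Ax.
  apply: (partials_le0_open oW (AW _ Ax)) => // y Wy.
  by rewrite fg// subrr.
(* Asking for all derivatives makes this class stable under partials, and only the values of f on
   [W] matter. *)
pose ker f := forall a b, T (partial_pow a b f) = 0.
have ker_eq f g : smooth f -> smooth g -> (forall x, W x -> f x = g x) -> ker f -> ker g.
  move=> sf sg fg kf a b; rewrite -(kf a b).
  apply: T_eq; [exact: smooth_partial_pow|exact: smooth_partial_pow|].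
  move=> x Wx; rewrite !partial_pow_partials; apply/esym.
  exact: (eq_partials_open _ oW fg Wx).
have ker_DZ u f g : smooth f -> smooth g -> ker f -> ker g -> ker (fun x => u * f x + g x).
  move=> sf sg kf kg a b; rewrite (partial_powDZ _ _ _ sf sg).
  have s1 := smooth_partial_pow a b sf; have s2 := smooth_partial_pow a b sg.
  by rewrite (lT u s1 s2) kf kg mulr0 addr0.
have ker0 : ker (fun=> 0).
  move=> a b; rewrite partial_pow_partials partials_cst0.
  exact: linear_on_smooth0.
have ker_Z u f : smooth f -> ker f -> ker (fun x => u * f x).
  move=> sf kf a b; have := ker_DZ u f _ sf (smooth_cst 0) kf ker0 a b.
  by under eq_fun do rewrite addr0.
have ker_partial i f : smooth f -> ker f -> ker (partial i f).
  move=> sf kf a b; have [->|->] := ord2P i; first by rewrite -partial_powSl.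
  by rewrite -(kf a b.+1) /partial_pow iterSr.
(* The starting point 1/|z|. Since Theta = |z| Psi is cd up to O(delta), Psi - cd / |z| is O(delta)
   with its derivatives on the annulus. As [T] kills the derivatives of Psi and cd >= 1/2, its value
   on those of 1/|z| is O(delta). *)
have kerQ : ker (Qp (- 2^-1)).
  move=> a b; have [bmp [sbmp bmp0 bmp1 bmpS]] := bump_exists R.
  pose Theta delta := rescaled_ray c Q delta bmp.
  have sTheta delta : smooth (Theta delta) := smooth_rescaled_ray c sQ Q0 delta sbmp.
  have [K K0 HK] := partial_rescaled_ray_bound oW AW cA sQ Q0 QW (N + (a + b)) sbmp bmpS.
  have [X X0 HX] := partials_le_compact (N + (a + b)) (sQp (- 2^-1)) cA.
  pose base := annulus_base c rho.
  pose cd delta := Theta delta base.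
  (* At the base point z = (rho, 0) the signed distance is - rho sin theta, at most delta / 2 in
     modulus for 0 <= theta <= delta / (2 rho). There the rescaled bump equals 1/delta, so the
     integral is at least 1 / (2 rho), and |z| = rho. *)
  have cd_ge delta : 0 < delta <= 1 -> 2^-1 <= cd delta.
    move=> /andP[dl0 dl1].
    have rho0 : 0 < rho := lt_le_trans ltr01 rho1.
    have Ab : A base by exact: annulus_base_in.
    have Qb : Q base `^ 2^-1 = rho.
      rewrite (QW _ (AW _ Ab)) /sqdist !centered_point eqxx /= expr0n addr0.
      by rewrite powR12_sqrt ?sqr_ge0// sqrtr_sqr gtr0_norm.
    rewrite /cd /Theta /rescaled_ray Qb -ler_pdivrMl//.
    have sr := smooth1_rescale delta sbmp.
    have len0 : 0 <= delta / (2 * rho) by rewrite divr_ge0 ?ltW// mulr_gt0.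
    have len1 : delta / (2 * rho) <= 2 * pi.
      apply: (@le_trans _ _ 1); last by have := @pi_ge2 R; lra.
      by rewrite ler_pdivrMr ?mulr_gt0// mul1r; lra.
    have c1 := @continuous_one R.
    have pos t : 0 <= t <= 2 * pi -> 0 <= 1 * rescale delta bmp (ray_dist c base t).
      by move=> _; rewrite mul1r mulr_ge0// invr_ge0 ltW.
    have low t : 0 <= t <= delta / (2 * rho) ->
        delta^-1 <= 1 * rescale delta bmp (ray_dist c base t).
      move=> /andP[t0 t1]; rewrite mul1r /rescale bmp1 ?mulr1//.
      rewrite /ray_dist !centered_point eqxx /= mul0r addr0 normal0 mulrN mulrN normrN.
      rewrite !normrM normfV (gtr0_norm dl0) (gtr0_norm rho0) mulrC ler_pdivrMr//.
      have := sin_norm_le t; rewrite (ger0_norm t0) => st.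
      move: t1; rewrite ler_pdivlMr ?mulr_gt0// => t1.
      have : rho * `|sin t| <= rho * t by rewrite ler_wpM2l// ltW.
      by move: t1; lra.
    have := segment_integral_ge_sub (lexx 0) len0 len1
      (@smooth_family_slice _ _ base (ray_family c c1 sr)) pos low.
    apply: le_trans; rewrite subr0.
    rewrite le_eqVlt; apply/orP; left; apply/eqP. field.
    by rewrite (lt0r_neq0 dl0) (lt0r_neq0 rho0).
  pose T' f := T (partial_pow a b f).
  have d1 : 0 < Num.min 1 d0 by rewrite lt_min ltr01.
  (* The first summand bounds the deviation from the constant along the annulus, the second the
     derivatives. *)
  pose K2 := 6 * rho * K + K; have K20 : 0 <= K2 by rewrite addr_ge0// !mulr_ge0// (le_trans ler01).
  apply: (@eq0_norm_le_eps _ (2 * (C * (2 ^+ (N + (a + b)) * X * K2)))) => e e0.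
  (* delta <= 1 is needed for the bounds on Theta, and delta <= d0 keeps the rescaled bump within
     the range of [T_rays]. *)
  pose delta := Num.min e (Num.min 1 d0).
  have dl0 : 0 < delta by rewrite lt_min e0.
  have dle : delta <= e by rewrite ge_min lexx.
  have dl1 : delta <= 1 by rewrite !ge_min lexx orbT.
  have dld : delta <= d0 by rewrite !ge_min lexx !orbT.
  have dd : 0 < delta <= 1 by rewrite dl0.
  pose err x := Theta delta x - cd delta.
  have serr : smooth err := smoothB (sTheta delta) (smooth_cst _).
  have err_le x : A x -> partials_le (N + (a + b)) err x (K2 * delta).
    move=> Ax; apply: (partials_leW (leqnSn _) (lexx _)); apply: partials_leS.
      have H := @annulus_variation _ c eps rho eps0 eps_rho _ (K * delta) (sTheta delta) _ x Ax.
      apply: le_trans (H _) _.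
        by move=> y i Ay; exact: (HK delta y i dd Ay [::]).
      have Kd : 0 <= K * delta by rewrite mulr_ge0// ltW.
      by rewrite /K2; lra.
    move=> i; have -> : partial i err = partial i (Theta delta).
      have := partialsB [:: i] (sTheta delta) (smooth_cst (cd delta)).
      by rewrite /= partial_cst => ->; apply/funext => y; rewrite subr0.
    apply: partials_leW (HK delta x i dd Ax) => //.
    by rewrite /K2 ler_wpM2r ?(ltW dl0)// lerDr !mulr_ge0// (le_trans ler01).
  have se := smoothM (sQp (- 2^-1)) serr.
  have T'err : `|T' (fun x => Qp (- 2^-1) x * err x)| <=
      C * (2 ^+ (N + (a + b)) * X * (K2 * delta)).
    apply: HC; first exact: smooth_partial_pow.
      by rewrite !mulr_ge0 ?exprn_ge0 ?(ltW dl0).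
    move=> x Ax; apply: partials_le_partial_pow.
    exact: (partials_leM (sQp _) serr (HX x Ax) (err_le x Ax)).
  have c1 := @continuous_one R.
  have sr := smooth1_rescale delta sbmp.
  have sPsi := smooth_ray_integral c c1 sr.
  have errE : (fun x => Qp (- 2^-1) x * err x) = (fun x => (- cd delta) * Qp (- 2^-1) x +
      ray_integral c (fun=> 1) (rescale delta bmp) x).
    apply/funext => x; rewrite /err /Theta /rescaled_ray mulrBr mulrA /Qp -Q_powRD//.
    by rewrite addNr powRr0 mul1r mulNr [RHS]addrC [cd _ * _]mulrC.
  have T'Psi : T' (ray_integral c (fun=> 1) (rescale delta bmp)) = 0.
    apply: T_rays => // v vd; rewrite /rescale bmpS ?mulr0//.
    by rewrite normrM normfV (gtr0_norm dl0) mulrC ltr_pdivlMr// mul1r (le_lt_trans dld).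
  move: T'err; rewrite errE /T' (partial_powDZ _ _ _ (sQp _) sPsi).
  rewrite (lT _ (smooth_partial_pow a b (sQp _)) (smooth_partial_pow a b sPsi)).
  rewrite -/(T' (ray_integral _ _ _)) T'Psi addr0 normrM normrN => T'err.
  have cdg := cd_ge delta dd.
  have cdp : 0 <= cd delta by apply: le_trans cdg; rewrite invr_ge0.
  rewrite (ger0_norm cdp) in T'err.
  set t := `|T _|; rewrite -/t in T'err.
  have t0 : 0 <= t by rewrite /t.
  have : 2^-1 * t <= C * (2 ^+ (N + (a + b)) * X * (K2 * delta)).
    by apply: le_trans T'err; rewrite ler_wpM2r.
  have : C * (2 ^+ (N + (a + b)) * X * (K2 * delta)) <= C * (2 ^+ (N + (a + b)) * X * (K2 * e)).
    by rewrite !ler_wpM2l ?mulr_ge0 ?exprn_ge0.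
  have -> : C * (2 ^+ (N + (a + b)) * X * (K2 * e)) =
    (C * (2 ^+ (N + (a + b)) * X * K2)) * e by ring.
  by rewrite -mulrA; lra.
have partial_Qp i s x : W x ->
    partial i (Qp s) x = 2 * s * centered c i x * Qp (s - 1) x.
  by move=> Wx; exact: (partial_Q_powR oW sQ Q0 QW i s Wx).
have Qp1 s x : W x -> Qp (s - 1) x * sqdist c x = Qp s x.
  by move=> Wx; rewrite -QW//; exact: Q_powR1.
have partial_z i j : partial i (centered c j) = fun=> (i == j)%:R.
  by apply: has_partial_partial => x; exact: has_partial_centered.
have ker_zQp i s : ker (Qp s) -> s != 0 -> ker (fun x => centered c i x * Qp (s - 1) x).
  move=> ks s0.
  have sd := smooth_partial i (sQp s).
  apply: (ker_eq (fun x => (2 * s)^-1 * partial i (Qp s) x)).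
  - exact: (smoothZ _ sd).
  - exact: (smoothM (sz i) (sQp _)).
  - move=> x Wx; rewrite partial_Qp//; field.
    by rewrite s0.
  - by apply: (ker_Z _ _ sd); apply: (ker_partial i _ (sQp s)).
(* the Laplacian of |z|^(2s) is 4 s^2 |z|^(2s-2) *)
have kerQpS s : ker (Qp s) -> s != 0 -> ker (Qp (s - 1)).
  move=> ks s0.
  have sz' i := smoothM (sz i) (sQp (s - 1)).
  have kp i := ker_partial i _ (sz' i) (ker_zQp i s ks s0).
  have k01 := ker_DZ 1 _ _ (smooth_partial 0 (sz' 0)) (smooth_partial 1 (sz' 1)) (kp 0) (kp 1).
  have s01 := smoothD (smoothZ 1 (smooth_partial 0 (sz' 0))) (smooth_partial 1 (sz' 1)).
  have kk := ker_Z (2 * s)^-1 _ s01 k01.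
  apply: (ker_eq _ _ (smoothZ _ s01) (sQp _) _ kk) => x Wx.
  have pE i : partial i (fun x => centered c i x * Qp (s - 1) x) x =
      Qp (s - 1) x + 2 * (s - 1) * centered c i x ^+ 2 * Qp (s - 1 - 1) x.
    rewrite (partialM i (sz i) (sQp _)) partial_z eqxx mul1r partial_Qp//; ring.
  rewrite mul1r !pE.
  have := Qp1 (s - 1) x Wx; rewrite /sqdist => E.
  set q := Qp (s - 1) x in E *; set q' := Qp _ x in E *.
  transitivity ((2 * s)^-1 * (2 * q + 2 * (s - 1) *
    (q' * (centered c 0 x ^+ 2 + centered c 1 x ^+ 2)))); first by ring.
  rewrite E; field; exact: s0.
(* The exponents start at -1/2 and drop by integers, so the factor s^2 in the Laplacian never
   vanishes. *)
have half (n : nat) : - 2^-1 - n%:R != 0 :> R.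
  by rewrite lt_eqF// -opprD oppr_lt0 ltr_wpDr// invr_gt0.
have kerQpn (n : nat) : ker (Qp (- 2^-1 - n%:R)).
  elim: n => [|n IH]; first by rewrite subr0.
  have := kerQpS _ IH (half n); congr ker; congr Qp.
  by rewrite -[n.+1%:R]natr1 opprD addrA.
pose mono m n s x := centered c 0 x ^+ m * centered c 1 x ^+ n * Qp s x.
have smono m n s : smooth (mono m n s).
  exact: (smoothM (smoothM (smoothX m (sz 0)) (smoothX n (sz 1))) (sQp s)).
have partialX i n : partial i (fun x => centered c i x ^+ n.+1) =
    fun x => n.+1%:R * centered c i x ^+ n.
  elim: n => [|n IH].
    under [X in partial _ X]eq_fun do rewrite expr1.
    by rewrite partial_z; apply/funext => x; rewrite eqxx mul1r expr0.
  under [X in partial _ X]eq_fun do rewrite exprS.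
  rewrite (partialM i (sz i) (smoothX n.+1 (sz i))) IH partial_z eqxx.
  by apply/funext => x; rewrite mul1r -[n.+2%:R]natr1 exprS; ring.
have partialX0 i j n : i != j -> partial i (fun x => centered c j x ^+ n) = fun=> 0.
  move=> ij; elim: n => [|n IH].
    by under [X in partial _ X]eq_fun do rewrite expr0; rewrite partial_cst.
  under [X in partial _ X]eq_fun do rewrite exprS.
  rewrite (partialM i (sz j) (smoothX n (sz j))) IH partial_z (negbTE ij).
  by apply/funext => x; rewrite mul0r mulr0 addr0.
have partial_mono i m n s x : W x -> partial i (mono m n s) x =
    (if i == 0 then m%:R * mono m.-1 n s x else n%:R * mono m n.-1 s x) +
    2 * s * (centered c i x * mono m n (s - 1) x).
  move=> Wx; have s0 := smoothX m (sz 0); have s1 := smoothX n (sz 1).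
  rewrite (partialM i (smoothM s0 s1) (sQp s)) (partialM i s0 s1) partial_Qp//.
  have n01 : (0 : 'I_2) != 1 by []. have n10 : (1 : 'I_2) != 0 by [].
  have [->|->] := ord2P i.
  - rewrite (partialX0 0 1 n n01) /mono eqxx; case: m {s0} => [|m]; last first.
      by rewrite (partialX 0 m) /=; ring.
    under [X in partial _ X]eq_fun do rewrite expr0.
    by rewrite partial_cst; ring.
  - rewrite (partialX0 1 0 m n10) /mono /=; case: n {s1} => [|n]; last first.
      by rewrite (partialX 1 n) /=; ring.
    under [X in partial _ X]eq_fun do rewrite expr0.
    by rewrite partial_cst; ring.
(* Induction on the degree: d_j (z^beta |z|^(2s)) equals 2 s z_j z^beta |z|^(2s-2) plus a term of
   lower degree. Each new factor z_j costs one unit of the exponent, hence the condition m + n <=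
   i. *)
have ker_mono K m n i : (m + n <= K)%N -> (m + n <= i)%N -> ker (mono m n (- 2^-1 - i%:R)).
  elim: K m n i => [|K IH] m n i mnK mni.
    have [-> ->] : m = 0%N /\ n = 0%N by lia.
    have := kerQpn i; congr ker; apply/funext => x.
    by rewrite /mono !expr0 !mul1r.
  have [|mnK'] := leqP (m + n) K; first by move=> h; exact: IH.
  have step j m' n' i' : (m' + n' <= K)%N -> (m' + n' <= i')%N ->
      ker (fun x => centered c j x * mono m' n' (- 2^-1 - i'.+1%:R) x).
    move=> h1 h2; pose s : R := - 2^-1 - i'%:R.
    have sE : - 2^-1 - i'.+1%:R = s - 1 by rewrite /s -[i'.+1%:R]natr1 opprD addrA.
    have kd := ker_partial j _ (smono m' n' s) (IH m' n' i' h1 h2).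
    pose low x := if j == 0 then mono m'.-1 n' s x else mono m' n'.-1 s x.
    have slow : smooth low by rewrite /low; case: eqP => _; exact: smono.
    have klow : ker low by rewrite /low; case: eqP => _; apply: IH; lia.
    pose w : R := if j == 0 then m'%:R else n'%:R.
    have sdm := smooth_partial j (smono m' n' s).
    have k1 := ker_DZ (- w) _ _ slow sdm klow kd.
    have s1 := smoothD (smoothZ (- w) slow) sdm.
    have k2 := ker_Z (2 * s)^-1 _ s1 k1.
    apply: (ker_eq _ _ (smoothZ _ s1) (smoothM (sz j) (smono _ _ _)) _ k2) => x Wx.
    have s0 : s != 0 := half i'.
    rewrite (partial_mono j m' n' s x Wx) sE /low /w.
    by case: eqP => _; field; exact: s0.
  case: i mni => [|i] mni; first by lia.
  case: m mnK mnK' mni => [|m] mnK mnK' mni.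
    case: n mnK mnK' mni => [|n] mnK mnK' mni; first by lia.
    have := step 1 0%N n i ltac:(lia) ltac:(lia); congr ker; apply/funext => x.
    by rewrite /mono exprS; ring.
  have := step 0 m n i ltac:(lia) ltac:(lia); congr ker; apply/funext => x.
  by rewrite /mono exprS; ring.
have Tpoly m n : T (fun x => centered c 0 x ^+ m * centered c 1 x ^+ n) = 0.
  pose s : R := - 2^-1 - (m + n)%:R.
  (* A functional of a function of the single variable t = 1/|z|^2, encoded on the line where the
     second coordinate is 0. It kills t^a by [ker_mono] with i = m + n + a, hence everything.
     Inserting f(t) = t^s cancels the power |z|^(2s) and leaves the bare monomial. *)
  pose S f := T (fun x => mono m n s x * f (point (Qp (- 1) x) 0)).
  have spt f : smooth f -> smooth (fun x => f (point (Qp (- 1) x) 0)).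
    by move=> sf; exact: (smooth_comp1 (smooth_restrict1 0 sf) (sQp (- 1))).
  have sS f (sf : smooth f) := smoothM (smono m n s) (spt f sf).
  have lS : linear_on_smooth S.
    move=> u f g sf sg; rewrite /S -(lT u (sS _ sf) (sS _ sg)); congr T.
    by apply/funext => x; ring.
  have bS : seminorm_bounded S.
    have [D D0 HD] := partials_le_compact N (sQp (- 1)) cA.
    have [X X0 HX] := partials_le_compact N (smono m n s) cA.
    have [E E0 HE] := partials_le_comp1 N D (sQp (- 1)).
    exists (C * (2 ^+ N * X * E)), N, D; split; first by rewrite !mulr_ge0// exprn_ge0.
    move=> f M sf M0 Hf; rewrite -mulrA; apply: (HC _ _ (sS _ sf)).
      by rewrite !mulr_ge0// exprn_ge0.
    move=> x Ax; rewrite -[_ * M]mulrA.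
    apply: (partials_leM (smono m n s) (spt _ sf) (HX x Ax)).
    apply: (HE x (HD x Ax) (fun k t => partials (nseq k 0) f (point t 0))).
      by move=> k t; exact: is_derive_partials_point.
    move=> k kN; apply: Hf; last by rewrite size_nseq.
    by apply: box_point; [exact: (HD x Ax [::])|rewrite normr0].
  have Smon a b : S (fun y => y 0 0 ^+ a * y 0 1 ^+ b) = 0.
    rewrite /S; case: b => [|b]; last first.
      transitivity (T (fun=> 0)); last exact: linear_on_smooth0.
      congr T; apply/funext => x.
      by rewrite point1 exprS mul0r !mulr0.
    have := ker_mono _ m n (m + n + a)%N (leqnn _) (leq_addr _ _) 0%N 0%N.
    apply: etrans; congr T; apply/funext => x; rewrite /partial_pow /= point0 expr0 mulr1.
    rewrite /mono -mulrA; congr (_ * _); rewrite /Qp -powR_mulrn ?powR_ge0// -powRrM.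
    rewrite -Q_powRD//; congr (_ `^ _); rewrite /s natrD; ring.
  (* On [W] one has 1/|z|^2 >= 1 / (2 rho^2 + 1), so this clamp makes t^s smooth without changing it
     there. *)
  have b0 : 0 < (2 * rho ^+ 2 + 1)^-1 / 2.
    by rewrite divr_gt0// invr_gt0 ltr_wpDl// mulr_ge0// sqr_ge0.
  have [cl [scl cl0 clE]] := smooth_clamp_exists b0.
  have sc0 : smooth (fun y : 'rV[R]_2 => cl (y 0 0)) := smooth_comp1 scl (smooth_coord 0).
  have sf := smooth_powR s sc0 (fun y => cl0 (y 0 0)).
  have := seminorm_bounded_monomials_eq0 lS bS Smon sf; rewrite /S => <-.
  apply: T_eq; [exact: (smoothM (smoothX m (sz 0)) (smoothX n (sz 1)))|exact: (sS _ sf)|].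
  move=> x Wx; rewrite point0 clE.
    rewrite /mono /Qp -mulrA -powRrM -Q_powRD// mulN1r subrr powRr0 mulr1.
    by [].
  rewrite mulrC divfK// /Qp powR_inv1 ?(ltW (Q0 x))// lef_pV2 ?posrE//.
    by rewrite QW//; case/andP: Wx => _ /ltW.
  by rewrite ltr_wpDl// mulr_ge0// sqr_ge0.
have [_ bT] := (compact_distributionP T).1 cT.
apply: (seminorm_bounded_monomials_eq0 lT bT) => a b.
(* Passage from monomials in z = x - c to monomials in x. Carrying all monomials in z makes the
   class stable under multiplication by x_i = z_i + c_i. *)
pose good f := smooth f /\ forall m n, T (fun x => centered c 0 x ^+ m * centered c 1 x ^+ n * f x) = 0.
have goodX i f : good f -> good (fun x => x 0 i * f x).
  move=> [sf gf]; split; first exact: (smoothM (smooth_coord i) sf).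
  move=> m n.
  have sm m' n' := smoothM (smoothM (smoothX m' (sz 0)) (smoothX n' (sz 1))) sf.
  have H m' n' : T (fun x => c 0 i * (centered c 0 x ^+ m * centered c 1 x ^+ n * f x) +
      centered c 0 x ^+ m' * centered c 1 x ^+ n' * f x) = 0.
    by rewrite (lT (c 0 i) (sm m n) (sm m' n')) !gf mulr0 addr0.
  have [i0|i1] := ord2P i.
  - rewrite -(H m.+1 n); congr T; apply/funext => x.
    have -> : x 0 i = centered c 0 x + c 0 i by rewrite i0 subrK.
    by rewrite exprS; ring.
  - rewrite -(H m n.+1); congr T; apply/funext => x.
    have -> : x 0 i = centered c 1 x + c 0 i by rewrite i1 subrK.
    by rewrite exprS; ring.
suff [_ /(_ 0%N 0%N)] : good (fun x => x 0 0 ^+ a * x 0 1 ^+ b).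
  by apply: etrans; congr T; apply/funext => x; rewrite !expr0 !mul1r.
elim: a => [|a IH]; last first.
  by have := goodX 0 _ IH; congr good; apply/funext => x; rewrite exprS mulrA.
elim: b => [|b IH]; last first.
  have := goodX 1 _ IH; congr good; apply/funext => x.
  by rewrite !expr0 !mul1r exprS.
split; first exact: smooth_monomial.
move=> m n; rewrite -(Tpoly m n); congr T; apply/funext => x.
by rewrite !expr0 !mulr1.
Qed.

End ScalarUniqueContinuation.

(** * Symmetric tensors in terms of index counts *)

Section IndexCounts.
Implicit Types n : nat.

(** In dimension two this number determines an index tuple up to permutation, hence the component of
    a symmetric tensor. *)
Definition ones n (I : n.-tuple 'I_2) : nat := count_mem (1 : 'I_2) I.

Definition ones_tuple n (p : nat) : n.-tuple 'I_2 :=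
  [tuple (if (i < p)%N then 1 else 0) | i < n].

Lemma ones_sum n (I : n.-tuple 'I_2) :
  ones I = (\sum_(a < n) (tnth I a == 1%R))%N.
Proof.
rewrite /ones -sum1_count big_tuple big_mkcond.
by apply: eq_bigr => a _ /=; case: eqP.
Qed.

Lemma ones_le n (I : n.-tuple 'I_2) : (ones I <= n)%N.
Proof. by rewrite /ones -[leqRHS](size_tuple I) count_size. Qed.

Lemma ones_tupleK n p : (p <= n)%N -> ones (ones_tuple n p) = p.
Proof.
have -> : ones (ones_tuple n p) = minn n p; last by move/minn_idPr.
rewrite ones_sum; under eq_bigr => a _ do rewrite tnth_mktuple.
elim: n => [|n IH]; first by rewrite big_ord0 min0n.
have b : ((if (n < p)%N then 1 else 0) == 1 :> 'I_2) = (n < p)%N by case: ltnP.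
by rewrite big_ord_recr /= IH b; lia.
Qed.

Lemma ones_permute n (s : 'S_n) (I : n.-tuple 'I_2) : ones (permute_idx s I) = ones I.
Proof.
rewrite !ones_sum [RHS](reindex_inj (@perm_inj _ s)).
by apply: eq_bigr => a _; rewrite tnth_mktuple.
Qed.

Lemma ones_permuteP n (I I' : n.-tuple 'I_2) : ones I = ones I' ->
  exists s : 'S_n, I = permute_idx s I'.
Proof.
move=> E; have : perm_eq I I'.
  have cE (J : n.-tuple 'I_2) : count_mem (0 : 'I_2) J = (n - ones J)%N.
    have := count_predC (pred1 (1 : 'I_2)) J; rewrite size_tuple -/(ones J) => cP.
    apply/eqP; rewrite -(eqn_add2l (ones J)) subnKC ?ones_le// -[X in _ == X]cP.
    rewrite eqn_add2l; apply/eqP; apply: eq_count => i /=.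
    by have [->|->] := ord2P i.
  apply/allP => i _ /=; have [->|->] := ord2P i; last by rewrite [X in X == _]E.
  by rewrite !cE E.
by move=> /tuple_permP[s sE]; exists s; exact: val_inj.
Qed.

Lemma ones_cons n (x : 'I_2) (I : n.-tuple 'I_2) :
  ones [tuple of x :: I] = ((x == 1%R) + ones I)%N.
Proof. by []. Qed.

Lemma ones_behead n (I : n.+1.-tuple 'I_2) :
  ones (behead_tuple I) = (ones I - (thead I == 1%R))%N.
Proof. by case/tupleP: I => x I; rewrite ones_cons theadE addKn; congr ones; exact: val_inj. Qed.

Variable R : realType.

Lemma sum_ones n (G : nat -> R) :
  \sum_(I : n.-tuple 'I_2) G (ones I) = \sum_(p < n.+1) 'C(n, p)%:R * G p.
Proof.
elim: n G => [|n IH] G.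
  rewrite big_ord1 bin0 mul1r (big_pred1 [tuple]) // => I.
  by rewrite [I]tuple0; apply/esym/eqP.
pose cons_pair (q : 'I_2 * n.-tuple 'I_2) : n.+1.-tuple 'I_2 := [tuple of q.1 :: q.2].
have cons_bij : {on predT, bijective cons_pair}.
  exists (fun I => (thead I, behead_tuple I)).
    by move=> [x I] _; rewrite /cons_pair /= theadE; congr pair; exact: val_inj.
  by move=> I _; rewrite /cons_pair /= -tuple_eta.
rewrite (reindex cons_pair) //=.
rewrite -(pair_bigA _ (fun x I => G (ones (cons_pair (x, I))))) /=.
rewrite big_ord_recl big_ord1.
under eq_bigr => I _ do rewrite ones_cons /=.
under [X in _ + X]eq_bigr => I _ do rewrite ones_cons /=.
rewrite (IH G) (IH (fun p => G p.+1)).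
have E : \sum_(p < n.+1) 'C(n, p)%:R * G p =
    G 0%N + \sum_(p < n.+1) 'C(n, p.+1)%:R * G p.+1.
  rewrite [LHS]big_ord_recl [in RHS]big_ord_recr /= bin0 mul1r bin_small//.
  by rewrite mul0r addr0.
rewrite E [RHS]big_ord_recl /= bin0 mul1r -addrA; congr (_ + _).
rewrite -big_split /=; apply: eq_bigr => p _.
by rewrite /bump leq0n add1n binS natrD mulrDl.
Qed.

(** Composition with a transposition shows that position 0 may be replaced by any other; summing
    over all positions gives n.+1 times the left side, and each permutation then contributes the
    full sum of [g]. *)
Lemma sum_perm_ord0 n (g : 'I_n.+1 -> R) :
  \sum_(s : 'S_n.+1) g (s ord0) = n`!%:R * \sum_a g a.
Proof.
have E b : \sum_(s : 'S_n.+1) g (s ord0) = \sum_(s : 'S_n.+1) g (s b).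
  rewrite (reindex_inj (mulgI (tperm ord0 b))) /=.
  by apply: eq_bigr => s _; rewrite permM tpermL.
have : n.+1%:R * \sum_(s : 'S_n.+1) g (s ord0) = n.+1%:R * (n`!%:R * \sum_a g a).
  transitivity (\sum_(b < n.+1) \sum_(s : 'S_n.+1) g (s b)).
    rewrite mulr_natl -[X in _ *+ X](card_ord n.+1) -sumr_const.
    by apply: eq_bigr => b _; exact: E.
  rewrite exchange_big /= mulrA -natrM -factS mulr_natl.
  have <- : #|{: 'S_n.+1}| = n.+1`! by rewrite card_Sn.
  rewrite -sumr_const; apply: eq_bigr => s _.
  by rewrite [RHS](reindex_inj (@perm_inj _ s)).
by apply: mulfI; rewrite pnatr_eq0.
Qed.

(** Under a random permutation the head is equally likely to be any entry of [I], and the count in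
    the tail is determined by the head. *)
Lemma symmetrize_ones n (H : 'I_2 -> nat -> R) (I : n.+1.-tuple 'I_2) :
  symmetrize (fun I' : n.+1.-tuple 'I_2 => H (thead I') (ones (behead_tuple I'))) I =
  n.+1%:R^-1 * ((n.+1 - ones I)%:R * H 0 (ones I) + (ones I)%:R * H 1 (ones I).-1).
Proof.
rewrite /symmetrize.
pose h a := H (tnth I a) (ones I - (tnth I a == 1%R))%N.
under eq_bigr => s _.
  rewrite ones_behead ones_permute.
  have -> : thead (permute_idx s I) = tnth I (s ord0) by rewrite /thead tnth_mktuple.
  over.
rewrite (sum_perm_ord0 h) factS natrM invfM -mulrA mulKf ?pnatr_eq0 -?lt0n ?fact_gt0//.
congr (_ * _).
have -> : \sum_a h a = \sum_a ((tnth I a != 1%R)%:R * H 0 (ones I) +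
    (tnth I a == 1%R)%:R * H 1 (ones I).-1).
  apply: eq_bigr => a _; rewrite /h; have [->|->] := ord2P (tnth I a) => /=.
    by rewrite subn0 mul1r mul0r addr0.
  by rewrite subn1 mul1r mul0r add0r.
rewrite big_split /= -!mulr_suml -!natr_sum -ones_sum; congr (_ %:R * _ + _).
have : (\sum_a (tnth I a != 1%R) + \sum_a (tnth I a == 1%R) = n.+1)%N.
  rewrite -big_split /= (eq_bigr (fun=> 1%N)) ?sum1_card ?card_ord// => a _.
  by case: eqP.
by rewrite -ones_sum => E; apply/eqP; rewrite -(eqn_add2r (ones I)) subnK ?ones_le// E.
Qed.

End IndexCounts.

Section TensorsByCounts.
Context {R : realType}.
Implicit Types (phi : 'rV[R]_2 -> R).

Lemma compact_tensor_ones k l (f : tensor R k l) : compact_tensor_distribution f ->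
  forall I J phi, smooth phi ->
  f I J phi = f (ones_tuple k (ones I)) (ones_tuple l (ones J)) phi.
Proof.
move=> [cf s1 s2] I J phi sphi.
have [s sE] := ones_permuteP (esym (ones_tupleK (ones_le I))).
have [t tE] := ones_permuteP (esym (ones_tupleK (ones_le J))).
rewrite {1}sE {1}tE.
rewrite (compact_distribution_eq (cf _ _) (cf _ _) (s1 s _ _) sphi).
exact: (compact_distribution_eq (cf _ _) (cf _ _) (s2 t _ _) sphi).
Qed.

Lemma dprime_ones k l (u : tensor R k l) (U : nat -> nat -> functional R) phi :
  (forall I J i, u I J (partial i phi) = U (ones I) (ones J) (partial i phi)) ->
  forall I J, dprime u I J phi = k.+1%:R^-1 *
    ((k.+1 - ones I)%:R * distr_partial 0 (U (ones I) (ones J)) phi +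
     (ones I)%:R * distr_partial 1 (U (ones I).-1 (ones J)) phi).
Proof.
move=> uU I J; rewrite /dprime.
rewrite -(symmetrize_ones (fun i p => distr_partial i (U p (ones J)) phi)).
congr (symmetrize _ I); apply/funext => I'.
by rewrite /distr_partial uU.
Qed.

Lemma lambda_ones k l (w : tensor R k l) (W : nat -> nat -> R) phi :
  (forall I J, w I J phi = W (ones I) (ones J)) ->
  forall I J, lambda w I J phi = (k.+1%:R * l.+1%:R)^-1 *
    ((k.+1 - ones I)%:R * (l.+1 - ones J)%:R * W (ones I) (ones J) +
     (ones I)%:R * (ones J)%:R * W (ones I).-1 (ones J).-1).
Proof.
move=> wW I J; rewrite /lambda.
pose H (i : 'I_2) p : R := l.+1%:R^-1 *
  ((l.+1 - ones J)%:R * ((i == 0)%:R * W p (ones J)) +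
   (ones J)%:R * ((i == 1)%:R * W p (ones J).-1)).
transitivity (symmetrize (fun I' : k.+1.-tuple 'I_2 =>
    H (thead I') (ones (behead_tuple I'))) I).
  congr (symmetrize _ I); apply/funext => I'.
  rewrite /H -(symmetrize_ones (fun j q => (thead I' == j)%:R * W _ q)).
  by congr (symmetrize _ J); apply/funext => J'; rewrite wW.
rewrite symmetrize_ones /H eqxx /= !mul0r !mul1r !mulr0 addr0 add0r invfM; ring.
Qed.

End TensorsByCounts.

(** * Contraction with xi and perp xi, and its kernel *)

Section Contraction.
Context {R : realType}.
Implicit Types (phi : 'rV[R]_2 -> R).

(* coefficient of xi_0^(k + l - a) xi_1^a in the polynomial obtained by contracting
   f with xi, ..., xi, perp xi, ..., perp xi *)
Definition contraction k l (f : tensor R k l) (a : nat) : functional R :=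
  fun phi => \sum_(I : k.-tuple 'I_2) \sum_(J : l.-tuple 'I_2)
    ((ones I + (l - ones J))%N == a)%:R * ((-1) ^+ (l - ones J) * f I J phi).

Lemma compact_contraction k l (f : tensor R k l) a :
  (forall I J, compact_distribution (f I J)) -> compact_distribution (contraction f a).
Proof.
move=> cf; apply: compact_distribution_sum => I; apply: compact_distribution_sum => J.
by do 2 apply: compact_distributionZ.
Qed.

Lemma contraction_ones k l (f : tensor R k l) a phi (F : nat -> nat -> R) :
  (forall I J, f I J phi = F (ones I) (ones J)) ->
  contraction f a phi = \sum_(p < k.+1) \sum_(q < l.+1)
    ((p + (l - q))%N == a)%:R * ((-1) ^+ (l - q) * ('C(k, p)%:R * 'C(l, q)%:R * F p q)).
Proof.
move=> fF; rewrite /contraction.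
under eq_bigr => I _.
  under eq_bigr => J _ do rewrite fF.
  rewrite (sum_ones l (fun q => ((ones I + (l - q))%N == a)%:R *
    ((-1) ^+ (l - q) * F (ones I) q))).
  over.
rewrite (sum_ones k (fun p => \sum_(q < l.+1) 'C(l, q)%:R *
  (((p + (l - q))%N == a)%:R * ((-1) ^+ (l - q) * F p q)))).
apply: eq_bigr => p _; rewrite mulr_sumr; apply: eq_bigr => q _; ring.
Qed.

Lemma natr_bin_down n p :
  n.+1%:R * 'C(n, p)%:R = (n.+1 - p)%:R * 'C(n.+1, p)%:R :> R.
Proof. by rewrite -!natrM (mul_bin_down n.+1). Qed.

Lemma natr_bin_diag n p :
  n.+1%:R * 'C(n, p)%:R = p.+1%:R * 'C(n.+1, p.+1)%:R :> R.
Proof. by rewrite -!natrM (mul_bin_diag n.+1). Qed.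

(* contracting delta_{ij} with xi and perp xi gives zero *)
Lemma contraction_lambda k l (w : tensor R k l) a phi (W : nat -> nat -> R) :
  (forall I J, w I J phi = W (ones I) (ones J)) ->
  contraction (lambda w) a phi = 0.
Proof.
move=> wW.
pose F p q : R := (k.+1%:R * l.+1%:R)^-1 * ((k.+1 - p)%:R * (l.+1 - q)%:R * W p q +
  p%:R * q%:R * W p.-1 q.-1).
rewrite (@contraction_ones _ _ (lambda w) a phi F (lambda_ones wW)) /F.
(* With the binomial factors absorbed, the two terms of [lambda] become [Z] at (p, q) and at (p - 1,
   q - 1). The shift (p, q) -> (p + 1, q + 1) keeps p + (l + 1 - q) and flips the sign, so the sums
   cancel. *)
pose s p q : R := ((p + (l.+1 - q))%N == a)%:R * (-1) ^+ (l.+1 - q).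
pose Z p q : R := 'C(k, p)%:R * 'C(l, q)%:R * W p q.
pose Z' p q : R := if p is p'.+1 then if q is q'.+1 then Z p' q' else 0 else 0.
have nz n : n.+1%:R != 0 :> R by rewrite pnatr_eq0.
rewrite (eq_bigr (fun p : 'I_k.+2 => \sum_(q < l.+2) s p q * Z p q +
    \sum_(q < l.+2) s p q * Z' p q)); last first.
  move=> p _; rewrite -big_split; apply: eq_bigr => q _ /=.
  have E1 : 'C(k.+1, p)%:R * 'C(l.+1, q)%:R * ((k.+1%:R * l.+1%:R)^-1 *
      ((k.+1 - p)%:R * (l.+1 - q)%:R * W p q)) = Z p q.
    rewrite /Z; apply: (mulfI (mulf_neq0 (nz k) (nz l))).
    have -> : k.+1%:R * l.+1%:R * ('C(k, p)%:R * 'C(l, q)%:R * W p q) =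
      (k.+1%:R * 'C(k, p)%:R) * (l.+1%:R * 'C(l, q)%:R) * W p q by ring.
    by rewrite !natr_bin_down; field; rewrite !nat1r !nz.
  have E2 : 'C(k.+1, p)%:R * 'C(l.+1, q)%:R * ((k.+1%:R * l.+1%:R)^-1 *
      (p%:R * q%:R * W p.-1 q.-1)) = Z' p q.
    rewrite /Z'; case: (nat_of_ord p) => [|p']; first by rewrite !mul0r !mulr0.
    case: (nat_of_ord q) => [|q']; first by rewrite mulr0 !mul0r !mulr0.
    rewrite /Z; apply: (mulfI (mulf_neq0 (nz k) (nz l))).
    have -> : k.+1%:R * l.+1%:R * ('C(k, p')%:R * 'C(l, q')%:R * W p' q') =
      (k.+1%:R * 'C(k, p')%:R) * (l.+1%:R * 'C(l, q')%:R) * W p' q' by ring.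
    by rewrite !natr_bin_diag; field; rewrite !nat1r !nz.
  rewrite -E1 -E2 /s; set x := (_ == _)%:R; set e := (-1) ^+ _.
  set y := _^-1; set u := (_ - _)%:R; set v := (_ - _)%:R; ring.
rewrite big_split /=.
have -> : \sum_(p < k.+2) \sum_(q < l.+2) s p q * Z p q =
    \sum_(p < k.+1) \sum_(q < l.+1) s p q * Z p q.
  rewrite big_ord_recr /= [X in _ + X]big1 ?addr0; last first.
    by move=> q _; rewrite /Z bin_small// !mul0r mulr0.
  apply: eq_bigr => p _; rewrite big_ord_recr /=.
  have -> : Z p l.+1 = 0 by rewrite /Z (bin_small (ltnSn l)) mulr0 mul0r.
  by rewrite mulr0 addr0.
have -> : \sum_(p < k.+2) \sum_(q < l.+2) s p q * Z' p q =
    \sum_(p < k.+1) \sum_(q < l.+1) s p.+1 q.+1 * Z p q.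
  rewrite big_ord_recl /= [X in X + _]big1 ?add0r; last by move=> q _; rewrite mulr0.
  apply: eq_bigr => p _; rewrite big_ord_recl /= mulr0 add0r.
  by apply: eq_bigr => q _; rewrite /bump !leq0n !add1n.
rewrite -big_split big1 //= => p _; rewrite -big_split big1 //= => q _.
have -> : s p.+1 q.+1 = - s p q.
  have lq : (l.+1 - q = (l.+1 - q.+1).+1)%N by have := ltn_ord q; lia.
  by rewrite /s lq exprS mulN1r mulrN opprK addSnnS.
by rewrite mulNr subrr.
Qed.

End Contraction.

(** * The adjoint of the mixed ray transform on functions of the signed distance *)

Section RayAdjoint.
Context {R : realType}.
Implicit Types (x c : 'rV[R]_2).

Lemma dotpE x y : dotp x y = x 0 0 * y 0 0 + x 0 1 * y 0 1.
Proof. by rewrite /dotp big_ord_recl big_ord1; congr (_ + x 0 _ * y 0 _); exact: val_inj. Qed.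

Lemma perp0 x : perp x 0 0 = - x 0 1. Proof. by rewrite mxE. Qed.
Lemma perp1 x : perp x 0 1 = x 0 0. Proof. by rewrite mxE. Qed.
Lemma unit_vector0 (t : R) : unit_vector t 0 0 = cos t. Proof. by rewrite mxE. Qed.
Lemma unit_vector1 (t : R) : unit_vector t 0 1 = sin t. Proof. by rewrite mxE. Qed.

Lemma prod_ones n (I : n.-tuple 'I_2) (y : 'I_2 -> R) :
  \prod_(i <- I) y i = y 0 ^+ (n - ones I) * y 1 ^+ ones I.
Proof.
have H (s : seq 'I_2) : \prod_(i <- s) y i =
    y 0 ^+ (size s - count_mem (1 : 'I_2) s) * y 1 ^+ count_mem (1 : 'I_2) s.
  elim: s => [|i s IH] /=; first by rewrite big_nil !expr0 mulr1.
  have cs := count_size (pred1 (1 : 'I_2)) s.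
  rewrite big_cons IH; have [->|->] := ord2P i => /=.
    by rewrite add0n subSn// exprS mulrA.
  by rewrite add1n subSS exprS mulrCA.
by have := H I; rewrite size_tuple.
Qed.

(** The powers of the normal stem from derivatives of a back-projection; the remaining monomial in
    xi is the one whose coefficient is [contraction f a]. *)
Definition ray_weight (alpha beta m a : nat) (t : R) : R :=
  normal 0 t ^+ alpha * normal 1 t ^+ beta * (cos t ^+ (m - a) * sin t ^+ a).

Lemma continuous_exp (f : R -> R) n : continuous f -> continuous (fun t => f t ^+ n).
Proof.
move=> cf; elim: n => [|n IH] t; first by under eq_fun do rewrite expr0; exact: cvg_cst.
by under eq_fun do rewrite exprS; exact: (cvgM (cf t) (IH t)).
Qed.

Lemma continuous_ray_weight alpha beta m a : continuous (ray_weight alpha beta m a).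
Proof.
have c0 := @continuous_exp _ alpha (@continuous_normal R 0).
have c1 := @continuous_exp _ beta (@continuous_normal R 1).
have cc := @continuous_exp _ (m - a) (@continuous_cos R).
have cs := @continuous_exp _ a (@continuous_sin R).
by move=> t; exact: (cvgM (cvgM (c0 t) (c1 t)) (cvgM (cc t) (cs t))).
Qed.

Lemma eq_ray_integral c (k k' : R -> R) B : k =1 k' -> ray_integral c k B = ray_integral c k' B.
Proof. by move=> /funext ->. Qed.

Lemma partial_pow_ray_integral c (F : nat -> R -> R) n a b (k : R -> R) : continuous k ->
  (forall n (t : R), is_derive t 1 (F n) (F n.+1 t)) ->
  partial_pow a b (ray_integral c k (F n)) =
  ray_integral c (fun t => k t * normal 0 t ^+ a * normal 1 t ^+ b) (F (n + (a + b))%N).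
Proof.
move=> ck dF.
have sF j : smooth1 (F j) by exists (fun n => F (j + n)%N) => [|i t]; rewrite ?addn0// addnS.
have step i j k' d : continuous k' -> iter d (partial i) (ray_integral c k' (F j)) =
    ray_integral c (fun t => k' t * normal i t ^+ d) (F (j + d)%N).
  move=> ck'; elim: d => [|d IH].
    by rewrite addn0; apply: eq_ray_integral => t; rewrite expr0 mulr1.
  have cd : continuous (fun t => k' t * normal i t ^+ d).
    have cn := @continuous_exp _ d (@continuous_normal R i).
    by move=> t; exact: (cvgM (ck' t) (cn t)).
  rewrite iterS IH (partial_ray_integral c i cd (sF _) (dF _)) addnS.
  by apply: eq_ray_integral => t; rewrite -mulrA -exprSr.
rewrite /partial_pow step// step; last first.
  have cn := @continuous_exp _ b (@continuous_normal R 1).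
  by move=> t; exact: (cvgM (ck t) (cn t)).
rewrite -addnA [(b + a)%N]addnC.
by apply: eq_ray_integral => t; rewrite mulrAC.
Qed.

Definition ray_test c (alpha beta : nat) (B : R -> R) (p : 'rV[R]_2 * 'rV[R]_2) : R :=
  perp p.2 0 0 ^+ alpha * perp p.2 0 1 ^+ beta * B (dotp (p.1 - c) (perp p.2)).

(** Since perp xi = (- sin, cos), each index 0 in [J] contributes - sin; this explains the sign and
    the exponent [ones I + (l - ones J)] of the sine. *)
Lemma mixed_ray_adjoint_test c alpha beta B k l (I : k.-tuple 'I_2) (J : l.-tuple 'I_2) :
  smooth1 B -> mixed_ray_adjoint (ray_test c alpha beta B) I J =
  fun x => (-1) ^+ (l - ones J) *
    ray_integral c (ray_weight alpha beta (k + l) (ones I + (l - ones J))) B x.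
Proof.
move=> sB; apply/funext => x; rewrite /mixed_ray_adjoint -segment_integralE.
have cw := @continuous_ray_weight alpha beta (k + l) (ones I + (l - ones J)).
rewrite -segment_integralZ; last exact: (smooth_family_slice (ray_family c cw sB)).
apply: eq_segment_integral => t _.
rewrite (prod_ones I (fun i => unit_vector t 0 i)) (prod_ones J (fun j => perp (unit_vector t) 0 j)).
rewrite /ray_test /= !perp0 !perp1 !unit_vector0 !unit_vector1.
have -> : dotp (x - dotp x (unit_vector t) *: unit_vector t - c) (perp (unit_vector t)) =
    ray_dist c x t.
  rewrite /ray_dist /centered normal0 normal1 !dotpE !mxE /=; ring.
rewrite /ray_weight normal0 normal1.
have Ik := ones_le I; have Jl := ones_le J.
have -> : (k + l - (ones I + (l - ones J)) = (k - ones I) + ones J)%N by lia.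
rewrite [(- sin t) ^+ (l - _)]exprNn !exprD; ring.
Qed.

Lemma mixed_ray_test c alpha beta B k l (f : tensor R k l) :
  (forall I J, linear_on_smooth (f I J)) -> smooth1 B ->
  mixed_ray f (ray_test c alpha beta B) =
  \sum_(a < (k + l).+1) contraction f a (ray_integral c (ray_weight alpha beta (k + l) a) B).
Proof.
move=> lf sB; rewrite /mixed_ray /contraction [RHS]exchange_big; apply: eq_bigr => I _.
rewrite [RHS]exchange_big; apply: eq_bigr => J _ /=.
have sr a : smooth (ray_integral c (ray_weight alpha beta (k + l) a) B).
  exact: (smooth_ray_integral c (@continuous_ray_weight _ _ _ _) sB).
rewrite mixed_ray_adjoint_test// (linear_on_smoothZ _ (lf I J) (sr _)).
have h : (ones I + (l - ones J) < (k + l).+1)%N by have := ones_le I; lia.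
rewrite (bigD1 (Ordinal h)) //= eqxx mul1r big1 ?addr0// => a ne.
rewrite (_ : (_ == _) = false) ?mul0r//; apply/negbTE; apply: contra ne => /eqP E.
by apply/eqP/val_inj; rewrite /= E.
Qed.

Lemma ray_test_function c d (alpha beta : nat) (B : R -> R) (U : set 'rV[R]_2) :
  0 < d -> (forall y, (forall i, `|centered c i y| <= d) -> U y) ->
  smooth1 B -> (forall v, d < `|v| -> B v = 0) ->
  test_function_TS1 (lines_meeting U) (ray_test c alpha beta B).
Proof.
move=> d0 dU sB B0.
pose Z : set ('rV[R]_2 * 'rV[R]_2) :=
  [set p | TS1 p /\ `|dotp (p.1 - c) (perp p.2)| <= d].
have cX i : continuous (fun p : 'rV[R]_2 * 'rV[R]_2 => p.1 0 i).
  exact: (continuous_fst_comp (@coord_continuous R 1 2 0 i)).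
have cY i : continuous (fun p : 'rV[R]_2 * 'rV[R]_2 => p.2 0 i).
  exact: (continuous_snd_comp (@coord_continuous R 1 2 0 i)).
have clZ : closed Z.
  have c1 : continuous (fun p : 'rV[R]_2 * 'rV[R]_2 => dotp p.2 p.2).
    under eq_fun do rewrite dotpE.
    by move=> p; exact: (cvgD (cvgM (cY 0 p) (cY 0 p)) (cvgM (cY 1 p) (cY 1 p))).
  have c2 : continuous (fun p : 'rV[R]_2 * 'rV[R]_2 => dotp p.1 p.2).
    under eq_fun do rewrite dotpE.
    by move=> p; exact: (cvgD (cvgM (cX 0 p) (cY 0 p)) (cvgM (cX 1 p) (cY 1 p))).
  have c3 : continuous (fun p : 'rV[R]_2 * 'rV[R]_2 => `|dotp (p.1 - c) (perp p.2)|).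
    have c3 : continuous (fun p : 'rV[R]_2 * 'rV[R]_2 => dotp (p.1 - c) (perp p.2)).
      under eq_fun do rewrite dotpE perp0 perp1 !mxE.
      move=> p; exact: (cvgD (cvgM (cvgB (cX 0 p) (cvg_cst _)) (cvgN (cY 1 p)))
        (cvgM (cvgB (cX 1 p) (cvg_cst _)) (cY 0 p))).
    by move=> p; exact: (cvg_norm (c3 p)).
  have e1 := @closed_comp _ _ _ [set y : R | y = 1] (fun p _ => c1 p) (@closed_eq _ 1).
  have e2 := @closed_comp _ _ _ [set y : R | y = 0] (fun p _ => c2 p) (@closed_eq _ 0).
  have e3 := @closed_comp _ _ _ [set y : R | y <= d] (fun p _ => c3 p) (@closed_le _ d).
  have := closedI (closedI e1 e2) e3; congr closed.
have sZ : supp_TS1 (ray_test c alpha beta B) `<=` Z.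
  apply: (subset_trans (closure_subset _) (_ : closure Z `<=` Z)); last by rewrite -(closure_id Z).1.
  move=> p [Tp gp]; split=> //; rewrite leNgt; apply: contra gp => /B0 Bp.
  by rewrite /ray_test Bp mulr0.
(* Expansion in the orthonormal frame (xi, perp xi). On TS1 the first coefficient of the base point
   vanishes, so bounding the signed distance bounds the point. *)
have frame (xi y : 'rV[R]_2) i : dotp xi xi = 1 ->
    y 0 i = dotp y xi * xi 0 i + dotp y (perp xi) * perp xi 0 i.
  rewrite !dotpE perp0 perp1 => h.
  rewrite -[LHS]mulr1 -h; have [->|->] := ord2P i; rewrite ?perp0 ?perp1; ring.
have xi1 (xi : 'rV[R]_2) i : dotp xi xi = 1 -> `|xi 0 i| <= 1.
  rewrite dotpE => h; rewrite -(@expr_le1 _ 2)//.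
  rewrite real_normK ?num_real// -h !expr2; have := sqr_ge0 (xi 0 0); have := sqr_ge0 (xi 0 1).
  by rewrite !expr2; have [->|->] := ord2P i; lra.
have perp_le1 (xi : 'rV[R]_2) i : dotp xi xi = 1 -> `|perp xi 0 i| <= 1.
  move=> h; have [->|->] := ord2P i; rewrite ?perp0 ?perp1 ?normrN; exact: xi1.
split.
- rewrite /smooth_TS1 /ray_test.
  have s0 : smooth (fun q : 'rV[R]_2 => cos (q 0 0)) := smooth_comp1 smooth1_cos (smooth_coord 0).
  have s1 : smooth (fun q : 'rV[R]_2 => sin (q 0 0)) := smooth_comp1 smooth1_sin (smooth_coord 0).
  have sr : smooth (fun q : 'rV[R]_2 => q 0 1) := smooth_coord 1.
  rewrite [X in smooth X](_ : _ = (fun q : 'rV[R]_2 =>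
      (- sin (q 0 0)) ^+ alpha * cos (q 0 0) ^+ beta *
      B ((q 0 1 * - sin (q 0 0) - c 0 0) * - sin (q 0 0) +
         (q 0 1 * cos (q 0 0) - c 0 1) * cos (q 0 0)))); last first.
    by apply/funext => q; rewrite /= dotpE !perp0 !perp1 !mxE.
  apply: (smoothM (smoothM (smoothX _ (smoothN s1)) (smoothX _ s0))).
  apply: (smooth_comp1 sB); apply: smoothD.
    exact: (smoothM (smoothB (smoothM sr (smoothN s1)) (smooth_cst _)) (smoothN s1)).
  exact: (smoothM (smoothB (smoothM sr s0) (smooth_cst _)) s0).
- apply: (subclosed_compact (@closed_closure _ _)
    (compact_setX (@compact_box R (d + 2 * `|c|)) (@compact_box R 1))).
  move=> p /sZ[[p1 p2] pd]; split=> i; last exact: xi1.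
  rewrite (frame p.2 p.1 i p1) p2 mul0r add0r normrM -[leRHS]mulr1 ler_pM//; last exact: perp_le1.
  have -> : dotp p.1 (perp p.2) = dotp (p.1 - c) (perp p.2) + dotp c (perp p.2).
    by rewrite !dotpE !mxE; ring.
  apply: le_trans (ler_normD _ _) (lerD pd _); rewrite dotpE.
  apply: le_trans (ler_normD _ _) _; rewrite !normrM mulr_natl mulr2n.
  by apply: lerD; rewrite -[leRHS]mulr1 ler_pM// ?norm_coord_le ?perp_le1.
(* This parameter gives the foot of the perpendicular from c to the line, which lies within d of
   c. *)
- move=> p /sZ[[p1 p2] pd]; split=> //; exists (dotp c p.2); apply: dU => i.
  have -> : centered c i (p.1 + dotp c p.2 *: p.2) =
      dotp (p.1 - c) (perp p.2) * perp p.2 0 i.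
    rewrite /centered !mxE (frame p.2 p.1 i p1) p2 (frame p.2 c i p1) !dotpE !mxE; ring.
  by rewrite normrM -[leRHS]mulr1 ler_pM// perp_le1.
Qed.

End RayAdjoint.

Lemma open_sub_centered (R : realType) (U : set 'rV[R]_2) c : open U -> U c ->
  exists2 d : R, 0 < d & forall y, (forall i, `|centered c i y| <= d) -> U y.
Proof.
move=> oU Uc; have : nbhs c U by exact: open_nbhs_nbhs.
move=> /nbhs_normP[e /= e0 He]; exists (e / 2); first by rewrite divr_gt0.
move=> y H; apply: He => /=.
apply: (@le_lt_trans _ _ (e / 2)); last by lra.
apply: norm_row_le => [|i]; first by rewrite divr_ge0// ltW.
by rewrite !mxE distrC; exact: H.
Qed.

(** * The contracted tensor satisfies the Saint-Venant relation *)

Section SaintVenantVanishes.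
Context {R : realType}.
Variables (k l : nat) (f : tensor R k.+1 l.+1) (U : set 'rV[R]_2).
Hypotheses (cf : compact_tensor_distribution f) (oU : open U) (U0 : U !=set0).
Variable w' : tensor R k l.
Hypotheses (cw' : compact_tensor_distribution w') (fU : eq_tensor_on U f (lambda w')).
Hypothesis fV : mixed_ray_vanishes_through U f.

Let m := (k.+1 + l.+1)%N.

Let cfc I J : compact_distribution (f I J). Proof. by case: cf. Qed.

Let lf I J : linear_on_smooth (f I J).
Proof. by have [] := (compact_distributionP (f I J)).1 (cfc I J). Qed.

Lemma contraction_near a phi : test_function U phi -> contraction f a phi = 0.
Proof.
move=> tphi; have [sphi _ _] := tphi.
transitivity (contraction (lambda w') a phi).
  by apply: eq_bigr => I _; apply: eq_bigr => J _; rewrite fU.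
apply: (@contraction_lambda _ _ _ w' a phi (fun p q => w' (ones_tuple k p) (ones_tuple l q) phi)).
by move=> I J; exact: compact_tensor_ones.
Qed.

(** Scalar unique continuation for the left side [T]. On a back-projection, d_0^a d_1^(m-a) creates
    the weight (- sin)^a cos^(m-a), and the sign (-1)^a of the relation turns it into the monomial
    paired with [contraction f a]. So [T] on the derivative of order (alpha, beta) is [mixed_ray f]
    on a [ray_test] with profile the derivative of B of order alpha + beta + m, supported in lines
    through U. *)
Lemma saint_venant_contraction_eq0 phi : smooth phi ->
  \sum_(a < m.+1) (-1) ^+ a * contraction f a (partial_pow a (m - a) phi) = 0.
Proof.
have [c Uc] := U0; have [d d0 dU] := open_sub_centered oU Uc.
pose T : functional R := fun phi =>
  \sum_(a < m.+1) (-1) ^+ a * contraction f a (partial_pow a (m - a) phi).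
have ch a : compact_distribution (contraction f a) by exact: compact_contraction.
have lh a : linear_on_smooth (contraction f a).
  by have [] := (compact_distributionP _).1 (ch a).
have cT : compact_distribution T.
  apply: (@compact_distribution_sum _ _ _ _
    (fun (a : 'I_m.+1) phi => (-1) ^+ a * contraction f a (partial_pow a (m - a) phi))) => a.
  by apply: compact_distributionZ; exact: compact_distribution_partial_pow.
apply: (eq0_of_ray_integrals cT d0) => [{}phi sphi phi0|B sB B0 alpha beta].
  apply: big1 => a _; rewrite contraction_near ?mulr0//.
  have clD := @closed_centered_box R c d; have cD := @compact_centered_box R c d.
  have spp := smooth_partial_pow a (m - a) sphi.
  have [s1 s2 s3] : test_function [set x | forall i, `|centered c i x| <= d]
      (partial_pow a (m - a) phi).
    apply: test_function_sub => // x nx.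
    have nsx : ~ supp phi x by move=> /(supp_sub clD phi0).
    rewrite partial_pow_partials; apply/eqP; rewrite -normr_le0.
    exact: (@partials_le_notin_supp _ phi (size (nseq a (0 : 'I_2) ++ nseq (m - a) 1)) x 0
      nsx (lexx 0) _ (leqnn _)).
  by split=> // x /s3 /dU.
have [F F0 dF] := sB.
pose n := (alpha + beta + m)%N.
have sF j : smooth1 (F j) by exists (fun i => F (j + i)%N) => [|i t]; rewrite ?addn0// addnS.
have Fsupp j v : d < `|v| -> F j v = 0.
  elim: j v => [|j IH] v dv; first by rewrite F0 B0.
  exact: (derive_eq0_outside (dF j) IH dv).
have cw a := @continuous_ray_weight R alpha beta m a.
have sr a : smooth (ray_integral c (ray_weight alpha beta m a) (F n)).
  exact: (smooth_ray_integral c (cw a) (sF n)).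
have E a : (a <= m)%N -> partial_pow a (m - a) (partial_pow alpha beta (ray_integral c (fun=> 1) B)) =
    fun x => (-1) ^+ a * ray_integral c (ray_weight alpha beta m a) (F n) x.
  move=> am; rewrite -F0 (partial_pow_ray_integral c 0 alpha beta (@continuous_one R) dF).
  have ck : continuous (fun t : R => 1 * normal 0 t ^+ alpha * normal 1 t ^+ beta).
    have c0 := @continuous_exp _ _ alpha (@continuous_normal R 0).
    have c1 := @continuous_exp _ _ beta (@continuous_normal R 1).
    by move=> t; exact: (cvgM (cvgM (cvg_cst _) (c0 t)) (c1 t)).
  rewrite (partial_pow_ray_integral c _ a (m - a) ck dF).
  have -> : (0 + (alpha + beta) + (a + (m - a)) = n)%N by rewrite /n; lia.
  apply/funext => x; rewrite /ray_integral -segment_integralZ; last first.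
    exact: (smooth_family_slice (ray_family c (cw a) (sF n))).
  apply: eq_segment_integral => t _.
  rewrite /ray_weight !normal0 !normal1 [(- sin t) ^+ a]exprNn; ring.
have tg := ray_test_function alpha beta d0 dU (sF n) (Fsupp n).
have := fV tg; rewrite (mixed_ray_test c alpha beta lf (sF n)) => <-.
apply: eq_bigr => a _; rewrite E; last by rewrite -ltnS.
by rewrite (linear_on_smoothZ _ (lh a) (sr a)) mulrA -expr2 sqrr_sign mul1r.
Qed.

End SaintVenantVanishes.

(** * Reconstruction of u and w from the divided contractions *)

Section Reconstruction.
Context {R : realType}.
Variables (k l : nat) (f : tensor R k.+1 l.+1).
Hypothesis cf : compact_tensor_distribution f.
Variable v : nat -> functional R.
Hypothesis cv : forall a, compact_distribution (v a).
Hypothesis fv : forall phi a, smooth phi -> (a <= k.+1 + l.+1)%N -> contraction f a phi =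
  (if (a < k.+1 + l.+1)%N then distr_partial 0 (v a) phi else 0) +
  (if (0 < a)%N then distr_partial 1 (v a.-1) phi else 0).

Local Notation K := k.+1.
Local Notation L := l.+1.

(* In terms of the numbers p, q of indices equal to 1, with the factors
   C(K,p) C(L,q) (-1)^q absorbed, d' becomes d_0 A(p,q) + d_1 A(p-1,q), lambda
   becomes B(p,q) - B(p-1,q-1), and the contraction sums along p - q = const. *)
Let F p q : functional R := fun phi =>
  'C(K, p)%:R * 'C(L, q)%:R * (-1) ^+ q * f (ones_tuple K p) (ones_tuple L q) phi.

(** The contraction sees only the sum along a diagonal p + (L - q) = a, so [v a] may be placed at a
    single point of it. For a < K + L exactly one point with p < K and q <= L has p = 0 or q = 0,
    namely (a - L, L - a) in truncated subtraction. *)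
Let A p q : functional R := fun phi =>
  ((p == 0%N) || (q == 0%N))%:R * ((-1) ^+ L * v (p + (L - q))%N phi).

(** What remains for [lambda w] after subtracting d'u. *)
Let G p q : functional R := fun phi => F p q phi -
  (p < K)%N%:R * distr_partial 0 (A p q) phi -
  (0 < p)%N%:R * distr_partial 1 (A p.-1 q) phi.

(** The partial sum of [G] down the diagonal through (p, q), which solves B(p,q) - B(p-1,q-1) =
    G(p,q). *)
Let B p q : functional R := fun phi =>
  \sum_(p' < p.+1) \sum_(q' < q.+1) ((p' + q)%N == (q' + p)%N)%:R * G p' q' phi.

Let cF p q : compact_distribution (F p q).
Proof. by apply: compact_distributionZ; case: cf. Qed.

Let cA p q : compact_distribution (A p q).
Proof. by do 2 apply: compact_distributionZ; exact: cv. Qed.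

Let cG p q : compact_distribution (G p q).
Proof.
apply: compact_distributionB; last first.
  by apply: compact_distributionZ; exact: compact_distribution_partial.
apply: compact_distributionB; first exact: cF.
by apply: compact_distributionZ; exact: compact_distribution_partial.
Qed.

Let cB p q : compact_distribution (B p q).
Proof.
apply: compact_distribution_sum => p'; apply: compact_distribution_sum => q'.
exact: compact_distributionZ.
Qed.

Let sum_delta n (x : nat -> R) j : (j < n)%N -> \sum_(i < n) ((i : nat) == j)%:R * x i = x j.
Proof.
move=> jn; rewrite (bigD1 (Ordinal jn)) //= eqxx mul1r big1 ?addr0// => i ne.
by rewrite (_ : (_ == _) = false) ?mul0r//; apply/negbTE; rewrite -val_eqE in ne.
Qed.

Let sum_diagonal_A a psi : (a < k.+1 + l.+1)%N ->
  \sum_(p < K) \sum_(q < L.+1) ((p + (L - q))%N == a)%:R * A p q psi = (-1) ^+ L * v a psi.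
Proof.
move=> aKL.
transitivity (\sum_(p < K) \sum_(q < L.+1)
    ((p : nat) == (a - L)%N)%:R * (((q : nat) == (L - a)%N)%:R * ((-1) ^+ L * v a psi))).
  apply: eq_bigr => p _; apply: eq_bigr => q _; rewrite /A.
  have := ltn_ord q; rewrite ltnS => qL.
  rewrite [LHS]mulrA [RHS]mulrA -!natrM !mulnb.
  have -> : ((p + (L - q))%N == a) && ((p == 0%N :> nat) || (q == 0%N :> nat)) =
      ((p == (a - L)%N :> nat) && (q == (L - a)%N :> nat)) by lia.
  case: eqP => [pa|]; last by rewrite !mul0r.
  case: eqP => [qa|]; last by rewrite !mul0r.
  by have -> : (p + (L - q) = a)%N by lia.
under eq_bigr => p _.
  rewrite -mulr_sumr (sum_delta (fun=> (-1) ^+ L * v a psi)); last by lia.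
  over.
by rewrite (sum_delta (fun=> (-1) ^+ L * v a psi))//; lia.
Qed.

(** Up to the common sign (-1)^L, the three parts of [G] sum along the diagonal to the contraction,
    d_0 v_a and d_1 v_(a-1), which cancel by [fv]. *)
Let sum_diagonal_G a phi : smooth phi -> (a <= k.+1 + l.+1)%N ->
  \sum_(p < K.+1) \sum_(q < L.+1) ((p + (L - q))%N == a)%:R * G p q phi = 0.
Proof.
move=> sphi aKL.
pose i p q : R := ((p + (L - q))%N == a)%:R.
have EF : \sum_(p < K.+1) \sum_(q < L.+1) i p q * F p q phi = (-1) ^+ L * contraction f a phi.
  rewrite (contraction_ones a (F := fun p q => f (ones_tuple K p) (ones_tuple L q) phi)); last first.
    by move=> I J; exact: compact_tensor_ones.
  rewrite mulr_sumr; apply: eq_bigr => p _; rewrite mulr_sumr; apply: eq_bigr => q _.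
  have := ltn_ord q; rewrite ltnS => qL.
  rewrite /F /i.
  have -> : (-1) ^+ L = (-1) ^+ (L - q) * (-1) ^+ q :> R by rewrite -exprD subnK.
  set x := (_ == _)%:R; set e := (-1) ^+ (L - q); set e' := (-1) ^+ q.
  have ee : e * e = 1 by rewrite /e -expr2 sqrr_sign.
  transitivity (x * ('C(K, p)%:R * 'C(L, q)%:R * e' * (e * e) *
    f (ones_tuple K p) (ones_tuple L q) phi)); first by rewrite ee mulr1.
  set y := f _ _ _; ring.
have E0 : \sum_(p < K.+1) \sum_(q < L.+1) i p q * ((p < K)%N%:R * distr_partial 0 (A p q) phi) =
    (-1) ^+ L * (if (a < k.+1 + l.+1)%N then distr_partial 0 (v a) phi else 0).
  rewrite big_ord_recr /= [X in _ + X]big1 ?addr0; last first.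
    by move=> q _; rewrite ltnn mul0r mulr0.
  under eq_bigr => p _ do under eq_bigr => q _ do
    rewrite ltn_ord mul1r /distr_partial mulrN.
  under eq_bigr => p _ do rewrite sumrN.
  rewrite sumrN; case: ifP => aL.
    by rewrite sum_diagonal_A// /distr_partial mulrN.
  rewrite mulr0 big1 ?oppr0// => p _; apply: big1 => q _.
  by rewrite /i (_ : (_ == _) = false) ?mul0r//; have := ltn_ord p; lia.
have E1 : \sum_(p < K.+1) \sum_(q < L.+1) i p q * ((0 < p)%N%:R * distr_partial 1 (A p.-1 q) phi) =
    (-1) ^+ L * (if (0 < a)%N then distr_partial 1 (v a.-1) phi else 0).
  rewrite big_ord_recl /= [X in X + _]big1 ?add0r; last first.
    by move=> q _; rewrite mul0r mulr0.
  under eq_bigr => p _ do under eq_bigr => q _ do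
    rewrite /bump leq0n add1n ?ltn0Sn mul1r /distr_partial mulrN.
  under eq_bigr => p _ do rewrite sumrN.
  rewrite sumrN; case: ifP => a0.
    rewrite /distr_partial mulrN -sum_diagonal_A; last by lia.
    congr (- _); apply: eq_bigr => p _; apply: eq_bigr => q _; rewrite /i /=.
    by congr (_%:R * _); lia.
  rewrite mulr0 big1 ?oppr0// => p _; apply: big1 => q _.
  by rewrite /i (_ : (_ == _) = false) ?mul0r//; lia.
transitivity ((-1) ^+ L * contraction f a phi -
    (-1) ^+ L * (if (a < k.+1 + l.+1)%N then distr_partial 0 (v a) phi else 0) -
    (-1) ^+ L * (if (0 < a)%N then distr_partial 1 (v a.-1) phi else 0)).
  rewrite -EF -E0 -E1 -!sumrB; apply: eq_bigr => p _; rewrite -!sumrB.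
  by apply: eq_bigr => q _; rewrite /G /i -!mulrBr.
rewrite (fv sphi aKL); ring.
Qed.

(** At the end of a diagonal the partial sum is the full one. This vanishing is the solvability
    condition, since w has no component with p = K or q = L. *)
Let B_edge p q phi : smooth phi -> (p <= K)%N -> (q <= L)%N -> (p == K) || (q == L) ->
  B p q phi = 0.
Proof.
move=> sphi pK qL pq.
have aKL : (p + (L - q) <= k.+1 + l.+1)%N by lia.
rewrite -[RHS](sum_diagonal_G sphi aKL) /B.
have widen n n' (x : nat -> R) : (n <= n')%N -> (forall i, (n <= i < n')%N -> x i = 0) ->
    \sum_(i < n) x i = \sum_(i < n') x i.
  move=> nn' x0; rewrite -!(big_mkord xpredT x) [RHS](big_cat_nat (n := n))//=.
  by rewrite [X in _ = _ + X]big_nat_cond [X in _ = _ + X]big1 ?addr0// => i /andP[/x0].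
rewrite (widen p.+1 K.+1 (fun p' => \sum_(q' < q.+1) ((p' + q)%N == (q' + p)%N)%:R * G p' q' phi))//.
- apply: eq_bigr => p' _.
  rewrite (widen q.+1 L.+1 (fun q' => ((p' + q)%N == (q' + p)%N)%:R * G p' q' phi))//.
    apply: eq_bigr => q' _; congr (_%:R * _).
    by have := ltn_ord p'; have := ltn_ord q'; lia.
  move=> q' q'b; rewrite (_ : (_ == _) = false) ?mul0r//.
  by have := ltn_ord p'; lia.
- move=> p' p'b; apply: big1 => q' _; rewrite (_ : (_ == _) = false) ?mul0r//.
  by have := ltn_ord q'; lia.
Qed.

Let B_diff p q phi : B p q phi -
  ((0 < p) && (0 < q))%N%:R * B p.-1 q.-1 phi = G p q phi.
Proof.
case: p => [|p].
  rewrite mul0r subr0 /B big_ord1.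
  under eq_bigr => q' _ do rewrite addn0 add0n eq_sym.
  exact: (sum_delta (fun q' => G 0 q' phi)).
case: q => [|q].
  rewrite andbF mul0r subr0 /B.
  under eq_bigr => p' _ do rewrite big_ord1 addn0 add0n.
  exact: (sum_delta (fun p' => G p' 0 phi)).
rewrite mul1r /= /B big_ord_recr /=.
have -> : \sum_(q' < q.+2) ((p.+1 + q.+1)%N == (q' + p.+1)%N)%:R * G p.+1 q' phi = G p.+1 q.+1 phi.
  under eq_bigr => q' _ do rewrite addnC eqn_add2r eq_sym.
  exact: (sum_delta (fun q' => G p.+1 q' phi)).
under eq_bigr => p' _.
  rewrite big_ord_recr /= (_ : ((p' + q.+1)%N == (q.+1 + p.+1)%N) = false); last first.
    by have := ltn_ord p'; lia.
  rewrite mul0r addr0.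
  under eq_bigr => q' _ do rewrite !addnS eqSS.
  over.
by rewrite addrAC subrr add0r.
Qed.

Let U p q : functional R := fun phi =>
  ('C(k, p)%:R * 'C(L, q)%:R)^-1 * ((-1) ^+ q * A p q phi).

Let W p q : functional R := fun phi =>
  ('C(k, p)%:R * 'C(l, q)%:R)^-1 * ((-1) ^+ q * B p q phi).

Lemma tensor_decomposition : exists (u : tensor R k l.+1) (w : tensor R k l),
    [/\ compact_tensor_distribution u, compact_tensor_distribution w
      & eq_tensor_on setT f (add_tensor (dprime u) (lambda w))].
Proof.
exists (fun I J => U (ones I) (ones J)), (fun I J => W (ones I) (ones J)).
have cU p q : compact_distribution (U p q) by do 2 apply: compact_distributionZ.
have cW p q : compact_distribution (W p q) by do 2 apply: compact_distributionZ.
split.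
- by split => // s I J phi _; rewrite ones_permute.
- by split => // s I J phi _; rewrite ones_permute.
move=> I J phi [sphi _ _]; rewrite /add_tensor.
rewrite (@dprime_ones _ _ _ _ U phi)//.
rewrite (@lambda_ones _ _ _ _ (fun p q => W p q phi))//.
rewrite (compact_tensor_ones cf I J sphi).
have := ones_le I; have := ones_le J; move: (ones I) (ones J) => p q qL pK.
have nz n : n.+1%:R != 0 :> R by rewrite pnatr_eq0.
have bnz n i : (i <= n)%N -> 'C(n, i)%:R != 0 :> R by move=> i_n; rewrite pnatr_eq0 -lt0n bin_gt0.
(* For i = n + 1 the last binomial coefficient is 0 and so is its inverse, which agrees with the
   indicator on the right. *)
have ratio0 n i : (i <= n.+1)%N -> 'C(n.+1, i)%:R * (n.+1 - i)%:R / n.+1%:R / 'C(n, i)%:R =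
    (i < n.+1)%N%:R :> R.
  move=> i_n; rewrite [_ * _%:R]mulrC -natr_bin_down; case: ltnP => h.
    by rewrite [n.+1%:R * _]mulrC mulfK ?nz// divff// bnz.
  by rewrite bin_small// mulr0 !mul0r.
have ratio1 n i : (i <= n.+1)%N -> 'C(n.+1, i)%:R * i%:R / n.+1%:R / 'C(n, i.-1)%:R =
    (0 < i)%N%:R :> R.
  case: i => [|i] i_n; first by rewrite mulr0 !mul0r.
  by rewrite [_ * _%:R]mulrC -natr_bin_diag /= [n.+1%:R * _]mulrC mulfK ?nz// divff// bnz.
have sgn n : (-1) ^+ n * (-1) ^+ n = 1 :> R by rewrite -expr2 sqrr_sign.
have cne : 'C(K, p)%:R * 'C(L, q)%:R * (-1) ^+ q != 0 :> R.
  by rewrite !mulf_neq0 ?bnz// signr_eq0.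
apply: (mulfI cne); rewrite -/(F p q phi) mulrDr.
have HU : 'C(K, p)%:R * 'C(L, q)%:R * (-1) ^+ q * (K%:R^-1 *
    ((K - p)%:R * distr_partial 0 (U p q) phi + p%:R * distr_partial 1 (U p.-1 q) phi)) =
    (p < K)%N%:R * distr_partial 0 (A p q) phi + (0 < p)%N%:R * distr_partial 1 (A p.-1 q) phi.
  rewrite -(ratio0 k p pK) -(ratio1 k p pK) /distr_partial /U !invfM.
  set a0 := A p q _; set a1 := A p.-1 q _.
  have b0 : 'C(L, q)%:R * 'C(L, q)%:R^-1 = 1 :> R by rewrite divff// bnz.
  set e := (-1) ^+ q; have ee : e * e = 1 := sgn q.
  set x := 'C(K, p)%:R; set y := 'C(L, q)%:R in b0 *; set z := K%:R^-1.
  set s := (K - p)%:R; set t0 := 'C(k, p)%:R^-1; set t1 := 'C(k, p.-1)%:R^-1.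
  transitivity ((y / y) * (e * e) * (x * s * z * t0 * - a0 + x * p%:R * z * t1 * - a1)).
    ring.
  by rewrite b0 ee !mul1r.
have HW : 'C(K, p)%:R * 'C(L, q)%:R * (-1) ^+ q * ((K%:R * L%:R)^-1 *
    ((K - p)%:R * (L - q)%:R * W p q phi + p%:R * q%:R * W p.-1 q.-1 phi)) =
    ((p < K) && (q < L))%N%:R * B p q phi - ((0 < p) && (0 < q))%N%:R * B p.-1 q.-1 phi.
  rewrite -!mulnb !natrM -(ratio0 k p pK) -(ratio1 k p pK) -(ratio0 l q qL) -(ratio1 l q qL).
  rewrite /W !invfM.
  set b0 := B p q _; set b1 := B p.-1 q.-1 _.
  set e := (-1) ^+ q; have ee : e * e = 1 := sgn q.
  (* The sign change between q and q - 1 fails at q = 0, where the predecessor is 0; the factor q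
     covers that case. *)
  have ee' : q%:R * (e * (-1) ^+ q.-1) = - q%:R.
    rewrite /e; case: (q) => [|q']; first by rewrite mul0r oppr0.
    by rewrite exprS mulN1r mulNr sgn mulrN1.
  set e' := (-1) ^+ q.-1 in ee' *.
  set x := 'C(K, p)%:R; set y := 'C(L, q)%:R; set z := K%:R^-1; set z' := L%:R^-1.
  set s := (K - p)%:R; set s' := (L - q)%:R.
  set t0 := 'C(k, p)%:R^-1; set t1 := 'C(k, p.-1)%:R^-1.
  set t0' := 'C(l, q)%:R^-1; set t1' := 'C(l, q.-1)%:R^-1.
  transitivity ((e * e) * (x * s * z * t0 * (y * s' * z' * t0') * b0) +
    (q%:R * (e * e')) * (x * p%:R * z * t1 * (y * z' * t1') * b1)); first by ring.
  by rewrite ee ee'; ring.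
rewrite HU HW.
have -> : ((p < K) && (q < L))%N%:R * B p q phi = B p q phi.
  have [pq|pq] := boolP ((p == K) || (q == L)).
    by rewrite (B_edge sphi pK qL pq) mulr0.
  by rewrite (_ : _ && _ = true) ?mul1r//; lia.
rewrite B_diff /G.
set x := _ * distr_partial 0 _ _; set y := _ * distr_partial 1 _ _; ring.
Qed.

End Reconstruction.

(* The ranks k, l >= 1 of the paper are k.+1 and l.+1 here. *)
Theorem theorem2p2 (R : realType) (k l : nat) (U : set 'rV[R]_2)
    (f : tensor R k.+1 l.+1) :
  open U -> U !=set0 ->
  compact_tensor_distribution f ->
  (exists w' : tensor R k l,
     compact_tensor_distribution w' /\ eq_tensor_on U f (lambda w')) ->
  mixed_ray_vanishes_through U f ->
  exists (u : tensor R k l.+1) (w : tensor R k l),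
    [/\ compact_tensor_distribution u, compact_tensor_distribution w
      & eq_tensor_on setT f (add_tensor (dprime u) (lambda w))].
Proof.
move=> oU U0 cf [w' [cw' fU]] fV.
have ch a : compact_distribution (contraction f a).
  by apply: compact_contraction; case: cf.
have H phi : smooth phi -> _ := saint_venant_contraction_eq0 cf oU U0 cw' fU fV (phi := phi).
have [v cv fv] := divide_by_gradient ch H.
exact: (tensor_decomposition cf cv fv).
Qed.
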